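(* Let $A$ be a positive formula of minimal predicate logic, regarded (after renaming its bound variables so that they are pairwise distinct and distinct from its free variables) as the normalized LJB-sequent $\vdash A$ with empty context. Then a term $t$ is a proof-term of the sequent $\vdash A$ in LJ$^{+}$ if and only if there exists a scheme $\pi$ generated by the scheme grammar from the non-terminal $s_{\vdash A}$ such that $t \in \mathcal{H}_{\vdash A}^{\vdash A}(\pi)$.
   Context: Formulas of minimal predicate logic are built from atomic formulas (predicate symbols applied to first-order terms) with $\to$ and $\forall$. Positive/negative formulas: an atomic formula is both positive and negative; $A\to B$ is positive (resp. negative) if $A$ is negative (resp. positive) and $B$ is positive (resp. negative); $\forall x\,A$ is positive if $A$ is positive. Every negative formula has the form $A_1\to\dots\to A_n\to P$ with $P$ atomic and the $A_i$ positive. LJ$^{+}$: a context with named formulae is a finite set of declarations $\alpha:C$ ($\alpha$ a proof variable, distinct from term variables; $C$ a formula), each proof variable declared at most once. Typing rules: (L$\to$) if $\Delta$ contains $\alpha:A_1\to\dots\to A_n\to P$ with $P$ atomic and $\Delta\vdash t_i:A_i$ for all $i$, then $\Delta\vdash(\alpha\,t_1\dots t_n):P$; (R$\forall$) if $\Delta\vdash t:A$ and $x$ is not free in $\Delta$ then $\Delta\vdash\lambda x\,t:\forall x\,A$; (R$\to$) if $\Delta,\alpha:A\vdash t:B$ then $\Delta\vdash\lambda\alpha\,t:A\to B$. $t$ is a proof-term of $\Delta\vdash B$ if $\Delta\vdash t:B$ is derivable. Two LJ$^{+}$-sequents are $\alpha$-equivalent if one is, up to renaming of bound variables, the image of the other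 under an injective renaming of term and proof variables. LJB: an LJB-context is a finite multiset of items; an item is a formula or an expression $[\Gamma]_V$ with $V$ a finite set of term variables (bound by the bracket) and $\Gamma$ an LJB-context. An LJB-sequent is $\Gamma\vdash A$; formulas are not taken modulo $\alpha$-equivalence. An LJB-sequent is normalized if all its bound variables (by quantifiers or brackets) are pairwise distinct and distinct from its free variables. Cleaning rules (applicable anywhere, also inside brackets): $[I,\Gamma]_V\to I,[\Gamma]_V$ if $FV(I)\cap V=\emptyset$; $[\ ]_V\to\emptyset$; $I,I\to I$. $\Gamma{\downarrow}$ is the cleaning normal form of $\Gamma$ obtained by a fixed deterministic strategy; this fixes a reduction sequence from $\Gamma$ to $\Gamma{\downarrow}$. A fixed injective map assigns to every formula $C$ a proof variable, its canonical variable. Schemes (proof-terms of LJB): (L$\to$) if $\Gamma=\Gamma_1,[\Gamma_2,[\dots\Gamma_{i-1},[\Gamma_i,A_1\to\dots\to A_n\to P]_{V_{i-1}}\dots]_{V_2}]_{V_1}$ ($i\ge1$), $P$ atomic with no free variable in $V_1\cup\dots\cup V_{i-1}$, $\Gamma^*=([\dots[[\Gamma_1]_{V_1},\Gamma_2]_{V_2},\dots,\Gamma_{i-1}]_{V_{i-1}},\Gamma_i,A_1\to\dots\to A_n\to P)$, and $\Gamma^*{\downarrow}\vdash\pi_j:A_j$ for all $j$, then $\Gamma\vdash(\alpha\,\pi_1\dots\pi_n):P$ with $\alpha$ the canonical variable of $A_1\to\dots\to A_n\to P$; (R$\forall$) if $[\Gamma]_V{\downarrow}\vdash\pi:A$ where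 $V$ is the set of all variables bound in $\forall x\,A$ (including $x$), then $\Gamma\vdash\lambda x\,\pi:\forall x\,A$; (R$\to$) if $(\Gamma,A){\downarrow}\vdash\pi:B$ then $\Gamma\vdash\lambda\alpha{:}A\,\pi:A\to B$ with $\alpha$ the canonical variable of $A$. $\pi$ is a scheme of $\Gamma\vdash A$ if $\Gamma\vdash\pi:A$ is derivable. Scheme grammar: one non-terminal $s_{S}$ for each LJB-sequent $S$ reachable from $\vdash A$ (finitely many for positive $A$), with productions $s_{\Gamma\vdash P}\to(\alpha\,s_{\Gamma^*{\downarrow}\vdash A_1}\dots s_{\Gamma^*{\downarrow}\vdash A_n})$ for every decomposition of $\Gamma$ as in (L$\to$) above; $s_{\Gamma\vdash\forall x A}\to\lambda x\,s_{[\Gamma]_V{\downarrow}\vdash A}$ ($V$ as in (R$\forall$)); $s_{\Gamma\vdash A\to B}\to\lambda\alpha{:}A\,s_{(\Gamma,A){\downarrow}\vdash B}$. A scheme is generated in $s_S$ if it is a terminal word derivable from $s_S$. Flattening: a fresh $\alpha$-variant of a normalized LJB-sequent is an LJB-sequent obtained from it by an injective renaming of free term variables and renaming of bound variables, in which all bound variables are named differently. A flattening of $\Gamma\vdash A$ is an LJ$^{+}$-sequent obtained by erasing all brackets in a fresh $\alpha$-variant and naming each formula occurrence of the context with a distinct proof variable; each declaration of the flattening corresponds to a formula occurrence of $\Gamma$. Partial duplication: $\Delta\vdash B$ is a partial duplication of $\Sigma\vdash A$ if there are substitutions $\sigma_1,\sigma_2$ with the same domain renaming term variables into fresh distinct variables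 such that for each $\gamma:C$ in $\Sigma$, $\Delta$ contains $\gamma_1:\sigma_1C$ or $\gamma_2:\sigma_2C$ or both, and $B$ is $\sigma_1A$ or $\sigma_2A$. $\mathcal F$: for a proof-term $u$ of $\Sigma\vdash A$ and a partial duplication $\Delta\vdash B$, $\mathcal F_{\Sigma\vdash A}^{\Delta\vdash B}(u)$ is defined by induction on $u$: if $u=(\alpha\,u_1\dots u_n)$ with $\alpha:C_1\to\dots\to C_n\to A$, then for $i\in\{1,2\}$, if $\Delta$ contains $\alpha_i:\sigma_iC_1\to\dots\to\sigma_iC_n\to\sigma_iA$ and $\sigma_iA=B$, it contains all $(\alpha_i\,u'_1\dots u'_n)$ with $u'_j\in\mathcal F_{\Sigma\vdash C_j}^{\Delta\vdash\sigma_iC_j}(u_j)$ (otherwise no term with head $\alpha_i$); if $u=\lambda x\,u_1$, $A=\forall x\,A_1$, $B=\forall x\,B_1$ with $B_1\in\{\sigma_1A_1,\sigma_2A_1\}$, it consists of all $\lambda x\,u'_1$ with $u'_1\in\mathcal F_{\Sigma\vdash A_1}^{\Delta\vdash B_1}(u_1)$; if $u=\lambda\alpha\,u_1$, $A=A_1\to A_2$, $B=B_1\to B_2$ with $B_k\in\{\sigma_1A_k,\sigma_2A_k\}$, it consists of all $\lambda\alpha'\,u'_1$ with $u'_1\in\mathcal F_{\Sigma,\alpha:A_1\vdash A_2}^{\Delta,\alpha':B_1\vdash B_2}(u_1)$. $\mathcal G$: for a normalized LJB-sequent $\Gamma\vdash A$, a flattening $\Delta\vdash B$ of it, a flattening $\Delta'\vdash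 B'$ of $\Gamma{\downarrow}\vdash A$ and a proof-term $u$ of $\Delta'\vdash B'$, $\mathcal G_{\Delta'\vdash B'}^{\Delta\vdash B}(u)$ is defined by induction on the length of the reduction from $\Gamma$ to $\Gamma{\downarrow}$: if $\Gamma=\Gamma{\downarrow}$, it is $\{\sigma u\}$ where $\sigma$ is a renaming making $\Delta'\vdash B'$ $\alpha$-equivalent to $\Delta\vdash B$; if $\Gamma\to\Gamma_1$ in one cleaning step, let $\Delta_1\vdash B_1$ be a flattening of $\Gamma_1\vdash A$ and $S=\mathcal G_{\Delta'\vdash B'}^{\Delta_1\vdash B_1}(u)$; if the step uses $[\ ]_V\to\emptyset$ or $[I,\Gamma]_V\to I,[\Gamma]_V$, then $\Delta\vdash B$ is $\alpha$-equivalent to $\Delta_1\vdash B_1$ via a renaming $\sigma$ and the result is $\{\sigma t\mid t\in S\}$; if it uses $I,I\to I$, then $\Delta\vdash B$ is a partial duplication of $\Delta_1\vdash B_1$ and the result is $\bigcup_{t\in S}\mathcal F_{\Delta_1\vdash B_1}^{\Delta\vdash B}(t)$. $\mathcal H$: for a normalized LJB-sequent $\Gamma\vdash A$, a flattening $\Delta\vdash B$ and a scheme $\pi$ of $\Gamma\vdash A$, $\mathcal H_{\Gamma\vdash A}^{\Delta\vdash B}(\pi)$ is defined by induction on $\pi$: (i) if $\pi=(\alpha\,\pi_1\dots\pi_n)$ with $\alpha$ canonical of type $A_1\to\dots\to A_n\to A$, select the occurrences of $A_1\to\dots\to A_n\to A$ in $\Gamma$ to which (L$\to$) applies and such that each $\pi_i$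 is a scheme of $\Gamma^*{\downarrow}\vdash A_i$ for the resulting $\Gamma^*$; for each, let $\alpha':B_1\to\dots\to B_n\to B$ be the corresponding declaration of $\Delta$ (then $\Delta\vdash B_i$ is a flattening of $\Gamma^*\vdash A_i$), choose a flattening $\Delta'\vdash B'_i$ of $\Gamma^*{\downarrow}\vdash A_i$, and let $S'_i=\bigcup_{t\in\mathcal H_{\Gamma^*{\downarrow}\vdash A_i}^{\Delta'\vdash B'_i}(\pi_i)}\mathcal G_{\Delta'\vdash B'_i}^{\Delta\vdash B_i}(t)$; $\mathcal H(\pi)$ is the set of all $(\alpha'\,t_1\dots t_n)$ with $\alpha'$ for a selected occurrence and $t_i\in S'_i$. (ii) If $\pi=\lambda x\,\pi_1$, $A=\forall x\,A_1$, $B=\forall y\,B_1$ ($\Delta\vdash B_1$ is a flattening of $[\Gamma]_V\vdash A_1$), choose a flattening $\Delta'\vdash B'_1$ of $[\Gamma]_V{\downarrow}\vdash A_1$; $\mathcal H(\pi)=\{\lambda y\,t\mid t\in\bigcup_{s\in\mathcal H_{[\Gamma]_V{\downarrow}\vdash A_1}^{\Delta'\vdash B'_1}(\pi_1)}\mathcal G_{\Delta'\vdash B'_1}^{\Delta\vdash B_1}(s)\}$. (iii) If $\pi=\lambda\alpha{:}A_1\,\pi_1$, $A=A_1\to A_2$, $B=B_1\to B_2$ ($\Delta,\alpha':B_1\vdash B_2$ is a flattening of $\Gamma,A_1\vdash A_2$), choose a flattening $\Delta'\vdash B'_2$ of $(\Gamma,A_1){\downarrow}\vdash A_2$; $\mathcal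 H(\pi)=\{\lambda\alpha'{:}B_1\,t\mid t\in\bigcup_{s\in\mathcal H_{(\Gamma,A_1){\downarrow}\vdash A_2}^{\Delta'\vdash B'_2}(\pi_1)}\mathcal G_{\Delta'\vdash B'_2}^{\Delta,\alpha':B_1\vdash B_2}(s)\}$. *)

(* Defs.v *)
From Stdlib Require Import ClassicalEpsilon Relation_Operators.
From mathcomp Require Import all_boot.
From mathcomp Require Import finmap zify.

Set Implicit Arguments.
Unset Strict Implicit.
Unset Printing Implicit Defensive.

Local Open Scope fset_scope.

Notation var := nat (only parsing).
Notation pvar := nat (only parsing).

Record signature := Signature {
  fsym : Type;
  far : fsym -> nat;
  psym : Type;
  par : psym -> nat
}.

Inductive term (Sg : signature) (X : Type) : Type :=
| TVar of X
| TApp (f : fsym Sg) of {ffun 'I_(far f) -> term Sg X}.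

Fixpoint tmap Sg X Y (g : X -> Y) (t : term Sg X) : term Sg Y :=
  match t with
  | TVar x => TVar Sg (g x)
  | TApp f ts => TApp [ffun i => tmap g (ts i)]
  end.

Fixpoint tvars Sg X (t : term Sg X) : seq X :=
  match t with
  | TVar x => [:: x]
  | TApp f ts => flatten [seq tvars (ts i) | i <- enum 'I_(far f)]
  end.

Inductive form (Sg : signature) : Type :=
| Atom (p : psym Sg) of {ffun 'I_(par p) -> term Sg var}
| Imp of form Sg & form Sg
| All of var & form Sg.

(* Lists returned by [fv] and [lfv] are used as sets; those returned by [bv]
   list one entry per binder. *)
Fixpoint fv Sg (A : form Sg) : seq var :=
  match A with
  | Atom p ts => flatten [seq tvars (ts i) | i <- enum 'I_(par p)]
  | Imp A B => fv A ++ fv B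
  | All x A => [seq y <- fv A | y != x]
  end.

Fixpoint bv Sg (A : form Sg) : seq var :=
  match A with
  | Atom _ _ => [::]
  | Imp A B => bv A ++ bv B
  | All x A => x :: bv A
  end.

Definition atomic Sg (A : form Sg) : bool :=
  if A is Atom _ _ then true else false.

(* [polarity true] is "positive", [polarity false] is "negative". *)
Fixpoint polarity Sg (b : bool) (A : form Sg) : bool :=
  match A with
  | Atom _ _ => true
  | Imp A B => polarity (~~ b) A && polarity b B
  | All _ A => b && polarity b A
  end.

Definition positive Sg (A : form Sg) := polarity true A.

Definition imps Sg (As : seq (form Sg)) (P : form Sg) : form Sg :=
  foldr (@Imp Sg) P As.

(* LJ+ identifies formulas and proof-terms that differ only by the names of
   their bound variables.  Such classes are represented with free variables
   as names ([inl]) and bound variables as de Bruijn indices ([inr]). *)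

Inductive lform (Sg : signature) : Type :=
| LAtom (p : psym Sg) of {ffun 'I_(par p) -> term Sg (var + nat)}
| LImp of lform Sg & lform Sg
| LAll of lform Sg.

(* Turns the name [x] into the index [k]; dangling indices are shifted, so that
   they cannot be captured by the new binder. *)
Definition bind_name (k : nat) (x : nat) (v : nat + nat) : nat + nat :=
  match v with
  | inl y => if y == x then inr k else inl y
  | inr j => if j < k then inr j else inr j.+1
  end.

Definition ren_name (r : nat -> nat) (v : nat + nat) : nat + nat :=
  match v with inl y => inl (r y) | inr j => inr j end.

Fixpoint lbind Sg (k : nat) (x : var) (A : lform Sg) : lform Sg :=
  match A with
  | LAtom p ts => LAtom [ffun i => tmap (bind_name k x) (ts i)]
  | LImp A B => LImp (lbind k x A) (lbind k x B)
  | LAll A => LAll (lbind k.+1 x A)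
  end.

(* [forall x A] *)
Definition lall Sg (x : var) (A : lform Sg) : lform Sg := LAll (lbind 0 x A).

(* The class of a named formula: [ln A = ln B] is alpha-equivalence. *)
Fixpoint ln Sg (A : form Sg) : lform Sg :=
  match A with
  | Atom p ts => LAtom [ffun i => tmap inl (ts i)]
  | Imp A B => LImp (ln A) (ln B)
  | All x A => lall x (ln A)
  end.

Fixpoint lren Sg (r : var -> var) (A : lform Sg) : lform Sg :=
  match A with
  | LAtom p ts => LAtom [ffun i => tmap (ren_name r) (ts i)]
  | LImp A B => LImp (lren r A) (lren r B)
  | LAll A => LAll (lren r A)
  end.

Definition free_names (s : seq (nat + nat)) : seq nat :=
  pmap (fun v : nat + nat => if v is inl x then Some x else None) s.

Fixpoint lfv Sg (A : lform Sg) : seq var :=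
  match A with
  | LAtom p ts => flatten [seq free_names (tvars (ts i)) | i <- enum 'I_(par p)]
  | LImp A B => lfv A ++ lfv B
  | LAll A => lfv A
  end.

Definition latomic Sg (A : lform Sg) : bool :=
  if A is LAtom _ _ then true else false.

Definition limps Sg (As : seq (lform Sg)) (P : lform Sg) : lform Sg :=
  foldr (@LImp Sg) P As.

(* In [lambda x t] the term variable [x] never occurs in [t], because (L->)
   instantiates no quantifier: the binder [PAll] needs no name. *)
Inductive pterm : Type :=
| PApp of pvar + nat & seq pterm
| PAll of pterm
| PLam of pterm.

Fixpoint pbind (k : nat) (a : pvar) (t : pterm) : pterm :=
  match t with
  | PApp h ts => PApp (bind_name k a h) [seq pbind k a u | u <- ts]
  | PAll t => PAll (pbind k a t)
  | PLam t => PLam (pbind k.+1 a t)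
  end.

(* [lambda alpha t] *)
Definition plam (a : pvar) (t : pterm) : pterm := PLam (pbind 0 a t).

Fixpoint pren (r : pvar -> pvar) (t : pterm) : pterm :=
  match t with
  | PApp h ts => PApp (ren_name r h) [seq pren r u | u <- ts]
  | PAll t => PAll (pren r t)
  | PLam t => PLam (pren r t)
  end.

(* A context is a finite set of declarations, given by a list. *)
Definition lctx (Sg : signature) := seq (pvar * lform Sg).

Definition lseq (Sg : signature) := (lctx Sg * lform Sg)%type.

Definition dom Sg (D : lctx Sg) : seq pvar := [seq d.1 | d <- D].

Definition lfv_ctx Sg (D : lctx Sg) : seq var := flatten [seq lfv d.2 | d <- D].

Definition lfv_seq Sg (S : lseq Sg) : seq var := lfv_ctx S.1 ++ lfv S.2.

Inductive ljp (Sg : signature) : lctx Sg -> pterm -> lform Sg -> Prop :=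
| ljp_L D a As P ts :
    List.In (a, limps As P) D -> latomic P -> size ts = size As ->
    (forall i A t, onth As i = Some A -> onth ts i = Some t -> ljp D t A) ->
    ljp D (PApp (inl a) ts) P
| ljp_Rall D t x A :
    ljp D t A -> x \notin lfv_ctx D -> ljp D (PAll t) (lall x A)
| ljp_Rimp D a A t B :
    a \notin dom D -> ljp (rcons D (a, A)) t B -> ljp D (plam a t) (LImp A B).

Definition same_decls Sg (D E : lctx Sg) : Prop :=
  forall d, List.In d D <-> List.In d E.

(* The renaming [r] = (term variables, proof variables) makes [S]
   alpha-equivalent to [T]. *)
Definition alpha_via Sg (r : (var -> var) * (pvar -> pvar)) (S T : lseq Sg) : Prop :=
  [/\ {in lfv_seq S &, injective r.1},
      {in dom S.1 &, injective r.2},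
      same_decls T.1 [seq (r.2 d.1, lren r.1 d.2) | d <- S.1]
    & T.2 = lren r.1 S.2].

(* Multisets of items are given by lists.  Every rule acts at arbitrary
   positions and repeated items are recognized up to reordering ([ieq]). *)

Inductive item (Sg : signature) : Type :=
| Leaf of form Sg
| Br of {fset var} & seq (item Sg).

Definition ctx (Sg : signature) := seq (item Sg).

Definition bseq (Sg : signature) := (ctx Sg * form Sg)%type.

Fixpoint fv_item Sg (I : item Sg) : seq var :=
  match I with
  | Leaf C => fv C
  | Br V G => [seq x <- flatten [seq fv_item J | J <- G] | x \notin V]
  end.

Definition fv_ctx Sg (G : ctx Sg) : seq var := flatten [seq fv_item J | J <- G].

Definition fv_seq Sg (S : bseq Sg) : seq var := fv_ctx S.1 ++ fv S.2.

Fixpoint bv_item Sg (I : item Sg) : seq var :=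
  match I with
  | Leaf C => bv C
  | Br V G => enum_fset V ++ flatten [seq bv_item J | J <- G]
  end.

Definition bv_seq Sg (S : bseq Sg) : seq var :=
  flatten [seq bv_item J | J <- S.1] ++ bv S.2.

Definition normalized Sg (S : bseq Sg) : bool :=
  uniq (bv_seq S) && all (fun x => x \notin fv_seq S) (bv_seq S).

Fixpoint leaves_item Sg (I : item Sg) : seq (form Sg) :=
  match I with
  | Leaf C => [:: C]
  | Br _ G => flatten [seq leaves_item J | J <- G]
  end.

Definition leaves Sg (G : ctx Sg) : seq (form Sg) :=
  flatten [seq leaves_item J | J <- G].

Inductive ieq (Sg : signature) : item Sg -> item Sg -> Prop :=
| ieq_leaf C : ieq (Leaf C) (Leaf C)
| ieq_br V G H : ceq G H -> ieq (Br V G) (Br V H)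
with ceq (Sg : signature) : ctx Sg -> ctx Sg -> Prop :=
| ceq_nil : ceq [::] [::]
| ceq_cons I J G a b :
    ieq I J -> ceq G (a ++ b) -> ceq (I :: G) (a ++ J :: b).

(* [clean d G H]: one cleaning step from [G] to [H]; the flag [d] tells whether
   it uses the rule [I, I -> I]. *)
Inductive clean (Sg : signature) : bool -> ctx Sg -> ctx Sg -> Prop :=
| clean_out a b V c I d :
    all (fun x => x \notin V) (fv_item I) ->
    clean false (a ++ Br V (c ++ I :: d) :: b) (a ++ I :: Br V (c ++ d) :: b)
| clean_empty a b V :
    clean false (a ++ Br V [::] :: b) (a ++ b)
| clean_dup a b c I J :
    ieq I J -> clean true (a ++ I :: b ++ J :: c) (a ++ I :: b ++ c)
| clean_in e a b V G H :
    clean e G H -> clean e (a ++ Br V G :: b) (a ++ Br V H :: b).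

Definition strategy (Sg : signature) := ctx Sg -> option (bool * ctx Sg).

Definition strategyP Sg (next : strategy Sg) : Prop :=
  forall G, match next G with
            | Some (d, H) => clean d G H
            | None => forall d H, ~ clean d G H
            end.

(* The sum over all items, at any depth, of one plus their bracket depth: it
   decreases at each cleaning step. *)
Fixpoint weight_item Sg (d : nat) (I : item Sg) : nat :=
  match I with
  | Leaf _ => d.+1
  | Br _ G => d.+1 + sumn [seq weight_item d.+1 J | J <- G]
  end.

Definition weight Sg (d : nat) (G : ctx Sg) : nat :=
  sumn [seq weight_item d J | J <- G].

Definition clean_step Sg (next : strategy Sg) (G : ctx Sg) : ctx Sg :=
  if next G is Some (_, H) then H else G.

(* The cleaning normal form; see [cleanedP]. *)
Definition cleaned Sg (next : strategy Sg) (G : ctx Sg) : ctx Sg :=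
  iter (weight 0 G) (clean_step next) G.

Lemma weight_itemS Sg d (I : item Sg) : weight_item d I < weight_item d.+1 I.
Proof.
move: I d; fix IH 1 => -[C|V G] d //=.
suff : sumn [seq weight_item d.+1 J | J <- G]
         <= sumn [seq weight_item d.+2 J | J <- G] by lia.
by elim: G => [|J G IHG] //=; have := IH J d.+1; lia.
Qed.

Lemma clean_weight Sg e (G H : ctx Sg) d : clean e G H -> weight d H < weight d G.
Proof.
move=> c; elim: c d => {e G H} [a b V c I f _|a b V|a b c I J _|e a b V G H _ IH] d;
  rewrite /weight; do 4! rewrite ?map_cat ?sumn_cat /=.
- by have := weight_itemS d I; lia.
- by lia.
- by have : 0 < weight_item d J by [case: J]; lia.
- by have := IH d.+1; rewrite /weight; lia.
Qed.

Lemma cleanedP Sg (next : strategy Sg) (G : ctx Sg) :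
  strategyP next -> next (cleaned next G) = None.
Proof.
move=> nextP; rewrite /cleaned; move: (leqnn (weight 0 G)).
move: {-1}(weight 0 G) => n; elim: n G => [|n IH] G le_n.
  rewrite /=; have := nextP G; case: (next G) => [[d H] /(clean_weight 0)|//].
  by lia.
rewrite iterSr; have := nextP G; case E: (next G) => [[d H]|] GH.
  rewrite [X in iter _ _ X]/clean_step E; apply: IH.
  by have := clean_weight 0 GH; lia.
rewrite [X in iter _ _ X]/clean_step E (_ : iter n _ G = G) //.
by elim: n {IH le_n} => //= n ->; rewrite /clean_step E.
Qed.

Lemma strategy_exists Sg : exists next : strategy Sg, strategyP next.
Proof.
exists (fun G => match excluded_middle_informative
                   (exists p : bool * ctx Sg, clean p.1 G p.2) with
                 | left h => Some (proj1_sig (constructive_indefinite_description _ h))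
                 | right _ => None
                 end) => G.
case: excluded_middle_informative => [h|h].
  by case: constructive_indefinite_description => -[].
by move=> d H c; apply: h; exists (d, H).
Qed.

Inductive scheme (Sg : signature) : Type :=
| SApp of pvar & seq (scheme Sg)
| SAll of var & scheme Sg
| SLam of pvar & form Sg & scheme Sg.

(* [focus acc G k V C Gs]: the [k]-th formula occurrence of [G] is [C], it lies
   under brackets whose variables form [V], and, for [acc = [::]], [Gs] is the
   context Gamma* of the rule (L->) for this occurrence.  The accumulator holds
   the bracketed outer part [..[G_1]_{V_1} .. , G_{j-1}]_{V_{j-1}}. *)
Inductive focus (Sg : signature) (acc : ctx Sg) :
  ctx Sg -> nat -> {fset var} -> form Sg -> ctx Sg -> Prop :=
| focus_here a b C :
    focus acc (a ++ Leaf C :: b) (size (leaves a)) fset0 C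
      (acc ++ a ++ b ++ [:: Leaf C])
| focus_in a b V G k W C Gs :
    focus [:: Br V (acc ++ a ++ b)] G k W C Gs ->
    focus acc (a ++ Br V G :: b) (size (leaves a) + k) (V `|` W) C Gs.

(* (L->) applies to the [k]-th formula occurrence [As -> P] of [G], with
   Gamma* equal to [Gs]. *)
Definition left_rule Sg (G : ctx Sg) (k : nat) (As : seq (form Sg)) (P : form Sg)
    (Gs : ctx Sg) : Prop :=
  exists V, [/\ focus [::] G k V (imps As P) Gs, atomic P
              & all (fun x => x \notin V) (fv P)].

Definition bracket_all Sg (G : ctx Sg) (x : var) (A : form Sg) : ctx Sg :=
  [:: Br [fset y in bv (All x A)] G].

Inductive scheme_of (Sg : signature) (canon : form Sg -> pvar) (next : strategy Sg) :
  ctx Sg -> form Sg -> scheme Sg -> Prop :=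
| scheme_L G k As P Gs ps :
    left_rule G k As P Gs -> size ps = size As ->
    (forall i A p, onth As i = Some A -> onth ps i = Some p ->
       scheme_of canon next (cleaned next Gs) A p) ->
    scheme_of canon next G P (SApp (canon (imps As P)) ps)
| scheme_Rall G x A p :
    scheme_of canon next (cleaned next (bracket_all G x A)) A p ->
    scheme_of canon next G (All x A) (SAll x p)
| scheme_Rimp G A B p :
    scheme_of canon next (cleaned next (rcons G (Leaf A))) B p ->
    scheme_of canon next G (Imp A B) (SLam (canon A) A p).

(* Sentential forms of the grammar; [NT S] is the non-terminal s_S. *)
Inductive word (Sg : signature) : Type :=
| NT of bseq Sg
| WApp of pvar & seq (word Sg)
| WAll of var & word Sg
| WLam of pvar & form Sg & word Sg.

Fixpoint terminal Sg (p : scheme Sg) : word Sg :=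
  match p with
  | SApp a ps => WApp a [seq terminal q | q <- ps]
  | SAll x p => WAll x (terminal p)
  | SLam a A p => WLam a A (terminal p)
  end.

Fixpoint nonterminals Sg (w : word Sg) : seq (bseq Sg) :=
  match w with
  | NT T => [:: T]
  | WApp _ ws => flatten [seq nonterminals v | v <- ws]
  | WAll _ w => nonterminals w
  | WLam _ _ w => nonterminals w
  end.

Inductive production (Sg : signature) (canon : form Sg -> pvar) (next : strategy Sg) :
  bseq Sg -> word Sg -> Prop :=
| prod_L G k As P Gs :
    left_rule G k As P Gs ->
    production canon next (G, P)
      (WApp (canon (imps As P)) [seq NT (cleaned next Gs, A) | A <- As])
| prod_Rall G x A :
    production canon next (G, All x A)
      (WAll x (NT (cleaned next (bracket_all G x A), A)))
| prod_Rimp G A B :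
    production canon next (G, Imp A B)
      (WLam (canon A) A (NT (cleaned next (rcons G (Leaf A)), B))).

Inductive reachable (Sg : signature) (canon : form Sg -> pvar) (next : strategy Sg)
    (S0 : bseq Sg) : bseq Sg -> Prop :=
| reach_init : reachable canon next S0 S0
| reach_step S w T :
    reachable canon next S0 S -> production canon next S w ->
    List.In T (nonterminals w) -> reachable canon next S0 T.

Inductive derives1 (Sg : signature) (canon : form Sg -> pvar) (next : strategy Sg)
    (S0 : bseq Sg) : word Sg -> word Sg -> Prop :=
| derives_NT S w :
    reachable canon next S0 S -> production canon next S w ->
    derives1 canon next S0 (NT S) w
| derives_App a us v w vs :
    derives1 canon next S0 v w ->
    derives1 canon next S0 (WApp a (us ++ v :: vs)) (WApp a (us ++ w :: vs))
| derives_All x v w :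
    derives1 canon next S0 v w -> derives1 canon next S0 (WAll x v) (WAll x w)
| derives_Lam a A v w :
    derives1 canon next S0 v w ->
    derives1 canon next S0 (WLam a A v) (WLam a A w).

Definition generated Sg (canon : form Sg -> pvar) (next : strategy Sg)
    (S0 : bseq Sg) (p : scheme Sg) : Prop :=
  clos_refl_trans _ (derives1 canon next S0) (NT S0) (terminal p).

(* [ivariant r I J]: [J] is obtained from [I] by applying [r] to the free term
   variables and renaming the bound ones. *)
Inductive ivariant (Sg : signature) (r : var -> var) : item Sg -> item Sg -> Prop :=
| ivariant_leaf C D : ln D = lren r (ln C) -> ivariant r (Leaf C) (Leaf D)
| ivariant_br (r' : var -> var) V G H :
    {in fv_item (Br V G), r' =1 r} ->
    {in enum_fset V ++ fv_ctx G &, injective r'} ->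
    cvariant r' G H ->
    ivariant r (Br V G) (Br [fset r' x | x in V] H)
with cvariant (Sg : signature) (r : var -> var) : ctx Sg -> ctx Sg -> Prop :=
| cvariant_nil : cvariant r [::] [::]
| cvariant_cons I J G H :
    ivariant r I J -> cvariant r G H -> cvariant r (I :: G) (J :: H).

(* Only the variant [T] has to be normalized: after (L->) the quantifiers of the
   goal also occur in the context, and after (R forall) a bracket may bind a
   variable that is free in the goal. *)
Definition fresh_variant Sg (S T : bseq Sg) : Prop :=
  normalized T /\
  exists r : var -> var,
    [/\ {in fv_seq S &, injective r}, cvariant r S.1 T.1 & ln T.2 = lren r (ln S.2)].

(* The [k]-th declaration of a flattening corresponds to the [k]-th formula
   occurrence of the LJB-context. *)
Definition flattening Sg (S : bseq Sg) (F : lseq Sg) : Prop :=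
  exists T : bseq Sg,
    [/\ fresh_variant S T, uniq (dom F.1),
        [seq d.2 | d <- F.1] = [seq ln C | C <- leaves T.1] & F.2 = ln T.2].

(* [dup_sub true], [dup_sub false] are sigma_1, sigma_2, with domain [dup_dom];
   [(c, i, d)] is in [dup_names] when [d] is the variable c_i. *)
Record dup_data := DupData {
  dup_dom : {fset var};
  dup_sub : bool -> var -> var;
  dup_names : seq (pvar * bool * pvar)
}.

Definition renames_apart (d : dup_data) (avoid : seq var) : Prop :=
  [/\ forall i x, x \notin dup_dom d -> dup_sub d i x = x,
      forall i x, x \in dup_dom d ->
        (dup_sub d i x \notin dup_dom d) && (dup_sub d i x \notin avoid)
    & forall i j x y, x \in dup_dom d -> y \in dup_dom d ->
        dup_sub d i x = dup_sub d j y -> i = j /\ x = y].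

Definition names_apart (d : dup_data) : Prop :=
  (forall c i a b, (c, i, a) \in dup_names d -> (c, i, b) \in dup_names d -> a = b) /\
  (forall c c' i i' a, (c, i, a) \in dup_names d -> (c', i', a) \in dup_names d ->
     c = c' /\ i = i').

Definition partial_dup Sg (d : dup_data) (S T : lseq Sg) : Prop :=
  [/\ renames_apart d (lfv_seq S), names_apart d,
      forall c, c \in dom S.1 -> exists i a, (c, i, a) \in dup_names d,
      forall a C, List.In (a, C) T.1 <->
        exists c i C0, [/\ List.In (c, C0) S.1, (c, i, a) \in dup_names d
                         & C = lren (dup_sub d i) C0]
    & exists i, T.2 = lren (dup_sub d i) S.2].

Definition add_name (d : dup_data) (n : pvar * bool * pvar) : dup_data :=
  DupData (dup_dom d) (dup_sub d) (n :: dup_names d).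

(* [inF d (S, A) (D, B) u u']: [u'] belongs to F_{S |- A}^{D |- B}(u). *)
Inductive inF (Sg : signature) : dup_data -> lseq Sg -> lseq Sg -> pterm -> pterm -> Prop :=
| inF_L d S D a i a' Cs A us us' :
    latomic A -> List.In (a, limps Cs A) S ->
    (a, i, a') \in dup_names d ->
    List.In (a', lren (dup_sub d i) (limps Cs A)) D ->
    size us = size Cs -> size us' = size Cs ->
    (forall j C u u', onth Cs j = Some C -> onth us j = Some u -> onth us' j = Some u' ->
       inF d (S, C) (D, lren (dup_sub d i) C) u u') ->
    inF d (S, A) (D, lren (dup_sub d i) A) (PApp (inl a) us) (PApp (inl a') us')
| inF_Rall d S D x A1 i u u' :
    x \notin lfv_ctx S -> x \notin lfv_ctx D ->
    x \notin dup_dom d -> (forall j y, y \in dup_dom d -> dup_sub d j y != x) ->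
    inF d (S, A1) (D, lren (dup_sub d i) A1) u u' ->
    inF d (S, lall x A1) (D, lall x (lren (dup_sub d i) A1)) (PAll u) (PAll u')
| inF_Rimp d S D a a' A1 A2 i j u u' :
    a \notin dom S -> a' \notin dom D ->
    (forall n, n \in dup_names d -> n.1.1 != a /\ n.2 != a') ->
    inF (add_name d (a, i, a'))
      (rcons S (a, A1), A2)
      (rcons D (a', lren (dup_sub d i) A1), lren (dup_sub d j) A2) u u' ->
    inF d (S, LImp A1 A2) (D, LImp (lren (dup_sub d i) A1) (lren (dup_sub d j) A2))
      (plam a u) (plam a' u').

(* Each "choose a flattening / a renaming such that ..." is Hilbert's epsilon. *)

Definition choose_flattening Sg (S : bseq Sg) : lseq Sg :=
  epsilon (inhabits ([::], ln S.2)) (flattening S).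

Definition choose_renaming Sg (S T : lseq Sg) : (var -> var) * (pvar -> pvar) :=
  epsilon (inhabits (id, id)) (fun r => alpha_via r S T).

(* A flattening of [S] of which [T] is a partial duplication. *)
Definition choose_dup Sg (S : bseq Sg) (T : lseq Sg) : lseq Sg * dup_data :=
  epsilon (inhabits (([::], ln S.2), DupData fset0 (fun _ => id) [::]))
    (fun p => flattening S p.1 /\ partial_dup p.2 p.1 T).

(* [G = cleaned next G] exactly when [next G = None].
   [inG next G A T T' u t]: [t] belongs to G_{T'}^{T}(u), where [T] and [T'] are
   flattenings of [G |- A] and of its cleaned form. *)
Inductive inG (Sg : signature) (next : strategy Sg) :
  ctx Sg -> form Sg -> lseq Sg -> lseq Sg -> pterm -> pterm -> Prop :=
| inG_nf G A T T' u :
    next G = None -> inG next G A T T' u (pren (choose_renaming T' T).2 u)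
| inG_ren G G1 A T T' u t (T1 := choose_flattening (G1, A)) :
    next G = Some (false, G1) ->
    inG next G1 A T1 T' u t ->
    inG next G A T T' u (pren (choose_renaming T1 T).2 t)
| inG_dup G G1 A T T' u t t' (c := choose_dup (G1, A) T) :
    next G = Some (true, G1) ->
    inG next G1 A c.1 T' u t ->
    inF c.2 c.1 T t t' ->
    inG next G A T T' u t'.

(* Supplies the names that represent the bound variables opened by H. *)
Definition fresh (s : seq nat) : nat := (foldr maxn 0 s).+1.

(* [inH canon next G A (D, B) p t]: [t] belongs to H_{G |- A}^{D |- B}(p). *)
Inductive inH (Sg : signature) (canon : form Sg -> pvar) (next : strategy Sg) :
  ctx Sg -> form Sg -> lseq Sg -> scheme Sg -> pterm -> Prop :=
| inH_L G k As A Gs D a' Bs B ps ss ts (Gc := cleaned next Gs) :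
    left_rule G k As A Gs ->
    size ps = size As ->
    (forall i Ai p, onth As i = Some Ai -> onth ps i = Some p ->
       scheme_of canon next Gc Ai p) ->
    onth D k = Some (a', limps Bs B) ->
    size Bs = size As -> size ss = size As -> size ts = size As ->
    (forall i Ai p s, onth As i = Some Ai -> onth ps i = Some p -> onth ss i = Some s ->
       inH canon next Gc Ai (choose_flattening (Gc, Ai)) p s) ->
    (forall i Ai Bi s t, onth As i = Some Ai -> onth Bs i = Some Bi ->
       onth ss i = Some s -> onth ts i = Some t ->
       inG next Gs Ai (D, Bi) (choose_flattening (Gc, Ai)) s t) ->
    inH canon next G A (D, B) (SApp (canon (imps As A)) ps) (PApp (inl a') ts)
| inH_Rall G x A1 D B B1 p s t (y := fresh (lfv_seq (D, B)))
    (Gv := bracket_all G x A1) (Gc := cleaned next Gv) :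
    B = lall y B1 ->
    inH canon next Gc A1 (choose_flattening (Gc, A1)) p s ->
    inG next Gv A1 (D, B1) (choose_flattening (Gc, A1)) s t ->
    inH canon next G (All x A1) (D, B) (SAll x p) (PAll t)
| inH_Rimp G A1 A2 D B1 B2 p s t (a' := fresh (dom D))
    (Ga := rcons G (Leaf A1)) (Gc := cleaned next Ga) :
    inH canon next Gc A2 (choose_flattening (Gc, A2)) p s ->
    inG next Ga A2 (rcons D (a', B1), B2) (choose_flattening (Gc, A2)) s t ->
    inH canon next G (Imp A1 A2) (D, LImp B1 B2) (SLam (canon A1) A1 p) (plam a' t).

(* Main.v *)
(** A bracket of an LJB-context cuts its formula occurrences into those inside and
    those outside; call two occurrences (the goal included, outside all brackets)
    linked for [x] when no bracket binding [x] separates them.  A flattening is the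
    same thing as a naming of the free variables of all occurrences that identifies
    exactly the linked occurrences of a variable.  Hence two flattenings of a
    sequent differ by a renaming; the cleaning rules other than [I, I -> I] preserve
    links; the passage from Gamma to Gamma* only moves the root of the tree of
    brackets, which complements some cuts and also preserves links; and [I, I -> I]
    is undone by a partial duplication.  Every step of H, G and F can then be
    inverted on proof-terms without changing their size, and soundness and
    completeness follow by induction. *)

From Stdlib Require Import Eqdep ClassicalEpsilon Relation_Operators.
From mathcomp Require Import all_boot.
From mathcomp Require Import finmap zify.
Require Import Defs.

Set Implicit Arguments.
Unset Strict Implicit.
Unset Printing Implicit Defensive.

(** * Names and formulas up to alpha-equivalence *)

(** Normalization is not inherited by premises: after (L->) the goal shares its quantifiers with the
    context, and a bracket opened by (R forall) may bind a variable free in the goal. What is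
    inherited is that every single formula has distinct bound variables, none of them free in it
    ([good]). This is enough: of all the variables bound by the new bracket, only the quantified one
    can then be free in the new goal. Links do not depend on the variant chosen, so any two
    flattenings are related by a renaming and the Hilbert choices in G and H meet their
    specifications. Cleaning and re-rooting permute the occurrences, whereas H finds the head of a
    term by its position; so G is analysed for flattenings up to order ([flat]), and H for literal
    ones. In completeness, the term passed to the induction hypothesis is not a subterm of the given
    one but the preimage of a subterm under G, over another flattening. Its size is the measure that
    survives this passage. *)

Lemma In_cat T (x : T) s t : List.In x (s ++ t) <-> List.In x s \/ List.In x t.
Proof. exact: List.in_app_iff. Qed.

Lemma In_map T U (f : T -> U) y s :
  List.In y (map f s) <-> exists2 x, List.In x s & y = f x.
Proof.
elim: s y => [|x s IH] y /=; first by split=> [|[]].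
split=> [[<-|/IH[z zs ->]]|[z [<-|zs] ->]].
- by exists x; [left|].
- by exists z; [right|].
- by left.
- by right; apply/IH; exists z.
Qed.

Lemma In_flatten_map T U (f : T -> seq U) y s :
  List.In y (flatten (map f s)) <-> exists2 x, List.In x s & List.In y (f x).
Proof.
elim: s => [|x s IH] /=; first by split=> [|[]].
rewrite In_cat IH; split=> [[yx|[z zs yz]]|[z [<-|zs] yz]].
- by exists x; [left|].
- by exists z; [right|].
- by left.
- by right; exists z.
Qed.

Lemma In_rcons T (x y : T) s : List.In x (rcons s y) <-> List.In x s \/ x = y.
Proof. by rewrite -cats1 In_cat /=; intuition. Qed.

Lemma eq_map_In T U (f g : T -> U) s :
  (forall x, List.In x s -> f x = g x) -> map f s = map g s.
Proof.
elim: s => //= x s IH fg; rewrite fg ?IH //; last by left.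
by move=> y ys; apply: fg; right.
Qed.

Lemma In_mem (T : eqType) (x : T) s : List.In x s <-> x \in s.
Proof.
elim: s => //= y s IH; rewrite in_cons; split=> [[->|/IH->]|/orP[/eqP->|/IH]];
  by rewrite ?eqxx ?orbT; auto.
Qed.

Lemma mem_flatten_map_In T (U : eqType) (f : T -> seq U) y s :
  y \in flatten (map f s) <-> exists2 x, List.In x s & y \in f x.
Proof.
rewrite -In_mem In_flatten_map; split=> -[x xs yx]; exists x => //; exact/In_mem.
Qed.

Lemma onth_In T (s : seq T) i x : onth s i = Some x -> List.In x s.
Proof.
elim: s i => [|y s IH] [|i] //= => [[->]|/IH]; by [left|right].
Qed.

Lemma In_onth T (s : seq T) x : List.In x s -> exists i, onth s i = Some x.
Proof.
elim: s => //= y s IH [->|/IH[i xi]]; first by exists 0.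
by exists i.+1.
Qed.

Lemma onth_lt T (s : seq T) i x : onth s i = Some x -> i < size s.
Proof. by elim: s i => [|y s IH] [|i] //= /IH. Qed.

Lemma lt_onth T (s : seq T) i : i < size s -> exists x, onth s i = Some x.
Proof. by elim: s i => [|y s IH] [|i] //=; [exists y | exact: IH]. Qed.

Lemma onth_map_Some T U (f : T -> U) s i y :
  onth (map f s) i = Some y <-> exists2 x, onth s i = Some x & y = f x.
Proof.
elim: s i => [|z s IH] [|i] //=; try by split=> [|[]].
by split=> [[<-]|[_ [<-] ->]] //; exists z.
Qed.

(** Assembles the argument list of an application from witnesses found argument by argument. *)
Lemma list_choice T (P : nat -> T -> Prop) n :
  (forall i, i < n -> exists x, P i x) ->
  exists s, size s = n /\ forall i x, onth s i = Some x -> P i x.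
Proof.
elim: n P => [|n IH] P H; first by exists [::]; split=> // -[].
have [x Px] := H 0 isT.
have [s [<- Ps]] := IH (fun i => P i.+1) (fun i lt_i => H i.+1 lt_i).
by exists (x :: s); split=> // -[|i] y //= => [[<-]|/Ps].
Qed.

Lemma fresh_notin s : fresh s \notin s.
Proof.
have h : forall x, x \in s -> x < fresh s.
  rewrite /fresh; elim: s => //= y s IH x; rewrite in_cons => /orP[/eqP->|/IH]; lia.
by apply/negP => /h; rewrite ltnn.
Qed.

(* Off [s], [f] is replaced by a shift past all the values of [f] on [s]. *)
Lemma extend_injective (s : seq nat) (f : nat -> nat) :
  {in s &, injective f} -> exists2 g, injective g & {in s, g =1 f}.
Proof.
move=> f_inj; pose M := fresh (map f s).
have ltM x : x \in s -> f x < M.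
  move=> xs; rewrite /M /fresh ltnS; elim: s xs {f_inj M} => //= y s IH.
  by rewrite in_cons => /orP[/eqP->|/IH]; lia.
exists (fun x => if x \in s then f x else x + M) => [x y|x xs]; last by rewrite xs.
case: ifP => xs; case: ifP => ys; first exact: f_inj.
- by have := ltM _ xs; lia.
- by have := ltM _ ys; lia.
- by lia.
Qed.

(** Bound names are changed by transpositions rather than by substitutions: a transposition is
    injective on all names, so it commutes with every binder. *)
Definition swap (x y z : nat) := if z == x then y else if z == y then x else z.

Lemma swap_inj x y : injective (swap x y).
Proof. by move=> z t; rewrite /swap; do ![case: eqP]; lia. Qed.

Lemma swapl x y : swap x y x = y.
Proof. by rewrite /swap eqxx. Qed.

Lemma swap_neq x y z : z != x -> z != y -> swap x y z = z.
Proof. by rewrite /swap => /negPf-> /negPf->. Qed.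

(** * Maps on terms and on locally nameless formulas *)

Lemma term_ind' Sg X (P : term Sg X -> Prop) :
  (forall x, P (TVar Sg x)) ->
  (forall f (ts : {ffun 'I_(far f) -> term Sg X}), (forall i, P (ts i)) -> P (TApp ts)) ->
  forall t, P t.
Proof. move=> Hv Ha; fix IH 1 => -[x|f ts]; [exact: Hv | apply: Ha => i; exact: IH]. Qed.

(* The equation on the left determines how the variables of [t] and [u] match. *)
Lemma tmap_rel Sg (X X' : eqType) Y Y' (f f' : _ -> _) (g g' : _ -> _)
    (t : term Sg X) (u : term Sg X') :
  tmap (Y := Y) f t = tmap g u ->
  {in tvars t & tvars u, forall v w, f v = g w -> f' v = g' w} ->
  tmap (Y := Y') f' t = tmap g' u.
Proof.
elim/term_ind': t u => [x|F ts IH] [y|F' us] //=.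
  by move=> [fg] H; congr TVar; apply: H; rewrite ?mem_head.
move=> [eF]; subst F' => e0 H; have e i := congr1 (fun ts : {ffun _ -> _} => ts i) (inj_pair2 _ _ _ _ _ e0).
congr TApp; apply/ffunP => i; rewrite !ffunE.
apply: IH => [|v w vt wu]; last first.
  by apply: H; apply/flatten_mapP; exists i; rewrite ?mem_enum.
by have := e i; rewrite !ffunE.
Qed.

Lemma tmap_comp Sg X Y Z (f : Y -> Z) (g : X -> Y) (t : term Sg X) :
  tmap f (tmap g t) = tmap (f \o g) t.
Proof.
elim/term_ind': t => //= F ts IH; congr TApp; apply/ffunP => i; by rewrite !ffunE.
Qed.

Lemma tmap_id Sg X (t : term Sg X) : tmap id t = t.
Proof.
elim/term_ind': t => //= F ts IH; congr TApp; apply/ffunP => i; by rewrite !ffunE.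
Qed.

Lemma map_flatten_map X Y Z (f : Y -> Z) (F : X -> seq Y) s :
  map f (flatten (map F s)) = flatten [seq map f (F x) | x <- s].
Proof. by rewrite map_flatten -map_comp. Qed.

Lemma tvars_tmap Sg X Y (f : X -> Y) (t : term Sg X) : tvars (tmap f t) = map f (tvars t).
Proof.
elim/term_ind': t => //= F ts IH; rewrite map_flatten_map.
by congr flatten; apply: eq_map => i; rewrite ffunE.
Qed.

(** Renaming and binding differ only in their action on variables at depth [k]; as instances of one
    map they share the proofs of composition, congruence and injectivity. *)
Fixpoint lmap Sg (h : nat -> nat + nat -> nat + nat) (k : nat) (A : lform Sg) : lform Sg :=
  match A with
  | LAtom p ts => LAtom [ffun i => tmap (h k) (ts i)]
  | LImp A B => LImp (lmap h k A) (lmap h k B)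
  | LAll A => LAll (lmap h k.+1 A)
  end.

Lemma lren_lmap Sg r k (A : lform Sg) : lren r A = lmap (fun _ => ren_name r) k A.
Proof. by elim: A k => //= [A IHA B IHB|A IH] k; rewrite -?IHA -?IHB -?IH. Qed.

Lemma lbind_lmap Sg x k (A : lform Sg) : lbind k x A = lmap (bind_name^~ x) k A.
Proof. by elim: A k => //= [A IHA B IHB|A IH] k; rewrite ?IHA ?IHB ?IH. Qed.

(** Only names are located in [A]; an index counts as occurring everywhere. *)
Definition occurs Sg (A : lform Sg) (v : nat + nat) :=
  if v is inl x then x \in lfv A else true.

Lemma mem_free_names s x : (x \in free_names s) = (inl x \in s).
Proof.
elim: s => //= -[y|j] s IH; rewrite in_cons /= ?IH //.
Qed.

(** The equation aligns the variable occurrences of [A] and [B], so whatever holds between aligned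
    variables yields an equation for other maps. Extensionality and injectivity of renamings are the
    cases where the maps on one side of the implication are identities. *)
Lemma lmap_rel Sg f g f' g' k (A B : lform Sg) :
  lmap f k A = lmap g k B ->
  (forall k v w, occurs A v -> occurs B w -> f k v = g k w -> f' k v = g' k w) ->
  lmap f' k A = lmap g' k B.
Proof.
elim: A B k => [p ts|A IHA A' IHA'|A IH] [q us|B B'|B] k //=.
- move=> [eF]; subst q => e0 H; have e i := congr1 (fun ts : {ffun _ -> _} => ts i) (inj_pair2 _ _ _ _ _ e0).
  congr LAtom; apply/ffunP => i; rewrite !ffunE.
  apply: (@tmap_rel _ _ _ _ _ (f k) (f' k) (g k) (g' k)) => [|v w vt wu].
    by have := e i; rewrite !ffunE.
  apply: H; [case: v vt|case: w wu] => //= x xt;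
  by apply/flatten_mapP; exists i; rewrite ?mem_enum ?mem_free_names.
- move=> [eA eA'] H; congr LImp; [apply: IHA|apply: IHA'] => // j [x|m] [y|l] //= Ax By;
  by apply: H => /=; rewrite ?mem_cat ?Ax ?By ?orbT.
- by move=> [e] H; congr LAll; apply: IH.
Qed.

Lemma lmap_comp Sg f g k (A : lform Sg) :
  lmap f k (lmap g k A) = lmap (fun k => f k \o g k) k A.
Proof.
elim: A k => //= [p ts|A IHA B IHB|A IH] k; rewrite ?IHA ?IHB ?IH //.
by congr LAtom; apply/ffunP => i; rewrite !ffunE tmap_comp.
Qed.

Lemma lmap_id Sg f k (A : lform Sg) : (forall k, f k = id) -> lmap f k A = A.
Proof.
move=> fid; elim: A k => //= [p ts|A IHA B IHB|A IH] k; rewrite ?IHA ?IHB ?IH //.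
by congr LAtom; apply/ffunP => i; rewrite !ffunE fid tmap_id.
Qed.

Lemma lmap_ext Sg f g k (A : lform Sg) :
  (forall k v, occurs A v -> f k v = g k v) -> lmap f k A = lmap g k A.
Proof.
move=> fg; apply: (lmap_rel (f := fun _ => id) (g := fun _ => id)) => //.
by move=> j v w Av _ <-; apply: fg.
Qed.

Lemma lren_rel Sg r s r' s' (A B : lform Sg) :
  lren r A = lren s B ->
  {in lfv A & lfv B, forall x y, r x = s y -> r' x = s' y} ->
  lren r' A = lren s' B.
Proof.
rewrite !(lren_lmap _ 0) => e H; apply: lmap_rel e _ => _ [x|i] [y|j] //=.
by move=> Ax By [e]; rewrite (H x y).
Qed.

Lemma lren_ext Sg r s (A : lform Sg) : {in lfv A, r =1 s} -> lren r A = lren s A.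
Proof. by move=> rs; apply: (lren_rel (r := id) (s := id)) => // x y Ax _ <-; apply: rs. Qed.

Lemma lren_comp Sg r s (A : lform Sg) : lren r (lren s A) = lren (r \o s) A.
Proof. by rewrite !(lren_lmap _ 0) lmap_comp; apply: lmap_ext => _ [x|i]. Qed.

Lemma lren_id Sg (A : lform Sg) : lren id A = A.
Proof.
rewrite (lren_lmap _ 0) -[RHS](lmap_id (f := fun _ => id) 0) //.
by apply: lmap_ext => _ [x|i].
Qed.

Lemma lren_id_in Sg r (A : lform Sg) : {in lfv A, r =1 id} -> lren r A = A.
Proof. by move=> rid; rewrite (lren_ext rid) lren_id. Qed.

Lemma lren_inj_in Sg r (A B : lform Sg) :
  {in lfv A & lfv B, forall x y, r x = r y -> x = y} -> lren r A = lren r B -> A = B.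
Proof. by move=> r_inj e; rewrite -(lren_id A) -(lren_id B); apply: lren_rel e _. Qed.

Lemma free_names_map r s : free_names (map (ren_name r) s) = map r (free_names s).
Proof. by elim: s => //= -[x|i] s //= ->. Qed.

Lemma lfv_lren Sg r (A : lform Sg) : lfv (lren r A) = map r (lfv A).
Proof.
elim: A => //= [p ts|A -> B ->]; last by rewrite map_cat.
rewrite map_flatten_map; congr flatten; apply: eq_map => i.
by rewrite ffunE tvars_tmap free_names_map.
Qed.

Lemma filter_flatten_map X Y (p : pred Y) (F : X -> seq Y) s :
  filter p (flatten (map F s)) = flatten [seq filter p (F x) | x <- s].
Proof. by elim: s => //= x s IH; rewrite filter_cat IH. Qed.

Lemma lfv_lbind Sg k x (A : lform Sg) : lfv (lbind k x A) = [seq y <- lfv A | y != x].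
Proof.
elim: A k => //= [p ts|A IHA B IHB] k; last by rewrite IHA IHB filter_cat.
rewrite filter_flatten_map; congr flatten; apply: eq_map => i.
rewrite ffunE tvars_tmap; elim: (tvars _) => //= -[y|j] s /=; last by case: ifP.
by case: eqP => //= _ ->.
Qed.

Lemma lfv_ln Sg (A : form Sg) : lfv (ln A) = fv A.
Proof.
elim: A => //= [p ts|A -> B ->|x A IH] //; last by rewrite lfv_lbind IH.
congr flatten; apply: eq_map => i; rewrite ffunE tvars_tmap.
by elim: (tvars _) => //= y s ->.
Qed.

(** Indices from [k] on are shifted, which keeps [k] free to represent [x]. *)
Lemma bind_name_inj k x : injective (bind_name k x).
Proof.
move=> [y|i] [z|j] /=; do ?case: eqP; do ?case: ltnP => ?; do ?case: ltnP => ?; try congruence;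
  by move=> *; repeat match goal with H : inr _ = inr _ |- _ => case: H end; try (congr inr); lia.
Qed.

Lemma lbind_inj Sg k x : injective (@lbind Sg k x).
Proof.
move=> A B; rewrite !lbind_lmap => e.
rewrite -(lmap_id (f := fun _ => id) k A) // -(lmap_id (f := fun _ => id) k B) //.
by apply: lmap_rel e _ => j v w _ _ /bind_name_inj.
Qed.

Lemma lall_inj Sg x : injective (@lall Sg x).
Proof. by move=> A B [] /lbind_inj. Qed.

Lemma lren_lbind Sg r k x (A : lform Sg) :
  {in lfv A, forall y, r y = r x -> y = x} ->
  lren r (lbind k x A) = lbind k (r x) (lren r A).
Proof.
move=> r_inj; rewrite !lbind_lmap !(lren_lmap _ k) !lmap_comp.
apply: lmap_ext => j [y|i] /= Ay; last by case: ifP.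
case: eqP => [->|ne] /=; first by rewrite eqxx.
by case: eqP => // /r_inj-/(_ Ay).
Qed.

Lemma lren_lall Sg r x (A : lform Sg) :
  {in lfv A, forall y, r y = r x -> y = x} ->
  lren r (lall x A) = lall (r x) (lren r A).
Proof. by move=> r_inj; rewrite /lall /= lren_lbind. Qed.

(** A section of [bind_name k x] on variables other than the name [x]. *)
Definition open_name (k : nat) (x : nat) (v : nat + nat) : nat + nat :=
  match v with
  | inl y => inl y
  | inr j => if j < k then inr j else if j == k then inl x else inr j.-1
  end.

Lemma lall_surj Sg x (A : lform Sg) : x \notin lfv A -> exists B, LAll A = lall x B.
Proof.
move=> xA; exists (lmap (open_name^~ x) 0 A); congr LAll.
rewrite lbind_lmap lmap_comp -[LHS](lmap_id (f := fun _ => id) 0) //.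
apply: lmap_ext => j [y|i] /= Ay.
  by case: eqP => // e; rewrite -e Ay in xA.
case: ltnP => /= h; first by rewrite h.
case: eqP => [->|ne] /=; first by rewrite eqxx.
by rewrite ltnNge (_ : j <= i.-1) /=; [congr inr|]; lia.
Qed.

Lemma lall_swap Sg x y (A : lform Sg) :
  y \notin lfv (lall x A) -> lall x A = lall y (lren (swap x y) A).
Proof.
move=> yA; rewrite -{1}(swapl x y) -lren_lall => [|z _ /swap_inj//].
rewrite lren_id_in // => z zA /=; apply: swap_neq.
  by move: zA; rewrite /= lfv_lbind mem_filter => /andP[].
by apply: contraNneq yA => <-.
Qed.

(** * Proof-terms, LJ+ and the function F *)

Lemma pterm_ind' (P : pterm -> Prop) :
  (forall h ts, (forall t, List.In t ts -> P t) -> P (PApp h ts)) ->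
  (forall t, P t -> P (PAll t)) -> (forall t, P t -> P (PLam t)) -> forall t, P t.
Proof.
move=> Happ Hall Hlam; fix IH 1 => -[h ts|t|t].
- apply: Happ; elim: ts => [|t ts IHts] u; first by case.
  by case=> [<-|uts]; [apply: IH | apply: (IHts u uts)].
- apply: Hall; exact: IH.
- apply: Hlam; exact: IH.
Qed.

Fixpoint psize (t : pterm) : nat :=
  match t with
  | PApp _ ts => (sumn [seq psize u | u <- ts]).+1
  | PAll t => (psize t).+1
  | PLam t => (psize t).+1
  end.

Fixpoint pfv (t : pterm) : seq nat :=
  match t with
  | PApp h ts => free_names [:: h] ++ flatten [seq pfv u | u <- ts]
  | PAll t => pfv t
  | PLam t => pfv t
  end.

Lemma psize_In h ts t : List.In t ts -> psize t < psize (PApp h ts).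
Proof. rewrite /= ltnS; elim: ts => //= u ts IH [->|/IH]; lia. Qed.

Lemma psize_map f ts :
  (forall t, List.In t ts -> psize (f t) = psize t) ->
  sumn (map psize (map f ts)) = sumn (map psize ts).
Proof. by move=> H; rewrite -map_comp; congr sumn; apply: eq_map_In. Qed.

Lemma psize_pren r t : psize (pren r t) = psize t.
Proof.
by elim/pterm_ind': t => //= [h ts IH|t ->|t ->] //; rewrite psize_map.
Qed.

Lemma psize_pbind k a t : psize (pbind k a t) = psize t.
Proof.
by elim/pterm_ind': t k => //= [h ts IH|t IH|t IH] k; rewrite ?IH // psize_map // => u /IH.
Qed.

Lemma pren_ext r s t : {in pfv t, r =1 s} -> pren r t = pren s t.
Proof.
elim/pterm_ind': t => //= [h ts IH|t IH|t IH] rs; rewrite ?IH //.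
congr PApp; first by case: h rs => //= a ->; rewrite ?mem_head.
apply: eq_map_In => t tts; apply: IH => // x xt; apply: rs.
by rewrite mem_cat orbC; apply/orP; left; apply/mem_flatten_map_In; exists t.
Qed.

Lemma pren_comp r s t : pren r (pren s t) = pren (r \o s) t.
Proof.
elim/pterm_ind': t => //= [h ts IH|t ->|t ->] //.
by rewrite -map_comp (eq_map_In IH); case: h.
Qed.

Lemma pren_id t : pren id t = t.
Proof.
elim/pterm_ind': t => //= [h ts IH|t ->|t ->] //.
by rewrite (eq_map_In IH) map_id; case: h.
Qed.

Lemma pren_id_in r t : {in pfv t, r =1 id} -> pren r t = t.
Proof. by move=> rid; rewrite (pren_ext rid) pren_id. Qed.

Lemma mem_pfv_pbind x k a t : (x \in pfv (pbind k a t)) = (x \in pfv t) && (x != a).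
Proof.
elim/pterm_ind': t k => //= h ts IH k; rewrite !mem_cat andb_orl; congr orb.
  case: h => [b|j] /=; last by case: ifP.
  case: eqP => [->|ne] /=; rewrite !inE; first by case: eqP.
  by case: (x =P b) => // ->; apply/esym/eqP.
apply/idP/andP => [/mem_flatten_map_In[_ /In_map[t tts ->]]|].
  rewrite IH // => /andP[xt ->]; split=> //; by apply/mem_flatten_map_In; exists t.
move=> [/mem_flatten_map_In[t tts xt] xa]; apply/mem_flatten_map_In.
by exists (pbind k a t); [apply/In_map; exists t | rewrite IH // xt].
Qed.

Lemma pren_pbind r k a t :
  {in pfv t, forall b, r b = r a -> b = a} ->
  pren r (pbind k a t) = pbind k (r a) (pren r t).
Proof.
elim/pterm_ind': t k => //= [h ts IH|t IH|t IH] k r_inj; rewrite ?IH //.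
congr PApp.
  case: h r_inj => [b|j] /= r_inj; last by case: ifP.
  case: eqP => [->|ne] /=; first by rewrite eqxx.
  by case: eqP => // /r_inj-/(_ (mem_head _ _)).
rewrite -!map_comp; apply: eq_map_In => t tts /=; apply: IH => // b bt; apply: r_inj.
by rewrite mem_cat orbC; apply/orP; left; apply/mem_flatten_map_In; exists t.
Qed.

Lemma plam_swap a b t : b \notin pfv (plam a t) -> plam a t = plam b (pren (swap a b) t).
Proof.
move=> bt; rewrite -{1}(swapl a b) /plam -pren_pbind => [|c _ /swap_inj//].
rewrite pren_id_in // => c; rewrite mem_pfv_pbind => /andP[ct ca].
apply: swap_neq => //; apply: contraNneq bt => <-.
by rewrite /= mem_pfv_pbind ct.
Qed.

Definition ren_decl Sg (rv rp : nat -> nat) (d : nat * lform Sg) := (rp d.1, lren rv d.2).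

Lemma mem_dom Sg (D : lctx Sg) a : a \in dom D <-> exists C, List.In (a, C) D.
Proof.
rewrite -In_mem In_map; split=> [[[b C] bD ->]|[C aD]]; first by exists C.
by exists (a, C).
Qed.

Lemma mem_lfv_ctx Sg (D : lctx Sg) x :
  x \in lfv_ctx D <-> exists a C, List.In (a, C) D /\ x \in lfv C.
Proof.
rewrite /lfv_ctx mem_flatten_map_In; split=> [[[a C] aD xC]|[a [C [aD xC]]]].
  by exists a, C.
by exists (a, C).
Qed.

Lemma dom_rcons Sg (D : lctx Sg) d : dom (rcons D d) = rcons (dom D) d.1.
Proof. exact: map_rcons. Qed.

Lemma same_decls_dom Sg (D E : lctx Sg) : same_decls D E -> dom D =i dom E.
Proof.
by move=> DE a; apply/idP/idP => /mem_dom[C /DE aC]; apply/mem_dom; exists C.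
Qed.

Lemma same_decls_lfv Sg (D E : lctx Sg) : same_decls D E -> lfv_ctx D =i lfv_ctx E.
Proof.
by move=> DE x; apply/idP/idP => /mem_lfv_ctx[a [C [/DE aC xC]]]; apply/mem_lfv_ctx; exists a, C.
Qed.

Lemma lren_limps Sg r As (P : lform Sg) :
  lren r (limps As P) = limps (map (lren r) As) (lren r P).
Proof. by elim: As => //= A As ->. Qed.

Lemma latomic_lren Sg r (P : lform Sg) : latomic (lren r P) = latomic P.
Proof. by case: P. Qed.

Lemma lfv_limps Sg As (P : lform Sg) : lfv (limps As P) = flatten (map (@lfv Sg) As) ++ lfv P.
Proof. by elim: As => //= A As ->; rewrite catA. Qed.

Lemma ljp_same_decls Sg (D E : lctx Sg) t B : same_decls D E -> ljp D t B -> ljp E t B.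
Proof.
move=> DE H; elim: H E DE => {D t B} [D a As P ts aD P_at sz _ IH|D t x A _ IH xD|D a A t B aD _ IH] E DE.
- apply: (@ljp_L _ _ _ As) => //; first exact: (DE _).1.
  by move=> i A t Ai ti; exact: (IH _ _ _ Ai ti).
- by apply: ljp_Rall; [exact: IH | rewrite -(same_decls_lfv DE)].
- apply: ljp_Rimp; first by rewrite -(same_decls_dom DE).
  by apply: IH => d; rewrite !In_rcons; split=> -[/DE|]; auto.
Qed.

Lemma ljp_pfv Sg (D : lctx Sg) t B : ljp D t B -> {subset pfv t <= dom D}.
Proof.
elim=> {D t B} [D a As P ts aD _ sz _ IH|//|D a A t B aD _ IH] b /=.
- rewrite in_cons => /orP[/eqP->|]; first by apply/mem_dom; exists (limps As P).
  move=> /mem_flatten_map_In[t tts bt]; have [i ti] := In_onth tts.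
  have [|A Ai] := @lt_onth _ As i; first by rewrite -sz (onth_lt ti).
  exact: (IH _ _ _ Ai ti).
- rewrite mem_pfv_pbind => /andP[/IH]; rewrite dom_rcons mem_rcons in_cons.
  by move=> /orP[/eqP->|//] /eqP.
Qed.

Lemma dom_ren Sg rv rp (D : lctx Sg) : dom (map (ren_decl rv rp) D) = map rp (dom D).
Proof. by rewrite /dom -!map_comp. Qed.

Lemma lfv_ctx_ren Sg rv rp (D : lctx Sg) : lfv_ctx (map (ren_decl rv rp) D) = map rv (lfv_ctx D).
Proof.
rewrite /lfv_ctx map_flatten_map -map_comp; congr flatten; apply: eq_map => d /=.
exact: lfv_lren.
Qed.

Lemma ljp_ren Sg rv rp (D : lctx Sg) t B :
  injective rv -> injective rp -> ljp D t B ->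
  ljp (map (ren_decl rv rp) D) (pren rp t) (lren rv B).
Proof.
move=> v_inj p_inj; elim=> {D t B} [D a As P ts aD P_at sz _ IH|D t x A _ IH xD|D a A t B aD _ IH] /=.
- apply: (@ljp_L _ _ _ (map (lren rv) As)); rewrite ?size_map ?latomic_lren //.
    by rewrite -lren_limps; apply/In_map; exists (a, limps As P).
  by move=> i _ _ /onth_map_Some[A Ai ->] /onth_map_Some[t ti ->]; exact: (IH _ _ _ Ai ti).
- rewrite -/(lall x A) -[LAll _]/(lren rv (lall x A)) lren_lall; last by move=> y _ /v_inj.
  by apply: ljp_Rall IH _; rewrite lfv_ctx_ren mem_map.
- rewrite pren_pbind; last by move=> y _ /p_inj.
  by apply: ljp_Rimp; rewrite ?dom_ren ?mem_map //; rewrite map_rcons in IH.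
Qed.

(** An alpha-equivalence is injective only on the names of [S], while a derivation also contains
    eigenvariables and abstracted proof variables. Both renamings are therefore extended to
    injections of all names, which preserve every freshness condition. *)
Lemma ljp_alpha Sg r (S T : lseq Sg) t :
  alpha_via r S T -> ljp S.1 t S.2 -> ljp T.1 (pren r.2 t) T.2.
Proof.
move=> [/extend_injective[rv v_inj rvE] /extend_injective[rp p_inj rpE] T1 ->] St.
rewrite -(pren_ext (r := rp)); last by move=> a /(ljp_pfv St) /rpE.
rewrite -(lren_ext (r := rv)); last by move=> x xS; rewrite rvE // mem_cat xS orbT.
apply: ljp_same_decls (ljp_ren v_inj p_inj St) => d.
rewrite T1 -[X in List.In d X <-> _](eq_map_In (f := fun d => (r.2 d.1, lren r.1 d.2))) //.
move=> [a C] aS; rewrite /ren_decl /= rpE; last by apply/mem_dom; exists C.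
congr pair; apply/esym/lren_ext => x xC; rewrite rvE // mem_cat; apply/orP; left.
by apply/mem_lfv_ctx; exists a, C.
Qed.

(** Left inverse of [f] on [s]; a value not taken on [s] goes to the default 0. *)
Definition inverse_on (s : seq nat) (f : nat -> nat) (y : nat) := nth 0 s (index y (map f s)).

Lemma inverse_onK s f : {in s &, injective f} -> {in s, cancel f (inverse_on s f)}.
Proof.
move=> f_inj x xs; have fx : f x \in map f s by exact: map_f.
have lt_i : index (f x) (map f s) < size s by rewrite -(size_map f) index_mem.
by apply: f_inj; rewrite ?mem_nth // -(nth_map _ 0) // nth_index.
Qed.

Lemma alpha_via_inv Sg r (S T : lseq Sg) : alpha_via r S T ->
  exists2 s, alpha_via s T S & {in dom T.1, cancel s.2 r.2}.
Proof.
move=> [v_inj p_inj T1 T2].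
have vK := inverse_onK v_inj; have pK := inverse_onK p_inj.
pose sv := inverse_on (lfv_seq S) r.1; pose sp := inverse_on (dom S.1) r.2.
have lfvT : {subset lfv_seq T <= map r.1 (lfv_seq S)}.
  move=> y; rewrite /lfv_seq map_cat !mem_cat T2 lfv_lren => /orP[|->]; last by rewrite orbT.
  by rewrite (same_decls_lfv T1) lfv_ctx_ren => ->.
have domT : dom T.1 =i map r.2 (dom S.1).
  by move=> a; rewrite (same_decls_dom T1) dom_ren.
exists (sv, sp); last by move=> a; rewrite domT => /mapP[b bS ->] /=; rewrite /sp pK.
split=> /=.
- move=> x y /lfvT/mapP[x' x'S ->] /lfvT/mapP[y' y'S ->]; by rewrite /sv !vK // => ->.
- move=> x y; rewrite !domT => /mapP[x' x'S ->] /mapP[y' y'S ->]; by rewrite /sp !pK // => ->.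
- have K : forall d, List.In d S.1 -> (sp (r.2 d.1), lren sv (lren r.1 d.2)) = d.
    move=> [a C] aS /=; rewrite /sp pK; last by apply/mem_dom; exists C.
    congr pair; rewrite lren_comp lren_id_in // => x xC /=; rewrite /sv vK // mem_cat.
    by apply/orP; left; apply/mem_lfv_ctx; exists a, C.
  move=> d; split=> [dS|/In_map[e /T1/In_map[d' d'S ->] ->] /=]; last by rewrite K.
  apply/In_map; exists (r.2 d.1, lren r.1 d.2); last by rewrite /= K.
  by apply: (T1 _).2; apply/In_map; exists d.
- rewrite T2 lren_comp lren_id_in // => x xC /=; by rewrite /sv vK // mem_cat xC orbT.
Qed.

Lemma ljp_alpha_surj Sg r (S T : lseq Sg) t : alpha_via r S T -> ljp T.1 t T.2 ->
  exists u, [/\ ljp S.1 u S.2, t = pren r.2 u & psize u = psize t].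
Proof.
move=> /alpha_via_inv[s TS sK] Tt; exists (pren s.2 t).
rewrite psize_pren pren_comp (@pren_id_in (r.2 \o s.2)); last by move=> a /(ljp_pfv Tt)/sK.
by split=> //; apply: ljp_alpha TS Tt.
Qed.

Lemma ljp_L_inv Sg (D : lctx Sg) h ts P : ljp D (PApp h ts) P ->
  exists a As, [/\ h = inl a, List.In (a, limps As P) D, latomic P, size ts = size As &
    forall i A t, onth As i = Some A -> onth ts i = Some t -> ljp D t A].
Proof.
move E: (PApp h ts) => t H; case: H E => // {}D a As {}P us aD P_at sz H [-> ->].
by exists a, As.
Qed.

(** H prescribes the name of the opened variable. The eigenvariable of the derivation can be
    exchanged with it because both are absent from [D], so the transposition fixes the context. *)
Lemma ljp_Rall_inv Sg (D : lctx Sg) t B y : ljp D (PAll t) B ->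
  y \notin lfv_ctx D -> y \notin lfv B -> exists2 B1, B = lall y B1 & ljp D t B1.
Proof.
move E: (PAll t) => u H; case: H E => // {}D {}u x A H xD [->] yD yA.
exists (lren (swap x y) A); first exact: lall_swap.
have := ljp_ren (@swap_inj x y) (@inj_id _) H; rewrite pren_id.
suff -> : map (ren_decl (swap x y) id) D = D by [].
rewrite -[RHS]map_id; apply: eq_map_In => -[a C] aD; rewrite /ren_decl /=; congr pair.
have notC z : z \notin lfv_ctx D -> z \notin lfv C.
  by apply: contraNN => zC; apply/mem_lfv_ctx; exists a, C.
apply: lren_id_in => z zC; apply: swap_neq; apply: contraTneq zC => ->; exact: notC.
Qed.

(** The same exchange for proof variables; [b] is not free in the term, since free proof variables
    are declared in [D]. *)
Lemma ljp_Rimp_inv Sg (D : lctx Sg) t B b : ljp D (PLam t) B -> b \notin dom D ->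
  exists B1 B2 u, [/\ B = LImp B1 B2, PLam t = plam b u & ljp (rcons D (b, B1)) u B2].
Proof.
move E: (PLam t) => u H bD; have bu := contraNN (ljp_pfv H (x := b)) bD.
case: H E bu bD => // {}D a A {}u {}B aD H _ bu bD.
exists A, B, (pren (swap a b) u); split=> //; first exact: plam_swap.
have := ljp_ren (@inj_id _) (@swap_inj a b) H; rewrite lren_id.
suff -> : map (ren_decl id (swap a b)) (rcons D (a, A)) = rcons D (b, A) by [].
rewrite map_rcons /ren_decl /= swapl lren_id; congr rcons.
rewrite -[RHS]map_id; apply: eq_map_In => -[c C] cD; rewrite /= lren_id; congr pair.
have cdom : c \in dom D by apply/mem_dom; exists C.
by apply: swap_neq; apply: contraTneq cdom => ->.
Qed.

(** * Soundness and inversion of F *)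

Lemma inF_sound Sg d (S T : lseq Sg) u t : inF d S T u t -> ljp T.1 t T.2.
Proof.
elim=> {d S T u t} [d S D a i a' Cs A us us' A_at aS aa' a'D sz sz' _ IH|
  d S D x A1 i u u' _ xD _ _ _ IH|d S D a a' A1 A2 i j u u' _ a'D _ _ IH] /=.
- apply: (@ljp_L _ _ _ (map (lren (dup_sub d i)) Cs)); rewrite ?size_map -?lren_limps ?latomic_lren //.
  move=> j _ t /onth_map_Some[C Cj ->] tj.
  have [|u uj] := @lt_onth _ us j; first by rewrite sz (onth_lt Cj).
  exact: (IH _ _ _ _ Cj uj tj).
- exact: ljp_Rall.
- exact: ljp_Rimp.
Qed.

Lemma limps_lren_inv Sg r Bs (B C : lform Sg) : limps Bs B = lren r C ->
  exists Cs P, [/\ C = limps Cs P, Bs = map (lren r) Cs & B = lren r P].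
Proof.
elim: Bs C => [|B1 Bs IH] C /=; first by move=> ->; exists [::], C.
case: C => //= C1 C [-> /IH[Cs [P [-> -> ->]]]].
by exists (C1 :: Cs), P.
Qed.

Lemma mem_dom_rcons Sg (D : lctx Sg) a A c :
  c \in dom (rcons D (a, A)) -> c = a \/ c \in dom D.
Proof. by rewrite dom_rcons mem_rcons in_cons => /orP[/eqP|]; auto. Qed.

Lemma onth_same_size T U (s : seq T) (t : seq U) i x :
  size s = size t -> onth s i = Some x -> exists y, onth t i = Some y.
Proof. by move=> st xi; apply: lt_onth; rewrite -st (onth_lt xi). Qed.

(** A free name of [T] determines the name of [S] it comes from, and a proof variable of [T] the
    declaration it copies. This collapse is not injective, so eigenvariables and abstracted proof
    variables are first renamed away from all the data of the duplication. *)
Lemma inF_complete Sg d (S T : lseq Sg) t : partial_dup d S T -> ljp T.1 t T.2 ->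
  exists u, [/\ ljp S.1 u S.2, inF d S T u t & psize u = psize t].
Proof.
have [n le_n] := ubnP (psize t); elim: n d S T t le_n => // n IH d [S A] [D B] t.
move=> le_n [/= [sub_id sub_fr sub_inj] [n_fun n_inj] n_tot DS [j Bj]] Dt.
(* Names created by the substitutions avoid those of the sequent, and the images of the two
   substitutions are disjoint; so a collision has a single source. *)
have subK i k x y : x \in lfv_seq (S, A) -> y \in lfv_seq (S, A) ->
    dup_sub d i x = dup_sub d k y -> x = y.
  move=> xS yS; case: (boolP (x \in dup_dom d)) (boolP (y \in dup_dom d)) => xd [yd|yd].
  - by move=> e; case: (sub_inj _ _ _ _ xd yd e).
  - rewrite (sub_id _ y) // => e; have := sub_fr i x xd; by rewrite e yS andbF.
  - rewrite (sub_id _ x) // => e; have := sub_fr k y yd; by rewrite -e xS andbF.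
  - by rewrite !sub_id.
case: t le_n Dt => [h ts|t|t] le_n Dt.
- have [a' [Bs [-> a'D B_at sz Hts]]] := ljp_L_inv Dt.
  have [c [i [C0 [cS cn e]]]] := (DS _ _).1 a'D.
  have [Cs [P [eC0 eBs eB]]] := limps_lren_inv e.
  (* The copy index [i] of the head and the index [j] of the goal may differ; [subK] shows that the
     conclusions agree before substitution. *)
  have eP : P = A.
    apply: (lren_inj_in (r := id)) => //.
    apply: lren_rel (etrans (esym eB) Bj) _ => x y xP yA; apply: subK; rewrite mem_cat ?yA ?orbT //.
    apply/orP; left; apply/mem_lfv_ctx; exists c, C0; split=> //.
    by rewrite eC0 lfv_limps mem_cat xP orbT.
  subst P C0 Bs; rewrite size_map in sz.
  have step k : k < size Cs -> exists u, forall C t, onth Cs k = Some C -> onth ts k = Some t ->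
      [/\ ljp S u C, inF d (S, C) (D, lren (dup_sub d i) C) u t & psize u = psize t].
    move=> lt_k; have [C Ck] := lt_onth lt_k; have [|t tk] := @lt_onth _ ts k; first by rewrite sz.
    have [|||u Hu] := IH d (S, C) (D, lren (dup_sub d i) C) t.
    + by have := psize_In h (onth_In tk); lia.
    + split=> //; last by exists i.
      split=> // l x xd; have /andP[-> h'] := sub_fr l x xd; apply: contraNN h'.
      rewrite /lfv_seq !mem_cat => /orP[->//|xC]; apply/orP; left; apply/mem_lfv_ctx.
      exists c, (limps Cs A); split=> //; rewrite lfv_limps mem_cat; apply/orP; left.
      by apply/mem_flatten_map_In; exists C => //; exact: onth_In Ck.
    + by apply: (Hts k) => //; apply/onth_map_Some; exists C.
    + by exists u => C' t'; rewrite Ck tk => -[<-] [<-].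
  have [us [sz_us Hus]] := list_choice step.
  exists (PApp (inl c) us); split=> /=.
  + apply: (@ljp_L _ _ _ Cs) => //=; first by rewrite -(latomic_lren (dup_sub d i)) -eB.
    move=> k C u Ck uk; have [t tk] := onth_same_size (esym sz) Ck.
    by case: (Hus _ _ uk _ _ Ck tk).
  + rewrite eB; apply: (@inF_L _ _ _ _ _ _ _ Cs) => //.
    * by rewrite -(latomic_lren (dup_sub d i)) -eB.
    * by rewrite lren_limps -eB.
    * by move=> k C u t Ck uk tk; case: (Hus _ _ uk _ _ Ck tk).
  + congr (sumn _).+1; have sz' : size us = size ts by rewrite sz.
    have {Hus} : forall k u t, onth us k = Some u -> onth ts k = Some t -> psize u = psize t.
      move=> k u t uk tk; have [C Ck] := onth_same_size sz tk.
      by case: (Hus _ _ uk _ _ Ck tk).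
    elim: us ts sz' {sz_us Dt Hts sz step le_n} => [|u us IHus] [|t ts] //= [sz'] Hk.
    by rewrite (Hk 0 u t) // (IHus ts) // => k; apply: (Hk k.+1).
(* The bound name must also avoid the domain and both images of the substitutions: then
   [dup_sub d j] commutes with the quantifier, and the duplication stays valid for the body. *)
- pose x := fresh (lfv_ctx S ++ lfv A ++ lfv_ctx D ++ lfv B ++ enum_fset (dup_dom d) ++
     [seq dup_sub d true y | y <- enum_fset (dup_dom d)] ++
     [seq dup_sub d false y | y <- enum_fset (dup_dom d)]).
  have := fresh_notin (lfv_ctx S ++ lfv A ++ lfv_ctx D ++ lfv B ++ enum_fset (dup_dom d) ++
     [seq dup_sub d true y | y <- enum_fset (dup_dom d)] ++
     [seq dup_sub d false y | y <- enum_fset (dup_dom d)]).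
  rewrite -/x !mem_cat !negb_or => /and5P[xS xA xD xB /and3P[xd x1 x2]].
  have xsub i y : y \in dup_dom d -> dup_sub d i y != x.
    move=> yd; case: i; [apply: contraNneq x1 => <- | apply: contraNneq x2 => <-]; exact: map_f.
  have [B1 eB Dt1] := ljp_Rall_inv Dt xD xB.
  have [A1 eA] : exists A1, A = lall x A1.
    by move: Bj xA; rewrite eB; case: (A) => //= A0 _ /lall_surj.
  have eB1 : B1 = lren (dup_sub d j) A1.
    apply: (@lall_inj _ x); rewrite -eB Bj eA lren_lall ?sub_id //.
    move=> y _; case: (boolP (y \in dup_dom d)) => [yd e|yd]; last by rewrite sub_id.
    by have := xsub j y yd; rewrite e eqxx.
  have [|||u [Su Fu sz]] := IH d (S, A1) (D, B1) t.
  + by [].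
  + split=> //; last by exists j.
    split=> // i y yd; have /andP[-> h] := sub_fr i y yd; apply: contraNN h.
    rewrite /lfv_seq !mem_cat => /orP[->//|yA1].
    apply/orP; right; rewrite eA /= lfv_lbind mem_filter yA1 andbT; exact: xsub.
  + by [].
  + exists (PAll u); split=> /=; last by rewrite sz.
      by rewrite eA; apply: ljp_Rall.
    by rewrite eA eB eB1; apply: inF_Rall; rewrite -?eB1.
- pose s1 := dom S ++ [seq m.1.1 | m <- dup_names d]; pose s2 := dom D ++ [seq m.2 | m <- dup_names d].
  pose a := fresh s1; pose a' := fresh s2.
  have := fresh_notin s1; have := fresh_notin s2; rewrite -/a -/a' /s1 /s2 !mem_cat !negb_or.
  move=> /andP[a'D a'n] /andP[aS an].
  have napart m : m \in dup_names d -> m.1.1 != a /\ m.2 != a'.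
    move=> md; split; [apply: contraNneq an => <-|apply: contraNneq a'n => <-]; exact: (map_f _ md).
  have [B1 [B2 [t1 [eB et Dt1]]]] := ljp_Rimp_inv Dt a'D.
  have [A1 [A2 [eA eB1 eB2]]] : exists A1 A2, [/\ A = LImp A1 A2,
      B1 = lren (dup_sub d j) A1 & B2 = lren (dup_sub d j) A2].
    by move: Bj; rewrite eB; case: (A) => //= A1 A2 [-> ->]; exists A1, A2.
  rewrite et in le_n Dt *.
  (* The new hypothesis gets one copy, with the index [j] by which the whole implication was
     substituted. *)
  have [|||u [Su Fu sz]] := IH (add_name d (a, j, a')) (rcons S (a, A1), A2) (rcons D (a', B1), B2) t1.
  + by move: le_n; rewrite /= psize_pbind.
  + split=> /=.
    * split=> // i x xd; have /andP[-> h] := sub_fr i x xd; apply: contraNN h.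
      rewrite /lfv_seq eA /= !mem_cat => /orP[/mem_lfv_ctx[c [C [/In_rcons cS xC]]]|->]; last by rewrite !orbT.
      case: cS => [cS|[_ eC]]; last by rewrite -eC xC orbT.
      by apply/orP; left; apply/mem_lfv_ctx; exists c, C.
    * split=> [c i b b'|c c' i i' b] /=; rewrite !in_cons.
        move=> /orP[/eqP[-> -> ->]|cb] /orP[/eqP[]|cb'] //.
        - by case/napart: cb' => /eqP.
        - by move=> e _ _; case/napart: cb => /eqP.
        - exact: n_fun cb cb'.
      move=> /orP[/eqP[-> -> ->]|cb] /orP[/eqP[-> ->]|cb'] //.
        - by case/napart: cb' => _ /eqP.
        - by move=> e; case/napart: cb => _ /eqP.
        - exact: n_inj cb cb'.
    * move=> c /mem_dom_rcons[->|/n_tot[i [b cb]]].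
        by exists j, a'; rewrite mem_head.
      by exists i, b; rewrite in_cons cb orbT.
    * move=> b C; rewrite In_rcons DS; split.
        move=> [[c [i [C0 [cS cb ->]]]]|[-> ->]].
          by exists c, i, C0; split=> //; [apply/In_rcons; left | rewrite in_cons cb orbT].
        by exists a, j, A1; split=> //; [apply/In_rcons; right | rewrite mem_head].
      move=> [c [i [C0 [/In_rcons cS]]]]; rewrite in_cons => /orP[/eqP[ec -> ->] ->|cb ->].
        case: cS => [cS|[_ ->]]; last by right; rewrite eB1.
        suff : a \in dom S by rewrite (negPf aS).
        by apply/mem_dom; exists C0; rewrite -ec.
      left; exists c, i, C0; split=> //; case: cS => // -[e _].
      by case/napart: cb => /eqP.
    * by exists j.
  + by [].
  + exists (plam a u); split=> /=; last by rewrite !psize_pbind sz.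
      by rewrite eA; apply: ljp_Rimp.
    by rewrite eA eB eB1 eB2; apply: inF_Rimp; rewrite -?eB1 -?eB2.
Qed.

(** * Cuts and links *)

Local Open Scope fset_scope.

(** A context with one proof variable per formula occurrence, so that occurrences can be followed
    through steps that reorder or bracket them. *)
Inductive atree (Sg : signature) : Type :=
| ALeaf of nat & form Sg
| ABr of {fset nat} & seq (atree Sg).

Lemma atree_ind' Sg (P : atree Sg -> Prop) :
  (forall a C, P (ALeaf a C)) ->
  (forall V g, (forall i, List.In i g -> P i) -> P (ABr V g)) -> forall i, P i.
Proof.
move=> Hleaf Hbr; fix IH 1 => -[a C|V g]; first exact: Hleaf.
apply: Hbr; elim: g => [|i g IHg] j; first by case.
by case=> [<-|jg]; [apply: IH | apply: (IHg j jg)].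
Qed.

Fixpoint erase Sg (i : atree Sg) : item Sg :=
  match i with
  | ALeaf _ C => Leaf C
  | ABr V g => Br V [seq erase j | j <- g]
  end.

Fixpoint idecls Sg (i : atree Sg) : seq (nat * form Sg) :=
  match i with
  | ALeaf a C => [:: (a, C)]
  | ABr _ g => flatten [seq idecls j | j <- g]
  end.

Definition decls Sg (g : seq (atree Sg)) := flatten [seq idecls i | i <- g].

Definition names Sg (g : seq (atree Sg)) : seq nat := [seq d.1 | d <- decls g].

(* The names of the leaves inside a bracket form one side of its cut. *)
Fixpoint icuts Sg (i : atree Sg) : seq ({fset nat} * seq nat) :=
  match i with
  | ALeaf _ _ => [::]
  | ABr V g => (V, names g) :: flatten [seq icuts j | j <- g]
  end.

Definition cuts Sg (g : seq (atree Sg)) := flatten [seq icuts i | i <- g].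

(* [None] stands for the goal, which is outside all brackets. *)
Definition inside (o : option nat) (s : seq nat) := if o is Some a then a \in s else false.

Definition linked (K : seq ({fset nat} * seq nat)) (x : nat) (o o' : option nat) : bool :=
  all (fun c => (x \in c.1) ==> (inside o c.2 == inside o' c.2)) K.

Arguments linked : simpl never.
Arguments cuts : simpl never.
Arguments decls : simpl never.

Lemma decls_cat Sg (g h : seq (atree Sg)) : decls (g ++ h) = decls g ++ decls h.
Proof. by rewrite /decls map_cat flatten_cat. Qed.

Lemma decls_cons Sg i (g : seq (atree Sg)) : decls (i :: g) = idecls i ++ decls g.
Proof. by []. Qed.

Lemma decls_br Sg V (g : seq (atree Sg)) : idecls (ABr V g) = decls g.
Proof. by []. Qed.

Lemma decls1 Sg (i : atree Sg) : decls [:: i] = idecls i.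
Proof. by rewrite /decls /= cats0. Qed.

Lemma names_cat Sg (g h : seq (atree Sg)) : names (g ++ h) = names g ++ names h.
Proof. by rewrite /names decls_cat map_cat. Qed.

Lemma names_cons Sg i (g : seq (atree Sg)) : names (i :: g) = names [:: i] ++ names g.
Proof. by rewrite -names_cat. Qed.

Lemma names_br Sg V (g : seq (atree Sg)) : names [:: ABr V g] = names g.
Proof. by rewrite /names decls1. Qed.

Lemma cuts_cat Sg (g h : seq (atree Sg)) : cuts (g ++ h) = cuts g ++ cuts h.
Proof. by rewrite /cuts map_cat flatten_cat. Qed.

Lemma cuts_cons Sg i (g : seq (atree Sg)) : cuts (i :: g) = cuts [:: i] ++ cuts g.
Proof. by rewrite -cuts_cat. Qed.

Lemma cuts_br Sg V (g : seq (atree Sg)) : cuts [:: ABr V g] = (V, names g) :: cuts g.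
Proof. by rewrite /cuts /= cats0. Qed.

Lemma mem_names Sg (g : seq (atree Sg)) a : a \in names g <-> exists C, List.In (a, C) (decls g).
Proof.
rewrite -In_mem In_map; split=> [[[b C] bD ->]|[C aD]]; first by exists C.
by exists (a, C).
Qed.

Lemma In_decls_name Sg (g : seq (atree Sg)) a C : List.In (a, C) (decls g) -> a \in names g.
Proof. by move=> aC; apply/mem_names; exists C. Qed.

Lemma In_decls_fun Sg (g : seq (atree Sg)) a C C' : uniq (names g) ->
  List.In (a, C) (decls g) -> List.In (a, C') (decls g) -> C = C'.
Proof.
rewrite /names; elim: (decls g) => //= -[b B] s IH /andP[bs /IH{}IH].
have notin D : ~ List.In (b, D) s.
  by move=> bD; move/negP: bs; apply; apply/In_mem/In_map; exists (b, D).
move=> [e|aC] [e'|aC'].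
- by move: e'; rewrite e => -[].
- by case: e aC' => <- _ aC'; case: (notin _ aC').
- by case: e' aC => <- _ aC; case: (notin _ aC).
- exact: IH.
Qed.

Lemma cuts_sub Sg (g : seq (atree Sg)) c : c \in cuts g -> {subset c.2 <= names g}.
Proof.
have sub i (h : seq (atree Sg)) : List.In i h -> {subset names [:: i] <= names h}.
  move=> ih a /mem_names[C]; rewrite decls1 => aC; apply/mem_names; exists C.
  by apply/In_flatten_map; exists i.
move=> /mem_flatten_map_In[i ig ci] a ac; apply: (sub _ _ ig).
elim/atree_ind': i ci {ig} => //= V h IH; rewrite in_cons names_br => /orP[/eqP ec|].
  by move: ac; rewrite ec.
by move=> /mem_flatten_map_In[j jh cj]; apply: (sub _ _ jh); exact: IH cj.
Qed.

Lemma linked_cat K K' x o o' : linked (K ++ K') x o o' = linked K x o o' && linked K' x o o'.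
Proof. exact: all_cat. Qed.

Lemma linked_cons c K x o o' :
  linked (c :: K) x o o' = ((x \in c.1) ==> (inside o c.2 == inside o' c.2)) && linked K x o o'.
Proof. by []. Qed.

Lemma linkedP (K : seq ({fset nat} * seq nat)) x o o' :
  reflect (forall c, c \in K -> x \in c.1 -> inside o c.2 = inside o' c.2) (linked K x o o').
Proof.
rewrite /linked; elim: K => [|c K IH] /=; first by left.
apply: (iffP andP) => [[/implyP cH /IH H] d|H].
  by rewrite in_cons => /orP[/eqP->|/H//] /cH/eqP.
split; first by apply/implyP => xc; rewrite H ?mem_head.
by apply/IH => d dK; apply: H; rewrite in_cons dK orbT.
Qed.

Lemma linked_sub (K K' : seq ({fset nat} * seq nat)) x o o' : {subset K' <= K} -> linked K x o o' -> linked K' x o o'.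
Proof. by move=> sub /linkedP H; apply/linkedP => c /sub; exact: H. Qed.

Lemma linked_refl K x o : linked K x o o.
Proof. exact/linkedP. Qed.

Lemma linked_sym K x o o' : linked K x o o' = linked K x o' o.
Proof. by apply: eq_all => c; rewrite eq_sym. Qed.

Lemma linked_trans K x o1 o2 o3 : linked K x o1 o2 -> linked K x o2 o3 -> linked K x o1 o3.
Proof.
move=> /linkedP h /linkedP h'; apply/linkedP => c cK xc.
by rewrite (h c cK xc) (h' c cK xc).
Qed.

Lemma linked_eql K x o1 o2 o : linked K x o1 o2 -> linked K x o1 o = linked K x o2 o.
Proof.
move=> h; apply/idP/idP; last exact: linked_trans.
by apply: linked_trans; rewrite linked_sym.
Qed.

(** Cuts of [g] list only names of [g]; an occurrence outside [g] is therefore on the same side of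
    each of them as the goal. *)
Lemma linked_outside Sg (g : seq (atree Sg)) x o :
  inside o (names g) = false -> linked (cuts g) x o None.
Proof.
move=> og; apply/linkedP => c cK _ /=; case: o og => //= a.
by apply: contraFF; exact: cuts_sub.
Qed.

Lemma linked_outside2 Sg (g : seq (atree Sg)) x o o' :
  inside o (names g) = false -> inside o' (names g) = false -> linked (cuts g) x o o'.
Proof.
move=> og o'g; apply: linked_trans (linked_outside _ og) _.
by rewrite linked_sym linked_outside.
Qed.

Lemma linked_outsider Sg (g : seq (atree Sg)) x o o' :
  inside o' (names g) = false -> linked (cuts g) x o o' = linked (cuts g) x o None.
Proof.
by move=> o'g; rewrite ![linked _ x o _]linked_sym; apply/linked_eql/linked_outside.
Qed.

(** No bracket around the occurrence binds [x], so [x] survives the filtering at every level. *)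
Lemma linked_free Sg (g : seq (atree Sg)) a C x :
  List.In (a, C) (decls g) -> x \in fv C -> linked (cuts g) x (Some a) None ->
  x \in fv_ctx (map (@erase Sg) g).
Proof.
move=> /In_flatten_map[i ig aC] xC lk; apply/mem_flatten_map_In.
exists (erase i); first by apply/In_map; exists i.
have {lk} : linked (icuts i) x (Some a) None.
  by apply: linked_sub lk => c ci; apply/mem_flatten_map_In; exists i.
elim/atree_ind': i aC {ig} => [b B|V h IH] /=; first by case=> // -[_ ->].
move=> aC; rewrite linked_cons /= => /andP[xV lk].
rewrite mem_filter; apply/andP; split.
  apply: contraTN xV => -> /=; rewrite eqbF_neg negbK.
  exact: In_decls_name aC.
move/In_flatten_map: aC => [j jh aC]; apply/mem_flatten_map_In; exists (erase j).
  by apply/In_map; exists j.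
by apply: IH => //; apply: linked_sub lk => c cj; apply/mem_flatten_map_In; exists j.
Qed.

Lemma map_eq_cat T U (f : T -> U) s a b : map f s = a ++ b ->
  exists s1 s2, [/\ s = s1 ++ s2, map f s1 = a & map f s2 = b].
Proof.
elim: a s => [|x a IH] s /=; first by exists [::], s.
by case: s => //= y s [<- /IH[s1 [s2 [-> <- <-]]]]; exists (y :: s1), s2.
Qed.

Lemma map_eq_cons T U (f : T -> U) s x b : map f s = x :: b ->
  exists y s2, [/\ s = y :: s2, f y = x & map f s2 = b].
Proof. by case: s => //= y s [<- <-]; exists y, s. Qed.

Lemma map_eq_cat_cons T U (f : T -> U) s a x b : map f s = a ++ x :: b ->
  exists s1 y s2, [/\ s = s1 ++ y :: s2, map f s1 = a, f y = x & map f s2 = b].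
Proof.
move=> /map_eq_cat[s1 [s' [-> <- e]]]; have [y [s2 [-> <- <-]]] := map_eq_cons e.
by exists s1, y, s2.
Qed.

Lemma erase_br_inv Sg (i : atree Sg) V G : erase i = Br V G ->
  exists g, i = ABr V g /\ map (@erase Sg) g = G.
Proof. by case: i => //= W g [-> <-]; exists g. Qed.

Lemma inside_cat o s t : inside o (s ++ t) = inside o s || inside o t.
Proof. by case: o => //= a; rewrite mem_cat. Qed.

Lemma inside_perm o s t : perm_eq s t -> inside o s = inside o t.
Proof. by move=> /perm_mem st; case: o => //= a. Qed.

Lemma uniq_inside s t o : uniq (s ++ t) -> inside o s -> inside o t = false.
Proof.
rewrite cat_uniq => /and3P[_ /hasPn st _]; case: o => //= a as_.
by apply: contraTF as_ => /st.
Qed.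

Lemma uniq_insider s t o : uniq (s ++ t) -> inside o t -> inside o s = false.
Proof. by move=> st ot; apply: contraTF ot => /(uniq_inside st)->. Qed.

(** Holds vacuously for the goal and for names outside [g], so that it restricts to parts of the
    context. *)
Definition uses Sg (g : seq (atree Sg)) (o : option nat) (x : nat) : Prop :=
  forall a C, o = Some a -> List.In (a, C) (decls g) -> x \in fv C.

Lemma uses_sub Sg (g h : seq (atree Sg)) o x :
  (forall d, List.In d (decls h) -> List.In d (decls g)) -> uses g o x -> uses h o x.
Proof. by move=> hg H a C e /hg; exact: H. Qed.

(** Carries distinctness of names along rearrangements of the tree: comparing counts reduces it to
    linear arithmetic. *)
Lemma uniq_count (s t : seq nat) : (forall p, count p t <= count p s) -> uniq s -> uniq t.
Proof.
move=> ts s_uniq; apply: count_mem_uniq => x; have := ts (pred1 x).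
rewrite (count_uniq_mem _ s_uniq); have := leq_b1 (x \in s).
rewrite -[x \in t]has_pred1 has_count => s1; move: (count _ t) => n ns.
by have : n <= 1 by [exact: leq_trans ns s1]; case: n {ns} => [|[]].
Qed.

Lemma uses_inside Sg (g : seq (atree Sg)) o x :
  inside o (names g) -> uses g o x -> exists a C, [/\ o = Some a, List.In (a, C) (decls g) & x \in fv C].
Proof.
by case: o => //= a /mem_names[C aC] /(_ a C erefl aC); exists a, C.
Qed.

(* A variable of a leaf of [i] that is not free in [i] is bound inside [i], hence
   links to no leaf outside. *)
Lemma linked_bound Sg (i : atree Sg) o o' x : x \notin fv_item (erase i) -> uses [:: i] o x ->
  linked (cuts [:: i]) x o o' -> inside o (names [:: i]) -> inside o' (names [:: i]).
Proof.
move=> xi ox lk oi; apply/negPn/negP => /negbTE o'i.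
have [a [C [eo aC xC]]] := uses_inside oi ox.
rewrite linked_outsider // eo in lk; have := linked_free aC xC lk.
by rewrite /fv_ctx /= cats0 (negPf xi).
Qed.

(** Moving [I] out of a bracket only removes its names from the inner side of the cut of [V]. For
    [x] in [V], hence not free in [I], two occurrences of [x] that the cuts inside [I] do not
    separate lie both in [I] or both outside, so the change does not affect them. An empty bracket
    has an empty inner side and separates nothing. *)
Lemma clean_move Sg (G H : ctx Sg) e : clean e G H -> e = false ->
  forall g, map (@erase Sg) g = G -> uniq (names g) -> exists h,
  [/\ map (@erase Sg) h = H, forall d, List.In d (decls h) <-> List.In d (decls g),
      perm_eq (names h) (names g)
    & forall o o' x, uses g o x -> uses g o' x ->
        linked (cuts h) x o o' = linked (cuts g) x o o'].
Proof.
elim=> {e G H} [a b V c I f IV|a b V|//|e a b V G H _ IH] e_false g.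
- move=> eg; have [ga [j [gb [-> <- ej <-]]]] := map_eq_cat_cons eg; have [g' [-> eg']] := erase_br_inv ej.
  have [gc [i [gf [-> <- eI <-]]]] := map_eq_cat_cons eg' => g_uniq.
  exists (ga ++ i :: ABr V (gc ++ gf) :: gb); split.
  + by rewrite !(map_cat, map_cons) /= eI map_cat.
  + move=> d; rewrite !(decls_cat, decls_cons, decls_br, In_cat); tauto.
  + rewrite !names_cat !(names_cons _ (_ :: _)) !(names_cons _ gb) !names_br !names_cat (names_cons _ gf).
    by apply/permP => p; rewrite !count_cat; lia.
  + move=> o o' x ox o'x; rewrite !cuts_cat !(cuts_cons _ (_ :: _)) !(cuts_cons _ gb) !cuts_br.
    have [K eK] : exists K, K = cuts [:: i] by exists (cuts [:: i]).
    rewrite !cuts_cat !(cuts_cons _ gf) -!eK /= !linked_cat !linked_cons !linked_cat /= !names_cat (names_cons _ gf).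
    rewrite !inside_cat.
    have i_uniq : uniq (names [:: i] ++ (names gc ++ names gf)).
      apply: uniq_count g_uniq => p.
      rewrite !names_cat (names_cons _ gb) names_br names_cat (names_cons _ gf) !count_cat; lia.
    (* The cuts inside [I] are conjuncts of both sides; only pairs that they do not separate
       remain. *)
    case lk: (linked K x o o'); rewrite eK in lk; last by rewrite !(andbF, andFb).
    case xV: (x \in V) => /=; last by rewrite !andbA.
    have xi : x \notin fv_item (erase i) by rewrite eI; apply: contraTN xV => /(allP IV).
    have isub d : List.In d (decls [:: i]) -> List.In d (decls (ga ++ ABr V (gc ++ i :: gf) :: gb)).
      rewrite decls1 !(decls_cat, decls_cons, decls_br, In_cat); tauto.
    have oo' : inside o (names [:: i]) = inside o' (names [:: i]).
      apply/idP/idP; first exact: linked_bound xi (uses_sub isub ox) lk.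
      by apply: linked_bound xi (uses_sub isub o'x) _; rewrite linked_sym.
    rewrite -oo'; case oi: (inside o (names [:: i])); last by rewrite /= !andbA.
    have := uniq_inside i_uniq oi; rewrite oo' in oi; have := uniq_inside i_uniq oi.
    by rewrite !inside_cat => /negbT/norP[/negPf-> /negPf->] /negbT/norP[/negPf-> /negPf->] /=.
- move=> eg; have [ga [j [gb [-> <- ej <-]]]] := map_eq_cat_cons eg; have [g' [-> eg']] := erase_br_inv ej.
  case: g' eg' => // _ g_uniq.
  exists (ga ++ gb); split; rewrite ?map_cat //.
  + by move=> d; rewrite !(decls_cat, decls_cons).
  + by rewrite !names_cat (names_cons _ gb) names_br.
  + move=> o o' x _ _; rewrite !cuts_cat (cuts_cons _ gb) cuts_br /= !linked_cat linked_cons.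
    by case: o o' => [?|] [?|] /=; rewrite eqxx implybT.
- move=> eg; have [ga [j [gb [-> <- ej <-]]]] := map_eq_cat_cons eg; have [g' [-> eG]] := erase_br_inv ej => g_uniq.
  have [|h [eH dh nh lh]] := IH e_false g' eG.
    apply: uniq_count g_uniq => p; rewrite !names_cat (names_cons _ gb) names_br !count_cat; lia.
  exists (ga ++ ABr V h :: gb); split.
  + by rewrite map_cat /= eH.
  + by move=> d; rewrite !(decls_cat, decls_cons, decls_br, In_cat) dh.
  + by rewrite !names_cat !(names_cons _ gb) !names_br perm_cat2l perm_cat2r.
  + move=> o o' x ox o'x; rewrite !cuts_cat !(cuts_cons _ gb) !cuts_br !linked_cat !linked_cons.
    have sub d : List.In d (decls g') -> List.In d (decls (ga ++ ABr V g' :: gb)).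
      rewrite !(decls_cat, decls_cons, decls_br, In_cat); tauto.
    rewrite lh; [|exact: uses_sub ox|exact: uses_sub o'x].
    by rewrite /= !(inside_perm _ nh).
Qed.

(** * Contraction and re-rooting *)

Definition cut_image (f : nat -> nat) (c c' : {fset nat} * seq nat) : Prop :=
  c'.1 = c.1 /\ c'.2 =i map f c.2.

(** An isomorphism as far as links can see it: only declarations and cuts are compared, both as
    sets, so reordering siblings costs nothing. *)
Definition renames Sg (f : nat -> nat) (g h : seq (atree Sg)) : Prop :=
  [/\ {in names g &, injective f},
      forall a C, List.In (a, C) (decls g) -> List.In (f a, C) (decls h),
      forall b C, List.In (b, C) (decls h) -> exists2 a, List.In (a, C) (decls g) & b = f a,
      forall c, c \in cuts g -> exists2 c', c' \in cuts h & cut_image f c c'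
    & forall c', c' \in cuts h -> exists2 c, c \in cuts g & cut_image f c c'].

Lemma renames_names Sg f (g h : seq (atree Sg)) : renames f g h -> names h =i map f (names g).
Proof.
move=> [_ gh hg _ _] b; apply/idP/mapP => [/mem_names[C /hg[a aC ->]]|[a /mem_names[C /gh aC] ->]].
  by exists a => //; exact: In_decls_name aC.
exact: In_decls_name aC.
Qed.

Definition among (s : seq nat) (o : option nat) := if o is Some a then a \in s else true.

Lemma inside_map (f : nat -> nat) U s o : {in U &, injective f} -> {subset s <= U} ->
  among U o -> inside (omap f o) (map f s) = inside o s.
Proof.
move=> f_inj sU; case: o => //= a aU; apply/mapP/idP => [[b bs e]|as_]; last by exists a.
by rewrite (f_inj a b) // sU.
Qed.

Lemma inside_eq_mem s t o : s =i t -> inside o s = inside o t.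
Proof. by case: o => //= a st; rewrite st. Qed.

Lemma linked_renames Sg f (g h : seq (atree Sg)) x o o' : renames f g h ->
  among (names g) o -> among (names g) o' ->
  linked (cuts h) x (omap f o) (omap f o') = linked (cuts g) x o o'.
Proof.
move=> [f_inj _ _ gh hg] og o'g.
have ins c c' p : c \in cuts g -> cut_image f c c' -> among (names g) p ->
    inside (omap f p) c'.2 = inside p c.2.
  move=> cg [_ e] pg; rewrite (inside_eq_mem _ e); exact: inside_map f_inj (cuts_sub cg) pg.
apply/linkedP/linkedP => H c cc xc.
  have [c' c'h im] := gh c cc.
  by rewrite -(ins c c') // -(ins c c' o') //; apply: H => //; rewrite im.1.
have [c' c'g im] := hg c cc.
by rewrite (ins c' c) // (ins c' c o') //; apply: H => //; rewrite -im.1.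
Qed.

Lemma renames_ext Sg f f' (g h : seq (atree Sg)) :
  {in names g, f =1 f'} -> renames f g h -> renames f' g h.
Proof.
move=> ff' [f_inj gh hg cgh chg].
have im c c' : c \in cuts g -> cut_image f c c' -> cut_image f' c c'.
  move=> cg [e1 e2]; split=> // b; rewrite e2; congr (b \in _).
  by apply/eq_in_map => a ac; apply: ff'; exact: cuts_sub ac.
split.
- by move=> a b ag bg; rewrite -!ff' //; exact: f_inj.
- by move=> a C aC; rewrite -ff'; [exact: gh|exact: In_decls_name aC].
- by move=> b C /hg[a aC ->]; exists a => //; apply: ff'; exact: In_decls_name aC.
- by move=> c cg; have [c' c'h e] := cgh c cg; exists c' => //; exact: im.
- by move=> c' c'h; have [c cg e] := chg c' c'h; exists c => //; exact: im.
Qed.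

Lemma renames_cat Sg f1 f2 (g1 g2 h1 h2 : seq (atree Sg)) :
  uniq (names (g1 ++ g2)) -> uniq (names (h1 ++ h2)) ->
  renames f1 g1 h1 -> renames f2 g2 h2 -> exists f, renames f (g1 ++ g2) (h1 ++ h2).
Proof.
rewrite !names_cat => ug uh r1 r2; pose f a := if a \in names g1 then f1 a else f2 a.
have {}r1 : renames f g1 h1 by apply: renames_ext r1 => a ag; rewrite /f ag.
have {}r2 : renames f g2 h2.
  apply: renames_ext r2 => a ag; rewrite /f.
  by have := @uniq_insider _ _ (Some a) ug ag; rewrite /= => ->.
have n1 := renames_names r1; have n2 := renames_names r2; exists f.
have disj a b : a \in names g1 -> b \in names g2 -> f a = f b -> a = b.
  move=> ag bg e; have := @uniq_inside _ _ (Some (f a)) uh; rewrite /= n1 n2 map_f // e map_f //.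
  by move/(_ isT).
case: r1 r2 => [i1 a1 b1 c1 d1] [i2 a2 b2 c2 d2]; split.
- move=> a b; rewrite !names_cat !mem_cat => /orP[] ag /orP[] bg; [exact: i1| | |exact: i2].
    exact: disj.
  by move=> e; apply/esym/disj.
- by move=> a C; rewrite !decls_cat !In_cat => -[/a1|/a2]; auto.
- by move=> b C; rewrite !decls_cat !In_cat => -[/b1|/b2] [a aC ->]; exists a; rewrite ?In_cat; auto.
- move=> c; rewrite !cuts_cat !mem_cat => /orP[/c1|/c2] [c' cc' e]; exists c' => //;
  by rewrite !mem_cat cc' ?orbT.
- move=> c; rewrite !cuts_cat !mem_cat => /orP[/d1|/d2] [c' cc' e]; exists c' => //;
  by rewrite !mem_cat cc' ?orbT.
Qed.

Lemma renames_br Sg f V (g h : seq (atree Sg)) :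
  renames f g h -> renames f [:: ABr V g] [:: ABr V h].
Proof.
move=> r; have n := renames_names r; case: r => [i a b c d].
split; rewrite ?names_br ?decls1 ?cuts_br //.
- move=> e; rewrite in_cons => /orP[/eqP->|/c[e' e'h im]].
    by exists (V, names h); rewrite ?mem_head.
  by exists e'; rewrite ?in_cons ?e'h ?orbT.
- move=> e; rewrite in_cons => /orP[/eqP->|/d[e' e'h im]].
    by exists (V, names g); rewrite ?mem_head.
  by exists e'; rewrite ?in_cons ?e'h ?orbT.
Qed.

Lemma renames_perm Sg f (g h h' : seq (atree Sg)) :
  (forall d, List.In d (decls h') <-> List.In d (decls h)) -> cuts h' =i cuts h ->
  renames f g h -> renames f g h'.
Proof.
move=> dh ch [i a b c d]; split=> //.
- by move=> x C /a/dh.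
- by move=> x C /dh/b.
- by move=> e /c[e' e'h im]; exists e'; rewrite ?ch.
- by move=> e; rewrite ch => /d.
Qed.

Scheme ieq_mut := Minimality for ieq Sort Prop
with ceq_mut := Minimality for ceq Sort Prop.

(** Serves twice: for the two copies of a contracted item, and, through [ceq_refl], for two
    annotations of one context when two flattenings are compared. *)
Lemma ceq_renames Sg (G H : ctx Sg) : ceq G H -> forall g h,
  map (@erase Sg) g = G -> map (@erase Sg) h = H -> uniq (names g) -> uniq (names h) ->
  exists f, renames f g h.
Proof.
pose P (I J : item Sg) := forall i j, erase i = I -> erase j = J ->
  uniq (names [:: i]) -> uniq (names [:: j]) -> exists f, renames f [:: i] [:: j].
elim/(@ceq_mut _ P) => {G H}.
- move=> C i j ei ej _ _; case: i ei => // a ? [->]; case: j ej => // b ? [->]; exists (fun=> b); split=> //.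
  + by move=> x y; rewrite !inE => /eqP-> /eqP->.
  + by move=> x D; rewrite !decls1 /= => -[[_ ->]|//]; left.
  + by move=> x D; rewrite !decls1 /= => -[[-> ->]|//]; exists a; [left|].
- move=> V G H _ IH i j ei ej.
  have [g [-> eg]] := erase_br_inv ei; have [h [-> eh]] := erase_br_inv ej.
  by rewrite !names_br => ug uh; have [f r] := IH g h eg eh ug uh; exists f; exact: renames_br.
- by case=> // -[] // _ _ _ _; exists id; split.
- move=> I J G a b _ IHI _ IHG g h eg eh ug uh.
  have [i [g' [eg' ei eG]]] := map_eq_cons eg; subst g.
  have [ha [j [hb [eh' ea ej eb]]]] := map_eq_cat_cons eh; subst h.
  have uh' : uniq (names ([:: j] ++ (ha ++ hb))).
    apply: uniq_count uh => p; rewrite !names_cat (names_cons _ hb) !count_cat; lia.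
  rewrite -(cat1s i g') in ug *.
  move: (ug) (uh'); rewrite (names_cat [:: i]) (names_cat [:: j]) !cat_uniq.
  move=> /and3P[ui _ ug'] /and3P[uj _ uhab].
  have [f1 r1] := IHI i j ei ej ui uj.
  have [|f2 r2] := IHG g' (ha ++ hb) eG _ ug' uhab; first by rewrite map_cat ea eb.
  have [f r] := renames_cat ug uh' r1 r2; exists f; apply: renames_perm r.
    move=> d; rewrite !(decls_cat, decls_cons, In_cat) /=; tauto.
  move=> c; rewrite !cuts_cat (cuts_cons _ hb) !mem_cat.
  by rewrite orbCA.
Qed.

Lemma ieq_refl Sg (I : item Sg) : ieq I I.
Proof.
move: I; fix IH 1 => -[C|V G]; constructor.
elim: G => [|J G IHG]; first exact: ceq_nil.
by apply: (@ceq_cons _ J J G [::] G).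
Qed.

Lemma ceq_refl Sg (G : ctx Sg) : ceq G G.
Proof.
elim: G => [|J G IHG]; first exact: ceq_nil.
by apply: (@ceq_cons _ J J G [::] G) => //; exact: ieq_refl.
Qed.

Lemma linked_br Sg (ga gb g : seq (atree Sg)) V x o o' :
  uniq (names (ga ++ ABr V g :: gb)) -> inside o (names g) -> inside o' (names g) ->
  linked (cuts (ga ++ ABr V g :: gb)) x o o' = linked (cuts g) x o o'.
Proof.
rewrite names_cat (names_cons _ gb) names_br => ug og o'g.
have ng : uniq (names g ++ (names ga ++ names gb)).
  by apply: uniq_count ug => p; rewrite !count_cat; lia.
have := uniq_inside ng og; have := uniq_inside ng o'g; rewrite !inside_cat.
move=> /negbT/norP[/negPf o'a /negPf o'b] /negbT/norP[/negPf oa /negPf ob].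
rewrite cuts_cat (cuts_cons _ gb) cuts_br !linked_cat linked_cons.
by rewrite /= og o'g eqxx implybT (linked_outside2 _ oa o'a) (linked_outside2 _ ob o'b) andbT.
Qed.

(* The shape of a contraction [I, I -> I]: [gi] is kept, [gj] is dropped. *)
Record contraction Sg (g h gi gj : seq (atree Sg)) (f : nat -> nat) : Prop := Contraction {
  contr_rename : renames f gi gj;
  contr_decls d : List.In d (decls g) <-> List.In d (decls h) \/ List.In d (decls gj);
  contr_kept d : List.In d (decls gi) -> List.In d (decls h);
  contr_names : perm_eq (names g) (names h ++ names gj);
  contr_linked x o o' : inside o (names gj) = false -> inside o' (names gj) = false ->
    linked (cuts h) x o o' = linked (cuts g) x o o';
  contr_copy x a a' : a \in names gi -> a' \in names gi ->
    linked (cuts g) x (Some (f a)) (Some (f a')) = linked (cuts g) x (Some a) (Some a');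
  contr_bound x a o : a \in names gi -> linked (cuts g) x (Some a) o ->
    inside o (names gi) || linked (cuts gi) x (Some a) None;
  contr_bound_copy x a o : a \in names gi -> linked (cuts g) x (Some (f a)) o ->
    inside o (names gj) || linked (cuts gi) x (Some a) None;
  contr_inner x a a' : a \in names gi -> a' \in names gi ->
    linked (cuts g) x (Some a) (Some a') -> linked (cuts gi) x (Some a) (Some a');
  contr_free x a : a \in names gi -> linked (cuts gi) x (Some a) None ->
    linked (cuts g) x (Some a) (Some (f a))
}.

(** The two copies are siblings, so no bracket around them and no cut of their neighbours separates
    them. Hence a variable free in the item is shared by both copies, whereas the links of a
    variable bound inside it are confined to one copy. *)
Lemma clean_contraction Sg (G H : ctx Sg) e : clean e G H -> e = true ->
  forall g, map (@erase Sg) g = G -> uniq (names g) ->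
  exists h gi gj f, map (@erase Sg) h = H /\ contraction g h gi gj f.
Proof.
elim=> {e G H} [//|//|a b c I J IJ|e a b V G H _ IH] e_true g eg.
- have [ga [i [g1 [-> <- ei eg1]]]] := map_eq_cat_cons eg.
  have [gb [j [gc [-> <- ej <-]]]] := map_eq_cat_cons eg1 => {eg eg1} g_uniq.
  have eh : map (@erase Sg) (ga ++ [:: i] ++ gb ++ gc) =
    [seq erase i | i <- ga] ++ I :: [seq erase i | i <- gb] ++ [seq erase i | i <- gc].
    by rewrite !map_cat /= ei.
  have eij : ceq (map (@erase Sg) [:: i]) (map (@erase Sg) [:: j]).
    by rewrite /= ei ej; apply: (@ceq_cons _ _ _ [::] [::] [::]) => //; exact: ceq_nil.
  rewrite -(cat1s i) -(cat1s j) in g_uniq *.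
  move: [:: i] [:: j] g_uniq eij eh => gi gj g_uniq eij eh.
  have ui : uniq (names gi) by apply: uniq_count g_uniq => p; rewrite !names_cat !count_cat; lia.
  have uj : uniq (names gj) by apply: uniq_count g_uniq => p; rewrite !names_cat !count_cat; lia.
  have [f r] := ceq_renames eij erefl erefl ui uj.
  exists (ga ++ gi ++ gb ++ gc), gi, gj, f; split=> //.
  have fj d : d \in names gi -> f d \in names gj by move=> di; rewrite (renames_names r) map_f.
  have ni : uniq (names gi ++ (names ga ++ names gb ++ names gj ++ names gc)).
    by apply: uniq_count g_uniq => p; rewrite !names_cat !count_cat; lia.
  have nj : uniq (names gj ++ (names ga ++ names gi ++ names gb ++ names gc)).
    by apply: uniq_count g_uniq => p; rewrite !names_cat !count_cat; lia.
  have outi d : d \in names gi -> [/\ inside (Some d) (names ga) = false, inside (Some d) (names gb) = false,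
      inside (Some d) (names gj) = false & inside (Some d) (names gc) = false].
    move=> di; have := @uniq_inside _ _ (Some d) ni di; rewrite !inside_cat.
    by move=> /negbT; rewrite !negb_or => /and4P[/negPf-> /negPf-> /negPf-> /negPf->].
  have outj d : d \in names gj -> [/\ inside (Some d) (names ga) = false, inside (Some d) (names gb) = false,
      inside (Some d) (names gi) = false & inside (Some d) (names gc) = false].
    move=> di; have := @uniq_inside _ _ (Some d) nj di; rewrite !inside_cat.
    by move=> /negbT; rewrite !negb_or => /and4P[/negPf-> /negPf-> /negPf-> /negPf->].
  split=> //.
  + by move=> d; rewrite !decls_cat !In_cat; tauto.
  + by move=> d; rewrite !decls_cat !In_cat; tauto.
  + by rewrite !names_cat; apply/permP => p; rewrite !count_cat; lia.
  + move=> x o o' oj o'j; rewrite !cuts_cat !linked_cat (linked_outside2 x oj o'j) //=.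
  + move=> x d d' di d'i; rewrite !cuts_cat !linked_cat.
    have [h1 h2 h3 h4] := outi d di; have [k1 k2 k3 k4] := outi d' d'i.
    have [l1 l2 l3 l4] := outj _ (fj _ di); have [m1 m2 m3 m4] := outj _ (fj _ d'i).
    rewrite !(linked_outside2 (g := ga)) // !(linked_outside2 (g := gb)) // !(linked_outside2 (g := gc)) //.
    rewrite (linked_outside2 _ l3 m3) (linked_outside2 _ h3 k3) /= !andbT.
    exact: (@linked_renames _ f gi gj x (Some d) (Some d')).
  + move=> x d o di; rewrite !cuts_cat !linked_cat => /and5P[_ lk _ _ _].
    by case oi: (inside o (names gi)) => //=; rewrite -(linked_outsider _ _ oi).
  + move=> x d o di; rewrite !cuts_cat !linked_cat => /and5P[_ _ _ lk _].
    case oj: (inside o (names gj)) => //=; rewrite (linked_outsider _ _ oj) in lk.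
    by rewrite -(@linked_renames _ f gi gj x (Some d) None).
  + by move=> x d d' _ _; rewrite !cuts_cat !linked_cat => /and5P[].
  + move=> x d di lk; rewrite !cuts_cat !linked_cat.
    have [h1 h2 h3 h4] := outi d di; have [l1 l2 l3 l4] := outj _ (fj _ di).
    rewrite !(linked_outside2 (g := ga)) // !(linked_outside2 (g := gb)) // !(linked_outside2 (g := gc)) //=.
    rewrite (linked_outsider x (Some d) l3) lk linked_sym (linked_outsider x (Some (f d)) h3) /= andbT.
    by rewrite (@linked_renames _ f gi gj x (Some d) None).
- have [ga [j [gb [-> <- ej <-]]]] := map_eq_cat_cons eg; have [g' [-> eG]] := erase_br_inv ej => g_uniq.
  have g'_uniq : uniq (names g').
    apply: uniq_count g_uniq => p; rewrite !names_cat (names_cons _ gb) names_br !count_cat; lia.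
  have [h [gi [gj [f [eh [r cd ck cn cl cc cb cbc ci cf]]]]]] := IH e_true g' eG g'_uniq.
  exists (ga ++ ABr V h :: gb), gi, gj, f; split; first by rewrite map_cat /= eh.
  have ng : uniq (names g' ++ (names ga ++ names gb)).
    by apply: uniq_count g_uniq => p; rewrite names_cat (names_cons _ gb) names_br !count_cat; lia.
  have jg d : inside d (names gj) -> inside d (names g').
    by rewrite (inside_perm _ cn) inside_cat => ->; rewrite orbT.
  have ig d : inside d (names gi) -> inside d (names g').
    case: d => //= d /mem_names[C /ck dC]; apply/mem_names; exists C; apply/cd; by left.
  have fg d : d \in names gi -> inside (Some (f d)) (names g').
    by move=> di; apply: jg; rewrite /= (renames_names r) map_f.
  split=> //.
  + by move=> d; rewrite !(decls_cat, decls_cons, decls_br, In_cat) cd; tauto.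
  + by move=> d /ck; rewrite !(decls_cat, decls_cons, decls_br, In_cat); tauto.
  + rewrite !names_cat !(names_cons _ gb) !names_br; move/permP: cn => cn.
    by apply/permP => p; rewrite !count_cat cn !count_cat; lia.
  + move=> x o o' oj o'j; rewrite !cuts_cat !(cuts_cons _ gb) !cuts_br !linked_cat !linked_cons cl //=.
    by rewrite !(inside_perm _ cn) !inside_cat oj o'j !orbF.
  + move=> x d d' di d'i; rewrite (linked_br _ g_uniq (fg _ di) (fg _ d'i)).
    by rewrite (linked_br _ g_uniq (ig (Some d) di) (ig (Some d') d'i)) cc.
  + move=> x d o di; rewrite !cuts_cat !(cuts_cons _ gb) !cuts_br !linked_cat !linked_cons.
    by move=> /and3P[_ /andP[_ lk] _]; exact: cb lk.
  + move=> x d o di; rewrite !cuts_cat !(cuts_cons _ gb) !cuts_br !linked_cat !linked_cons.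
    by move=> /and3P[_ /andP[_ lk] _]; exact: cbc lk.
  + move=> x d d' di d'i; rewrite (linked_br _ g_uniq (ig (Some d) di) (ig (Some d') d'i)).
    exact: ci.
  + by move=> x d di lk; rewrite (linked_br _ g_uniq (ig (Some d) di) (fg _ di)) cf.
Qed.

(** Each descent replaces the bracket around the rest of the path by one around the siblings left
    behind, which exchanges the two sides of its cut among the declarations. The goal moves from
    outside all brackets to beside the focused occurrence [a]: links with the old goal are lost, and
    [a] answers for the new one. The variables separating [a] from the old goal are exactly [V], the
    set in the side condition of (L->). *)
Lemma focus_reroot Sg (acc G : ctx Sg) k V C Gs : focus acc G k V C Gs ->
  forall ga g, map (@erase Sg) ga = acc -> map (@erase Sg) g = G -> uniq (names (ga ++ g)) ->
  exists a gs, [/\ map (@erase Sg) gs = Gs, onth (decls g) k = Some (a, C),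
    forall d, List.In d (decls gs) <-> List.In d (decls (ga ++ g)), perm_eq (names gs) (names (ga ++ g))
  & [/\ forall x, (x \in V) = ~~ linked (cuts g) x (Some a) None,
      forall x, linked (cuts gs) x (Some a) None
    & forall x b b', b \in names (ga ++ g) -> b' \in names (ga ++ g) ->
        linked (cuts gs) x (Some b) (Some b') = linked (cuts (ga ++ g)) x (Some b) (Some b')]].
Proof.
have size_leaves (h : seq (atree Sg)) : size (leaves (map (@erase Sg) h)) = size (decls h).
  have size1 (i : atree Sg) : size (leaves_item (erase i)) = size (idecls i).
    elim/atree_ind': i => //= W g' IH; rewrite !size_flatten /shape -!map_comp.
    by congr sumn; apply: eq_map_In => j /IH.
  rewrite !size_flatten /shape -!map_comp; congr sumn; apply: eq_map => i; exact: size1.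
have onth_cat (T : Type) (s t : seq T) j : onth (s ++ t) (size s + j) = onth t j by elim: s.
elim=> {acc G k V C Gs} [acc a b C|acc a b V G k W C Gs _ IH] ga g e_acc eg.
- have [g1 [i [g2 [-> <- ei <-]]]] := map_eq_cat_cons eg.
  case: i ei => [n D|//] /= [->] u; rewrite -e_acc.
  exists n, (ga ++ g1 ++ g2 ++ [:: ALeaf n C]); split.
  + by rewrite !map_cat.
  + by rewrite size_leaves decls_cat -[size _]addn0 onth_cat.
  + by move=> d; rewrite !decls_cat (decls_cons _ g2) decls1 !In_cat; tauto.
  + rewrite !names_cat (names_cons _ g2); apply/permP => p; rewrite !count_cat; lia.
  + have un : uniq (names [:: ALeaf n C] ++ (names ga ++ names g1 ++ names g2)).
      by apply: uniq_count u => p; rewrite !names_cat (names_cons _ g2) !count_cat; lia.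
    have := @uniq_inside _ _ (Some n) un (mem_head _ _); rewrite !inside_cat.
    move=> /negbT/norP[/negPf na /norP[/negPf n1 /negPf n2]].
    split.
    * move=> x; rewrite in_fset0 cuts_cat (cuts_cons _ g2) !linked_cat !linked_outside //.
    * by move=> x; rewrite !cuts_cat !linked_cat !linked_outside.
    * by move=> x d d' _ _; rewrite !cuts_cat (cuts_cons _ g2) -[cuts [:: _]]/[::] cats0.
- have [g1 [i [g2 [-> ea ei eb]]]] := map_eq_cat_cons eg; have [g' [-> eG]] := erase_br_inv ei => u.
  have u' : uniq (names ([:: ABr V (ga ++ g1 ++ g2)] ++ g')).
    rewrite names_cat names_br; apply: uniq_count u => p.
    by rewrite !names_cat (names_cons _ g2) names_br !count_cat; lia.
  have [|n [gs [egs on ds ns [lV la lk]]]] := IH _ g' _ eG u'.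
    by rewrite /= !map_cat e_acc ea eb.
  have ng : n \in names g' by apply: In_decls_name (onth_In on).
  have un : uniq (names g' ++ (names ga ++ names g1 ++ names g2)).
    by apply: uniq_count u => p; rewrite !names_cat (names_cons _ g2) names_br !count_cat; lia.
  have nn : perm_eq (names ([:: ABr V (ga ++ g1 ++ g2)] ++ g'))
      (names (ga ++ g1 ++ ABr V g' :: g2)).
    rewrite !names_cat names_br (names_cons _ g2) names_br !names_cat.
    by apply/permP => p; rewrite !count_cat; lia.
  exists n, gs; split=> //.
  + rewrite -ea size_leaves decls_cat onth_cat decls_cons decls_br.
    by elim: (decls g') (k) on => [|d s IHs] [|j] //=; exact: IHs.
  + move=> d; rewrite ds (decls_cat [:: _]) decls1 !(decls_cat, decls_br) (decls_cons _ g2) decls_br !In_cat.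
    tauto.
  + exact: perm_trans ns nn.
  + split=> //.
    * move=> x; rewrite in_fsetU lV cuts_cat (cuts_cons _ g2) cuts_br !linked_cat linked_cons.
      have := @uniq_inside _ _ (Some n) un ng; rewrite !inside_cat.
      move=> /negbT/norP[/negPf na /norP[/negPf n1 /negPf n2]].
      rewrite !(linked_outside (g := g1)) // !(linked_outside (g := g2)) //= andbT ng.
      by case: (x \in V).
    * move=> x d d' dn d'n; rewrite -!(perm_mem nn) in dn d'n; rewrite lk //.
      rewrite !cuts_cat cuts_br (cuts_cons _ g2) cuts_br !cuts_cat /= !linked_cat !linked_cons !linked_cat /=.
      (* The new bracket and the old one contain complementary sets of names, and complementing a
         set does not change which pairs it separates. *)
      have compl c : c \in names ([:: ABr V (ga ++ g1 ++ g2)] ++ g') ->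
          (c \in names (ga ++ g1 ++ g2)) = (c \notin names g').
        rewrite names_cat names_br mem_cat => /orP[] cc.
          rewrite cc; move: u'; rewrite names_cat names_br => /(@uniq_inside _ _ (Some c)) /(_ cc) /=.
          by move=> ->.
        rewrite cc; move: u'; rewrite names_cat names_br => /(@uniq_insider _ _ (Some c)) /(_ cc) /=.
        by move=> ->.
      rewrite !compl //.
      have -> : (d \notin names g') == (d' \notin names g') = ((d \in names g') == (d' \in names g')).
        by do 2!case: (_ \in _).
      move: (_ ==> _) (linked (cuts ga) _ _ _) (linked (cuts g1) _ _ _) (linked (cuts g2) _ _ _).
      by move: (linked _ _ _ _) => [] [] [] [] [].
Qed.

Lemma focus_exists Sg (G : ctx Sg) k C : onth (leaves G) k = Some C ->
  forall acc, exists V Gs, focus acc G k V C Gs.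
Proof.
have onth_catE (T : Type) (s t : seq T) j y : onth (s ++ t) j = Some y ->
    onth s j = Some y \/ exists2 l, onth t l = Some y & j = (size s + l)%N.
  elim: s j => [|z s IH] j /=; first by right; exists j.
  case: j => [|j]; first by left.
  by move=> /= /IH[|[l ? ->]]; [left|right; exists l].
(* Accumulator and siblings stay arbitrary, because entering a bracket puts its siblings into the
   accumulator. *)
pose P (I : item Sg) := forall k C, onth (leaves_item I) k = Some C -> forall acc a b,
  exists V Gs, focus acc (a ++ I :: b) (size (leaves a) + k) V C Gs.
have all_in (s : ctx Sg) : (forall I, List.In I s -> P I) ->
    forall k C, onth (leaves s) k = Some C -> forall acc, exists V Gs, focus acc s k V C Gs.
  move=> H {}k {}C kC acc.
  suff gen a b : s = a ++ b -> forall l, onth (leaves b) l = Some C ->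
      exists V Gs, focus acc s (size (leaves a) + l) V C Gs by apply: (gen [::] s).
  elim: b a => [|I b IHb] a es l lC; first by case: l lC.
  have [lI|[l' l'b ->]] := onth_catE _ _ _ _ _ lC.
    rewrite es; have /H Ib : List.In I s by rewrite es; apply/In_cat; right; left.
    exact: (Ib _ _ lI).
  have [V [Gs F]] := IHb (rcons a I) (etrans es (esym (cat_rcons _ _ _))) l' l'b.
  exists V, Gs; move: F; rewrite /leaves -cats1 map_cat flatten_cat size_cat /= cats0.
  by rewrite addnA.
suff allP : forall I, P I by apply: all_in => I _; exact: allP.
fix IH 1 => -[D|V s] {}k {}C.
  case: k => [|k] /=; last by case: k.
  move=> [->] acc a b; rewrite addn0; exists fset0, (acc ++ a ++ b ++ [:: Leaf C]).
  exact: focus_here.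
move=> kC acc a b.
have sP : forall I, List.In I s -> P I.
  elim: s {kC} => [|J s IHs] I; first by case.
  by case=> [<-|Is]; [exact: IH | exact: (IHs I Is)].
have [W [Gs F]] := all_in s sP k C kC [:: Br V (acc ++ a ++ b)].
exists (V `|` W), Gs; exact: focus_in.
Qed.

(** * Flattenings as faithful namings *)

Definition entry Sg (g : seq (atree Sg)) (A : form Sg) (o : option nat) (C : form Sg) : Prop :=
  if o is Some a then List.In (a, C) (decls g) else C = A.

(* [rho o] names the free variables of the formula at [o] in a flattening: equal
   names are given exactly to linked occurrences of the same variable. *)
Definition faithful Sg (g : seq (atree Sg)) (A : form Sg) (rho : option nat -> nat -> nat) : Prop :=
  forall o o' C C' x x', entry g A o C -> entry g A o' C' -> x \in fv C -> x' \in fv C' ->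
    (rho o x = rho o' x' <-> x = x' /\ linked (cuts g) x o o').

Definition tagged_ctx Sg (g : seq (atree Sg)) (rho : option nat -> nat -> nat) : lctx Sg :=
  [seq (d.1, lren (rho (Some d.1)) (ln d.2)) | d <- decls g].

Definition flat_by Sg (g : seq (atree Sg)) rho (S : bseq Sg) (T : lseq Sg) : Prop :=
  [/\ map (@erase Sg) g = S.1, uniq (names g), faithful g S.2 rho,
      same_decls T.1 (tagged_ctx g rho) & T.2 = lren (rho None) (ln S.2)].

(* Flattening up to the order of the declarations. *)
Definition flat Sg (S : bseq Sg) (T : lseq Sg) : Prop := exists g rho, flat_by g rho S T.

Lemma In_tagged Sg (g : seq (atree Sg)) rho a L :
  List.In (a, L) (tagged_ctx g rho) <->
  exists2 C, List.In (a, C) (decls g) & L = lren (rho (Some a)) (ln C).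
Proof.
rewrite In_map; split=> [[[b C] bC [-> ->]]|[C aC ->]]; first by exists C.
by exists (a, C).
Qed.

Lemma dom_tagged Sg (g : seq (atree Sg)) rho : dom (tagged_ctx g rho) = names g.
Proof. by rewrite /dom /tagged_ctx -map_comp. Qed.

Lemma flat_lfv Sg g rho (S : bseq Sg) T y : flat_by g rho S T ->
  y \in lfv_seq T <-> exists o C x, [/\ entry g S.2 o C, x \in fv C & y = rho o x].
Proof.
move=> [_ _ _ T1 T2]; rewrite mem_cat (same_decls_lfv T1) T2 lfv_lren lfv_ln; split.
  move=> /orP[/mem_lfv_ctx[a [L [/In_tagged[C aC ->]]]]|/mapP[x xA ->]].
    by rewrite lfv_lren lfv_ln => /mapP[x xC ->]; exists (Some a), C, x.
  by exists None, S.2, x.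
move=> [[a|] [C [x [/= oC xC ->]]]]; apply/orP; [left|right; apply: map_f; by rewrite -oC].
apply/mem_lfv_ctx; exists a, (lren (rho (Some a)) (ln C)); split.
  by apply/In_tagged; exists C.
by rewrite lfv_lren lfv_ln map_f.
Qed.

(** A name stands for a class of linked occurrences, and [f] respects links. So [rv] may read its
    value off any occurrence carrying the name: faithfulness makes the result independent of the
    choice. *)
Lemma faithful_transfer Sg f (g g' : seq (atree Sg)) A rho rho' :
  faithful g A rho -> faithful g' A rho' -> renames f g g' ->
  exists rv, forall o C x, entry g A o C -> x \in fv C -> rv (rho o x) = rho' (omap f o) x.
Proof.
move=> F F' R.
pose Q y z := exists o C x, [/\ entry g A o C, x \in fv C, y = rho o x & z = rho' (omap f o) x].
have entry' o C : entry g A o C -> entry g' A (omap f o) C.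
  by case: o => //= a; case: R => _ h _ _ _ /h.
have am o C : entry g A o C -> among (names g) o.
  by case: o => //= a; exact: In_decls_name.
exists (fun y => epsilon (inhabits 0) (Q y)) => o C x oC xC.
have : Q (rho o x) (epsilon (inhabits 0) (Q (rho o x))).
  by apply: epsilon_spec; exists (rho' (omap f o) x), o, C, x.
move: (epsilon _ _) => z [o' [C' [x' [o'C' x'C' e ->]]]].
have [e' lk] := (F _ _ _ _ _ _ oC o'C' xC x'C').1 e; subst x'.
apply/esym/(F' _ _ _ _ _ _ (entry' _ _ oC) (entry' _ _ o'C') xC x'C'); split=> //.
by rewrite (linked_renames _ R) //; [exact: am oC|exact: am o'C'].
Qed.

Lemma entry_renames Sg f (g g' : seq (atree Sg)) A o C :
  renames f g g' -> entry g A o C -> entry g' A (omap f o) C.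
Proof. by move=> [_ h _ _ _]; case: o => //= a /h. Qed.

Lemma entry_among Sg (g : seq (atree Sg)) A o C : entry g A o C -> among (names g) o.
Proof. by case: o => //= a; exact: In_decls_name. Qed.

Lemma flat_alpha Sg (S : bseq Sg) T T' : flat S T -> flat S T' -> exists r, alpha_via r T T'.
Proof.
move=> [g [rho FT]] [g' [rho' FT']].
have [eg ug F T1 T2] := FT; have [eg' ug' F' T1' T2'] := FT'.
have [f R] := ceq_renames (ceq_refl S.1) eg eg' ug ug'.
have [rv rvE] := faithful_transfer F F' R.
have lrenE o C : entry g S.2 o C -> lren rv (lren (rho o) (ln C)) = lren (rho' (omap f o)) (ln C).
  by move=> oC; rewrite lren_comp; apply: lren_ext => x; rewrite lfv_ln /=; exact: rvE.
exists (rv, f); split=> /=.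
- move=> y y' /(flat_lfv _ FT)[o [C [x [oC xC ->]]]] /(flat_lfv _ FT)[o' [C' [x' [o'C' x'C' ->]]]].
  rewrite (rvE _ _ _ oC xC) (rvE _ _ _ o'C' x'C').
  move=> /(F' _ _ _ _ _ _ (entry_renames R oC) (entry_renames R o'C') xC x'C')[e lk]; subst x'.
  apply/(F _ _ _ _ _ _ oC o'C' xC x'C'); split=> //.
  by rewrite -(linked_renames _ R) //; [exact: entry_among oC|exact: entry_among o'C'].
- move=> a b; rewrite !(same_decls_dom T1) dom_tagged; by case: R => f_inj _ _ _ _; exact: f_inj.
- move=> [b L]; rewrite T1' In_tagged In_map; split.
    move=> [C bC ->]; case: (R) => _ _ /(_ b C bC)[a aC ->] _ _.
    exists (a, lren (rho (Some a)) (ln C)); first by apply/T1/In_tagged; exists C.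
    by rewrite /= (lrenE (Some a)).
  move=> [[a L'] /T1/In_tagged[C aC ->] [-> ->]]; exists C; last by rewrite (lrenE (Some a)).
  exact: (@entry_renames _ f g g' S.2 (Some a)).
- by rewrite T2 T2' (lrenE None).
Qed.

Lemma entry_uses Sg (g : seq (atree Sg)) A o C x :
  uniq (names g) -> entry g A o C -> x \in fv C -> uses g o x.
Proof.
by move=> ug oC xC a C' eo aC'; subst o; rewrite (In_decls_fun ug aC' oC).
Qed.

Lemma same_decls_tagged Sg (g h : seq (atree Sg)) rho T :
  (forall d, List.In d (decls h) <-> List.In d (decls g)) ->
  same_decls T (tagged_ctx g rho) -> same_decls T (tagged_ctx h rho).
Proof.
move=> hg Tg [a L]; rewrite Tg !In_tagged.
by split=> -[C aC ->]; exists C => //; apply/hg.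
Qed.

Lemma flat_move Sg (G H : ctx Sg) A T : clean false G H -> flat (G, A) T -> flat (H, A) T.
Proof.
move=> c [g [rho [/= eg ug F T1 T2]]].
have [h [eh dh nh lh]] := clean_move c erefl eg ug.
exists h, rho; split=> //=; first by rewrite (perm_uniq nh).
  have entry_h o C : entry h A o C -> entry g A o C by case: o => //= a /dh.
  move=> o o' C C' x x' /entry_h oC /entry_h o'C' xC x'C'.
  rewrite (F _ _ _ _ _ _ oC o'C' xC x'C'); split=> -[e lk]; split=> //; subst x'.
    by rewrite lh //; [exact: entry_uses oC xC|exact: entry_uses o'C' x'C'].
  by rewrite -lh //; [exact: entry_uses oC xC|exact: entry_uses o'C' x'C'].
by apply: same_decls_tagged T1.
Qed.

(** The hypothesis moves from the goal position to a leaf outside all brackets, where links are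
    those of the goal; it therefore keeps the naming [rho None]. *)
Lemma flat_rcons Sg (G : ctx Sg) A1 A2 g rho a D B1 B2 :
  flat_by g rho (G, Imp A1 A2) (D, LImp B1 B2) -> a \notin dom D ->
  flat_by (rcons g (ALeaf a A1)) (fun o => if o == Some a then rho None else rho o)
    (rcons G (Leaf A1), A2) (rcons D (a, B1), B2).
Proof.
move=> [/= eg ug F T1 [T2 T3]]; rewrite (same_decls_dom T1) dom_tagged => ag.
have an b C : List.In (b, C) (decls g) -> (Some b == Some a) = false.
  by move=> bC; apply/eqP => -[e]; move: (In_decls_name bC); rewrite e (negPf ag).
rewrite -!cats1; split=> /=.
- by rewrite map_cat eg.
- by rewrite names_cat cat_uniq ug -[names [:: _]]/[:: a] /= orbF !andbT.
(* The new leaf and the new goal are both sent back to the old goal, whose free variables include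
   theirs. *)
- pose back o := if o == Some a then None else o.
  have cE : cuts (g ++ [:: ALeaf a A1]) = cuts g by rewrite cuts_cat cats0.
  have backE o C : entry (g ++ [:: ALeaf a A1]) A2 o C ->
      exists C', [/\ entry g (Imp A1 A2) (back o) C', {subset fv C <= fv C'},
        (if o == Some a then rho None else rho o) = rho (back o) &
        forall x o', linked (cuts g) x o o' = linked (cuts g) x (back o) o'].
    rewrite /back; case: o => [b|] /=.
      rewrite decls_cat In_cat decls1 /= => -[bC|[[<- <-]|//]].
        by rewrite (an _ _ bC); exists C; split.
      rewrite eqxx; exists (Imp A1 A2); split=> //; first by move=> x /=; rewrite mem_cat => ->.
      by move=> x o'; apply/linked_eql/linked_outside/negbTE.
    by move=> ->; exists (Imp A1 A2); split=> //; move=> x /=; rewrite mem_cat orbC => ->.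
  move=> o o' C C' x x' /backE[E [oE CE -> lo]] /backE[E' [o'E' C'E' -> lo']] xC x'C'.
  rewrite (F _ _ _ _ _ _ oE o'E' (CE _ xC) (C'E' _ x'C')) cE lo.
  by rewrite [linked _ x _ o']linked_sym lo' linked_sym.
- move=> [b L]; rewrite !In_cat T1 !In_tagged decls_cat decls1 /=; split.
    move=> [[C bC ->]|[[<- <-]|//]].
      by exists C; [apply/In_cat; left | rewrite (an _ _ bC)].
    by exists A1; [apply/In_cat; right; left | rewrite eqxx T2].
  move=> [C /In_cat[bC|[[<- <-]|//]] ->]; first by rewrite (an _ _ bC); left; exists C.
  by right; left; rewrite eqxx T2.
- by [].
Qed.

(** The part of normalization that concerns one formula at a time; unlike normalization, it passes
    to all premises. *)
Definition good Sg (A : form Sg) : bool := uniq (bv A) && all (fun x => x \notin fv A) (bv A).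

(** The bracket separates the goal from the whole context for every variable in [bv (All x A1)]. By
    [good], the only one of these that can be free in [A1] is [x], and it receives the name [y],
    which occurs nowhere else. Links within the context are unchanged, since all of it lies
    inside. *)
Lemma flat_bracket Sg (G : ctx Sg) x A1 g rho y D B1 :
  good (All x A1) -> flat_by g rho (G, All x A1) (D, lall y B1) ->
  y \notin lfv_seq (D, lall y B1) ->
  flat_by [:: ABr [fset z in bv (All x A1)] g]
    (fun o z => if o is Some _ then rho o z else if z == x then y else rho None z)
    (bracket_all G x A1, A1) (D, B1).
Proof.
move=> /andP[u_bv fv_bv] FT yT; have [/= eg ug F T1 T2] := FT.
have ney o C z : entry g (All x A1) o C -> z \in fv C -> rho o z != y.
  move=> oC zC; apply: contraNneq yT => e.
  suff : rho o z \in lfv_seq (D, lall y B1) by rewrite e.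
  by apply/(flat_lfv _ FT); exists o, C, z.
pose rho' o z := if o is Some _ then rho o z else if z == x then y else rho None z.
rewrite -/rho'.
have e1 : B1 = lren (rho' None) (ln A1).
  apply: (@lall_inj _ y); rewrite T2 -[LAll _]/(lren (rho None) (lall x (ln A1))).
  have r'x : rho' None x = y by rewrite /rho' eqxx.
  rewrite -{1}r'x -lren_lall => [|z].
    apply: lren_ext => z; rewrite /= lfv_lbind mem_filter /rho' => /andP[/negPf-> _] //.
  rewrite lfv_ln /rho' eqxx; case: (z =P x) => // /eqP zx zA e.
  have := ney None (All x A1) z erefl; rewrite /= mem_filter zx zA e eqxx.
  by move/(_ isT).
split=> //=.
- by rewrite eg.
- by rewrite names_br.
- have in_g o C : entry [:: ABr [fset z in bv (All x A1)] g] A1 o C ->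
    o = None /\ C = A1 \/ exists2 a, o = Some a & List.In (a, C) (decls g).
    by case: o => [a|] /=; [rewrite decls1; right; exists a|left].
  have goal_leaf a C z z' : List.In (a, C) (decls g) -> z \in fv A1 -> z' \in fv C ->
     (rho' None z = rho (Some a) z' <-> z = z' /\ linked (cuts [:: ABr [fset z in bv (All x A1)] g]) z None (Some a)).
    move=> aC zA z'C; rewrite cuts_br linked_cons /= (In_decls_name aC) eqb_id /rho'.
    rewrite in_fset inE; case: (z =P x) => [->|/eqP zx] /=.
      split=> [e|[_]//]; have := ney (Some a) C z' aC z'C; by rewrite -e eqxx.
    have zA' : z \in fv (All x A1) by rewrite /= mem_filter zx.
    have -> : z \in bv A1 = false.
      by apply/negbTE/negP => zb; have := allP fv_bv z; rewrite /= in_cons zb orbT zA' => /(_ isT).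
    exact: (F None (Some a) (All x A1) C).
  move=> o o' C C' z z' /in_g[[-> ->]|[a -> aC]] /in_g[[-> ->]|[a' -> a'C']] zC z'C'.
  + rewrite linked_refl /rho'; split=> [|[-> _] //].
    case: (z =P x) => [->|/eqP zx]; case: (z' =P x) => [->|/eqP z'x] // e.
    * by have := ney None (All x A1) z' erefl; rewrite /= mem_filter z'x z'C' -e eqxx => /(_ isT).
    * by have := ney None (All x A1) z erefl; rewrite /= mem_filter zx zC e eqxx => /(_ isT).
    * have [] := (F None None (All x A1) (All x A1) z z' erefl erefl _ _).1 e => //.
        by rewrite /= mem_filter zx.
      by rewrite /= mem_filter z'x.
  + exact: goal_leaf a'C' zC z'C'.
  + have := goal_leaf a C z' z aC z'C' zC; rewrite linked_sym => h.
    split=> [e|[e lk]]; first by have [<- ->] := h.1 (esym e).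
    by apply/esym/h.2; rewrite -e.
  + rewrite cuts_br linked_cons /= (In_decls_name aC) (In_decls_name a'C') eqxx implybT /=.
    exact: (F (Some a) (Some a') C C').
- move=> [a L]; rewrite T1 !In_tagged; by rewrite decls1.
Qed.

(** The goal now stands beside the focused occurrence, so a premise, whose free variables are among
    those of [C], takes over the naming [rho (Some a)]. *)
Lemma flat_focus Sg (G : ctx Sg) A g rho T k V C Gs :
  flat_by g rho (G, A) T -> focus [::] G k V C Gs ->
  exists a, [/\ onth (decls g) k = Some (a, C),
    forall x, (x \in V) = ~~ linked (cuts g) x (Some a) None
    & forall A', {subset fv A' <= fv C} -> flat (Gs, A') (T.1, lren (rho (Some a)) (ln A'))].
Proof.
move=> [/= eg ug F T1 T2] foc.
have [a [gs [egs ka ds ns [lV la lk]]]] := focus_reroot foc (erefl : map (@erase Sg) [::] = [::]) eg ug.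
exists a; split=> // A' A'C; exists gs, (fun o => if o is None then rho (Some a) else rho o).
have aC := onth_In ka.
split=> //=; first by rewrite (perm_uniq ns).
- pose home (o : option nat) := if o is None then Some a else o.
  have homeE o E : entry gs A' o E -> exists E', [/\ entry g A (home o) E', {subset fv E <= fv E'},
      (if o is None then rho (Some a) else rho o) = rho (home o) &
      exists2 b, home o = Some b & b \in names g].
    case: o => [b /ds bE|->] /=.
      by exists E; split=> //; exists b => //; exact: In_decls_name bE.
    by exists C; split=> //; exists a => //; exact: In_decls_name aC.
  have lh x o o' : linked (cuts gs) x o o' = linked (cuts gs) x (home o) o'.
    by case: o => //=; apply/esym/linked_eql.
  move=> o o' E E' x x' /homeE[E1 [oE EE1 -> [b hb bg]]] /homeE[E1' [o'E' EE1' -> [b' hb' b'g]]] xE x'E'.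
  rewrite (F _ _ _ _ _ _ oE o'E' (EE1 _ xE) (EE1' _ x'E')).
  have -> : linked (cuts gs) x o o' = linked (cuts gs) x (home o) (home o').
    by rewrite lh linked_sym lh linked_sym.
  by rewrite hb hb' lk.
- move=> [b L]; rewrite T1 !In_tagged.
  by split=> -[E bE ->]; exists E => //; apply/ds.
Qed.

(* From fresh variants to faithful namings *)
Scheme ivariant_mut := Minimality for ivariant Sort Prop
with cvariant_mut := Minimality for cvariant Sort Prop.

Lemma fv_variant Sg (r : nat -> nat) (C D : form Sg) : ln D = lren r (ln C) -> fv D = map r (fv C).
Proof. by move=> e; rewrite -lfv_ln e lfv_lren lfv_ln. Qed.

Lemma cvariant_fv Sg r (G H : ctx Sg) : cvariant r G H -> fv_ctx H =i map r (fv_ctx G).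
Proof.
pose P (r : nat -> nat) (I J : item Sg) := fv_item J =i map r (fv_item I).
elim/(@cvariant_mut _ P) => {r G H} //.
- by move=> r C D e y; rewrite /= (fv_variant e).
- move=> r r' V G H rr' r'_inj _ IH y.
  rewrite /= mem_filter -/(fv_ctx H) -/(fv_ctx G) IH; apply/andP/mapP.
    move=> [yV /mapP[x xG e]]; have xV : x \notin V.
      by apply: contraNN yV => xV; rewrite e; apply/imfsetP; exists x.
    exists x; first by rewrite mem_filter xV.
    by rewrite -rr' //= mem_filter xV.
  move=> [x]; rewrite mem_filter => /andP[xV xG] ->.
  have e : r x = r' x by rewrite rr' //= mem_filter xV.
  rewrite e; split; last exact: map_f.
  apply/imfsetP => -[z /= zV ez]; move/negP: xV; apply.
  by rewrite (r'_inj x z) // mem_cat ?xG ?zV ?orbT.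
- move=> r I J G H _ IHI _ IHG y.
  by rewrite /fv_ctx /= map_cat !mem_cat IHI -!/(fv_ctx _) IHG.
Qed.

Definition bv_ctx Sg (H : ctx Sg) : seq nat := flatten [seq bv_item J | J <- H].

(** The inductive form of faithfulness, for a context without goal. A variable free in the whole
    context is renamed by [r], any other gets a name bound in [H]. Recording which case applies
    allows namings of neighbouring parts to be glued, and [r] to be replaced inside a bracket. *)
Definition named_by Sg (r : nat -> nat) (G H : ctx Sg) : Prop :=
  forall g, map (@erase Sg) g = G -> uniq (names g) -> uniq (bv_ctx H) ->
  {in fv_ctx G &, injective r} -> {in fv_ctx G, forall x, r x \notin bv_ctx H} ->
  exists rho : nat -> nat -> nat,
  [/\ [seq lren (rho d.1) (ln d.2) | d <- decls g] = map (@ln Sg) (leaves H),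
      forall a C x, List.In (a, C) (decls g) -> x \in fv C ->
        if linked (cuts g) x (Some a) None then rho a x = r x else rho a x \in bv_ctx H
    & forall a a' C C' x x', List.In (a, C) (decls g) -> List.In (a', C') (decls g) ->
        x \in fv C -> x' \in fv C' ->
        (rho a x = rho a' x' <-> x = x' /\ linked (cuts g) x (Some a) (Some a'))].

Lemma named_by_cat Sg r (G1 G2 H1 H2 : ctx Sg) :
  named_by r G1 H1 -> named_by r G2 H2 -> named_by r (G1 ++ G2) (H1 ++ H2).
Proof.
move=> IHI IHG g eg; have [gi [g' [-> eI eG]]] := map_eq_cat eg => {g eg} ug.
rewrite /bv_ctx /fv_ctx /leaves !map_cat !flatten_cat -!/(bv_ctx _) -!/(fv_ctx _) -!/(leaves _).
move=> u_bv r_inj r_bv.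
move: (u_bv) (ug); rewrite names_cat !cat_uniq => /and3P[u_J /hasPn dJH u_H] /and3P[u_i _ u_g'].
have r_bv' x : x \in fv_ctx G1 ++ fv_ctx G2 -> (r x \notin bv_ctx H1) && (r x \notin bv_ctx H2).
  by move/r_bv; rewrite mem_cat negb_or.
have memI x : x \in fv_ctx G1 -> x \in fv_ctx G1 ++ fv_ctx G2 by move=> xI; rewrite mem_cat xI.
have memG x : x \in fv_ctx G2 -> x \in fv_ctx G1 ++ fv_ctx G2 by move=> xI; rewrite mem_cat xI orbT.
have [||rho1 [eL1 P1 Q1]] := IHI gi eI u_i u_J.
+ by move=> x y /memI xI /memI yI; exact: r_inj.
+ by move=> x /memI/r_bv'/andP[].
have [||rho2 [eL2 P2 Q2]] := IHG g' eG u_g' u_H.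
+ by move=> x y /memG xI /memG yI; exact: r_inj.
+ by move=> x /memG/r_bv'/andP[].
rewrite names_cat in ug; pose rho a := if a \in names gi then rho1 a else rho2 a.
have r1 a C : List.In (a, C) (decls gi) -> rho a = rho1 a.
  by move=> aC; rewrite /rho (In_decls_name aC).
have out1 a C : List.In (a, C) (decls g') -> inside (Some a) (names gi) = false.
  by move=> aC; apply: (uniq_insider ug); exact: In_decls_name aC.
have out2 a C : List.In (a, C) (decls gi) -> inside (Some a) (names g') = false.
  by move=> aC; apply: (uniq_inside ug); exact: In_decls_name aC.
have r2 a C : List.In (a, C) (decls g') -> rho a = rho2 a.
  by move=> aC; rewrite /rho; have /= -> := out1 a C aC.
(* Only variables free in both parts are linked across them. Two free ones are told apart by
   injectivity of [r], a free one from a bound one by [r_bv], and two bound ones by the distinctness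
   of the names bound in [H1] and [H2]. *)
have cross a a' C C' x x' : List.In (a, C) (decls gi) -> List.In (a', C') (decls g') ->
    x \in fv C -> x' \in fv C' ->
    (rho1 a x = rho2 a' x' <-> x = x' /\ linked (cuts (gi ++ g')) x (Some a) (Some a')).
  move=> aC a'C' xC x'C'; rewrite cuts_cat linked_cat (linked_outsider _ _ (out1 _ _ a'C')).
  rewrite [linked _ _ _ (Some a')]linked_sym (linked_outsider _ _ (out2 _ _ aC)).
  have := P1 a C x aC xC; have := P2 a' C' x' a'C' x'C'.
  case lk': (linked (cuts g') x' _ _) => e'; case lk: (linked (cuts gi) x _ _) => e /=.
  * rewrite e e'; split=> [/r_inj->|[-> _] //].
    - by rewrite lk'.
    - by rewrite mem_cat -eI (linked_free aC xC lk).
    - by rewrite mem_cat -eG (linked_free a'C' x'C' lk') orbT.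
  * split=> [ee|[]//]; move: e; rewrite ee e' => rJ.
    have /r_bv' : x' \in fv_ctx G1 ++ fv_ctx G2 by rewrite mem_cat -eG (linked_free a'C' x'C' lk') orbT.
    by rewrite rJ.
  * split=> [ee|[ex lk2]]; last by rewrite ex lk' in lk2.
    have /r_bv' : x \in fv_ctx G1 ++ fv_ctx G2 by rewrite mem_cat -eI (linked_free aC xC lk).
    by rewrite -e ee e' andbF.
  * split=> [ee|[]//]; have := dJH _ e'; by rewrite /= -ee e.
exists rho; rewrite decls_cat; split.
+ rewrite !map_cat -eL1 -eL2; congr cat; apply: eq_map_In => -[a C] aC /=.
    by rewrite (r1 _ _ aC).
  by rewrite (r2 _ _ aC).
+ move=> a C x /In_cat[aC|aC] xC; rewrite cuts_cat linked_cat.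
    rewrite (linked_outside _ (out2 _ _ aC)) andbT (r1 _ _ aC).
    by have := P1 a C x aC xC; case: ifP => // _; rewrite mem_cat => ->.
  rewrite (linked_outside _ (out1 _ _ aC)) (r2 _ _ aC).
  by have := P2 a C x aC xC; case: ifP => // _; rewrite mem_cat orbC => ->.
+ move=> a a' C C' x x' /In_cat[aC|aC] /In_cat[a'C'|a'C'] xC x'C'.
  * rewrite (r1 _ _ aC) (r1 _ _ a'C') (Q1 _ _ _ _ _ _ aC a'C' xC x'C') cuts_cat linked_cat.
    by rewrite (linked_outside2 _ (out2 _ _ aC) (out2 _ _ a'C')) andbT.
  * by rewrite (r1 _ _ aC) (r2 _ _ a'C'); apply: cross aC a'C' xC x'C'.
  * rewrite (r2 _ _ aC) (r1 _ _ a'C'); have h := cross _ _ _ _ _ _ a'C' aC x'C' xC.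
    rewrite linked_sym; split=> [e|[ex lk]]; first by have [<- ->] := h.1 (esym e).
    by apply/esym/h; rewrite -ex.
  * rewrite (r2 _ _ aC) (r2 _ _ a'C') (Q2 _ _ _ _ _ _ aC a'C' xC x'C') cuts_cat linked_cat.
    by rewrite (linked_outside2 _ (out1 _ _ aC) (out1 _ _ a'C')).
Qed.

Lemma cvariant_named Sg r (G H : ctx Sg) : cvariant r G H -> named_by r G H.
Proof.
pose P (r : nat -> nat) (I J : item Sg) := named_by r [:: I] [:: J].
elim/(@cvariant_mut _ P) => {r G H}.
- move=> r C D e g0 eg0; have [i [g' [-> ei e']]] := map_eq_cons eg0; case: g' e' => // _.
  case: i ei => // a ? [->] _ _; rewrite /fv_ctx /= cats0 => r_inj _.
  exists (fun=> r); split; first by rewrite /= e.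
    by move=> b E x _ _.
  move=> b b' E E' x x' /= [[-> <-]|//] [[-> <-]|//] xC x'C.
  by split=> [/(r_inj _ _ xC x'C)->|[-> _]].
- move=> r r' V G H rr' r'_inj _ IH g0 eg0.
  have [i [g' [-> ei e']]] := map_eq_cons eg0; case: g' e' => // _.
  have [g [-> eg]] := erase_br_inv ei.
  rewrite names_br /fv_ctx /bv_ctx /= !cats0 -/(fv_ctx G) -/(bv_ctx H) => ug u_bv r_inj r_bv.
  move: (u_bv); rewrite cat_uniq => /and3P[_ /hasPn disj u_H].
  have inV x : x \in V -> r' x \in enum_fset [fset r' x | x in V].
    by move=> xV; apply/imfsetP; exists x.
  have fvE x : x \in fv_ctx G -> x \notin V -> x \in fv_item (Br V G).
    by move=> xG xV; rewrite /= mem_filter xV.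
  have [|x xG|rho [eL P1 P2]] := IH g eg ug u_H.
  + by move=> x y xG yG; apply: r'_inj; rewrite mem_cat ?xG ?yG orbT.
  (* Names given to [V] belong to the bracket itself, and all bound names of the variant are
     distinct; so they do not occur among the names bound further inside. *)
  + case xV: (x \in V); first by apply/negP => /disj; rewrite /= inV.
    have xI := fvE x xG (negbT xV); rewrite rr' //.
    by have := r_bv x xI; rewrite mem_cat negb_or => /andP[].
  exists rho; rewrite decls1 decls_br; split.
  + by rewrite eL /leaves /= cats0.
  + move=> a C x aC xC; have := P1 a C x aC xC.
    rewrite cuts_br linked_cons /= (In_decls_name aC) implybF.
    case lk: (linked (cuts g) x _ _); last by rewrite andbF mem_cat => ->; rewrite orbT.
    rewrite andbT => ->; case xV: (x \in V) => /=; first by rewrite mem_cat inV.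
    by apply: rr'; apply: fvE; rewrite ?xV // -eg; apply: linked_free aC xC lk.
  + move=> a a' C C' x x' aC a'C' xC x'C'; rewrite (P2 _ _ _ _ _ _ aC a'C' xC x'C').
    by rewrite cuts_br linked_cons /= (In_decls_name aC) (In_decls_name a'C') eqxx implybT.
- by move=> r [] // _ _ _ _ _; exists (fun=> id); split.
- by move=> r I J G H _ IHI _; exact: (named_by_cat IHI).
Qed.

Lemma cvariant_size Sg r (G H : ctx Sg) : cvariant r G H -> size (leaves H) = size (leaves G).
Proof.
pose P (r : nat -> nat) (I J : item Sg) := size (leaves_item J) = size (leaves_item I).
elim/(@cvariant_mut _ P) => {r G H} // r I J G H _ IHI _ IHG.
by rewrite /leaves /= !size_cat IHI IHG.
Qed.

Lemma annotate Sg (G : ctx Sg) ns : size ns = size (leaves G) ->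
  exists g, map (@erase Sg) g = G /\ names g = ns.
Proof.
have all_in (s : ctx Sg) : (forall I, List.In I s -> forall ms, size ms = size (leaves_item I) ->
      exists i, erase i = I /\ names [:: i] = ms) ->
    forall ms, size ms = size (leaves s) -> exists g, map (@erase Sg) g = s /\ names g = ms.
  elim: s => [|I s IH] H ms; first by case: ms => // _; exists [::].
  rewrite /leaves /= size_cat => sz.
  have [||i [ei ni]] := H I _ (take (size (leaves_item I)) ms); first by left.
    by rewrite size_take sz; case: ltnP => //; lia.
  have [||g [eg ng]] := IH _ (drop (size (leaves_item I)) ms).
  - by move=> J Js; apply: H; right.
  - by rewrite size_drop sz addKn.
  by exists (i :: g); rewrite /= ei eg names_cons ni ng cat_take_drop.
move: ns; apply: (all_in G) => I _; move: I; fix IH 1 => -[C|V s] ms.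
  by case: ms => [|a [|//]] // _; exists (ALeaf a C).
have sP : forall I, List.In I s -> forall ms, size ms = size (leaves_item I) ->
      exists i, erase i = I /\ names [:: i] = ms.
  elim: s => [|J s IHs] I; first by case.
  by case=> [<-|Is]; [exact: IH | exact: (IHs I Is)].
move=> /(all_in s sP)[g [eg ng]]; exists (ABr V g).
by rewrite /= eg names_br.
Qed.

(** Normalization of the variant keeps the names bound in the context away from the free names of
    the goal. So the goal can share a name with a leaf only through a variable that no bracket
    binds, which is what a link with the goal means. *)
Lemma flattening_naming Sg (S : bseq Sg) T g : flattening S T ->
  map (@erase Sg) g = S.1 -> uniq (names g) ->
  exists rho, [/\ faithful g S.2 rho, T.2 = lren (rho None) (ln S.2)
    & [seq d.2 | d <- T.1] = [seq lren (rho (Some d.1)) (ln d.2) | d <- decls g]].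
Proof.
move: S T => [G A] [D B] [[H B0] [/= [/andP[u_bv /allP fv_bv] [r [/= r_inj cv eB0]]] u_dom eD eB]] eg ug.
rewrite /bv_seq /= in u_bv fv_bv; rewrite cat_uniq in u_bv.
have fvH := cvariant_fv cv.
have [|||rho [eL P Q]] := cvariant_named cv eg ug; rewrite -?/(bv_ctx H) in u_bv fv_bv *.
- by case/and3P: u_bv.
- by move=> x y xG yG; apply: r_inj; rewrite mem_cat ?xG ?yG.
- move=> x xG; apply/negP => bx; have := fv_bv (r x); rewrite mem_cat bx => /(_ isT).
  by rewrite mem_cat fvH map_f.
exists (fun o => if o is Some a then rho a else r); split=> //=; last by rewrite eD eL.
  have goal_leaf a C x x' : List.In (a, C) (decls g) -> x \in fv A -> x' \in fv C ->
      (r x = rho a x' <-> x = x' /\ linked (cuts g) x' (Some a) None).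
    move=> aC xA x'C; have := P a C x' aC x'C; case lk: (linked _ _ _ _) => e.
      rewrite e; split=> [/r_inj->|[-> _] //] //; rewrite mem_cat ?xA ?orbT //.
      by rewrite -eg (linked_free aC x'C lk).
    split=> [ee|[]//]; have := fv_bv (rho a x'); rewrite mem_cat e => /(_ isT).
    by rewrite mem_cat negb_or -ee (fv_variant eB0) map_f // andbF.
  move=> [a|] [a'|] C C' x x' /= aC a'C' xC x'C'.
  - exact: Q aC a'C' xC x'C'.
  - subst C'; have h := goal_leaf _ _ _ _ aC x'C' xC.
    split=> [e|[ex lk]]; first by have [<- ->] := h.1 (esym e).
    by apply/esym/h; rewrite -ex.
  - subst C; rewrite (goal_leaf _ _ _ _ a'C' xC x'C').
    by split=> -[-> lk]; split=> //; rewrite linked_sym.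
  - subst; rewrite linked_refl; split=> [/r_inj->|[-> _]] //; by rewrite mem_cat ?xC ?x'C' orbT.
by rewrite eB eB0.
Qed.

Lemma pair_seq_ext T U (s t : seq (T * U)) :
  map fst s = map fst t -> map snd s = map snd t -> s = t.
Proof.
by elim: s t => [|[a b] s IH] [|[c d] t] //= [-> /IH e] [-> /e->].
Qed.

Lemma flattening_flat Sg (S : bseq Sg) T : flattening S T ->
  exists g rho, flat_by g rho S T /\ T.1 = tagged_ctx g rho.
Proof.
move=> FT; have [H [[_ [r [_ cv _]]] u_dom eD _]] := FT.
have [|g [eg ng]] := @annotate _ S.1 (dom T.1).
  by rewrite -(cvariant_size cv) size_map -(size_map snd) eD size_map.
have ug : uniq (names g) by rewrite ng.
have [rho [F eB eT]] := flattening_naming FT eg ug.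
have eT1 : T.1 = tagged_ctx g rho.
  apply: pair_seq_ext; last by rewrite [LHS]eT /tagged_ctx -map_comp.
  by rewrite -[LHS]/(dom T.1) -ng -(dom_tagged g rho).
by exists g, rho; split=> //; split=> //; rewrite -eT1.
Qed.

(** * Existence of flattenings, and faithful namings as flattenings *)

Lemma form_fresh Sg (C : form Sg) r n : {in fv C, forall x, r x < n} ->
  exists D m, [/\ n <= m, ln D = lren r (ln C), uniq (bv D) & all (fun y => n <= y < m) (bv D)].
Proof.
elim: C r n => [p ts|C1 IH1 C2 IH2|x C IH] r n lt_n /=.
- exists (Atom [ffun i => tmap r (ts i)]), n; split=> //=.
  congr LAtom; apply/ffunP => i; rewrite !ffunE !tmap_comp.
  by apply: (tmap_rel (f := id) (g := id)) => // v w _ _ ->.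
- have [|D1 [m1 [nm1 e1 u1 b1]]] := IH1 r n; first by move=> x xC; apply: lt_n; rewrite /= mem_cat xC.
  have [|D2 [m2 [nm2 e2 u2 b2]]] := IH2 r m1.
    by move=> x xC; apply: leq_trans nm1; apply: lt_n; rewrite /= mem_cat xC orbT.
  exists (Imp D1 D2), m2; split=> /=; [lia|by rewrite e1 e2| |].
    rewrite cat_uniq u1 u2 andbT; apply/hasPn => y /(allP b2) y2; apply/negP => /(allP b1); lia.
  rewrite all_cat; apply/andP; split; apply/allP => y; [move=> /(allP b1)|move=> /(allP b2)]; lia.
(* The binder takes [n] itself and the body uses names from [n.+1] on. All bound names lie in an
   interval above the values of [r], which makes distinctness arithmetical. *)
- pose r' y := if y == x then n else r y.
  have lt_r y : y \in fv C -> y != x -> r y < n by move=> yC yx; apply: lt_n; rewrite /= mem_filter yx.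
  have [|D [m [nm e u b]]] := IH r' n.+1.
    by move=> y yC; rewrite /r'; case: (y =P x) => // /eqP yx; rewrite ltnS ltnW ?lt_r.
  exists (All n D), m; split=> /=; first by lia.
  + have r'x : r' x = n by rewrite /r' eqxx.
    rewrite e -r'x -[LAll _]/(lren r (lall x (ln C))) -lren_lall.
      apply: lren_ext => y; rewrite /= lfv_lbind mem_filter /r' => /andP[/negPf-> _] //.
    move=> y; rewrite lfv_ln r'x /r'; case: (y =P x) => // /eqP yx yC e'.
    by have := lt_r y yC yx; rewrite e' ltnn.
  + by rewrite u andbT; apply/negP => /(allP b); lia.
  + by rewrite leqnn nm; apply/allP => y /(allP b); lia.
Qed.

Lemma item_fresh Sg (G : ctx Sg) r n :
  {in fv_ctx G &, injective r} -> {in fv_ctx G, forall x, r x < n} ->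
  exists H m, [/\ n <= m, cvariant r G H, uniq (bv_ctx H) & all (fun y => n <= y < m) (bv_ctx H)].
Proof.
pose P (I : item Sg) := forall r n, {in fv_item I &, injective r} -> {in fv_item I, forall x, r x < n} ->
  exists J m, [/\ n <= m, ivariant r I J, uniq (bv_item J) & all (fun y => n <= y < m) (bv_item J)].
have all_in (s : ctx Sg) : (forall I, List.In I s -> P I) ->
    forall r n, {in fv_ctx s &, injective r} -> {in fv_ctx s, forall x, r x < n} ->
    exists H m, [/\ n <= m, cvariant r s H, uniq (bv_ctx H) & all (fun y => n <= y < m) (bv_ctx H)].
  elim: s => [|I s IH] HP {}r {}n; first by exists [::], n; split=> //; constructor.
  rewrite /fv_ctx /= -/(fv_ctx s) => r_inj lt_n.
  have [|||J [m1 [nm1 v1 u1 b1]]] := HP I _ r n; first by left.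
  + by move=> x y xI yI; apply: r_inj; rewrite mem_cat ?xI ?yI.
  + by move=> x xI; apply: lt_n; rewrite mem_cat xI.
  have [|||H [m2 [nm2 v2 u2 b2]]] := IH _ r m1; first by move=> K Ks; apply: HP; right.
  + by move=> x y xI yI; apply: r_inj; rewrite mem_cat ?xI ?yI orbT.
  + by move=> x xI; apply: leq_trans nm1; apply: lt_n; rewrite mem_cat xI orbT.
  exists (J :: H), m2; rewrite /bv_ctx /= -/(bv_ctx H); split; first by lia.
  + by constructor.
  + rewrite cat_uniq u1 u2 andbT; apply/hasPn => y /(allP b2) y2; apply/negP => /(allP b1); lia.
  + rewrite all_cat; apply/andP; split; apply/allP => y; [move=> /(allP b1)|move=> /(allP b2)]; lia.
move: r n; apply: (all_in G) => I _; move: I; fix IH 1 => -[C|V s] r n.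
  move=> _ /= lt_n; have [D [m [nm e u b]]] := form_fresh lt_n.
  by exists (Leaf D), m; split=> //; constructor.
have sP : forall I, List.In I s -> P I.
  elim: s => [|J s IHs] I; first by case.
  by case=> [<-|Is]; [exact: IH | exact: (IHs I Is)].
move=> r_inj lt_n; pose N := size (enum_fset V).
(* The variables of the bracket take the [N] names from [n] on, in the order of [enum_fset V]; names
   bound in the contents start at [n + N]. *)
pose r' x := if x \in V then (n + index x (enum_fset V))%N else r x.
have ltV x : x \in V -> index x (enum_fset V) < N by move=> xV; rewrite index_mem.
have inI x : x \in fv_ctx s -> x \notin V -> x \in fv_item (Br V s).
  by move=> xs xV; rewrite /= mem_filter xV.
have r'_inj : {in enum_fset V ++ fv_ctx s &, injective r'}.
  move=> x y; rewrite !mem_cat /r' -[x \in enum_fset V]/(x \in V) -[y \in enum_fset V]/(y \in V).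
  case: ifP => xV xs; case: ifP => yV ys /=.
  - by move=> /addnI e; rewrite -(nth_index 0 (xV : x \in enum_fset V)) e nth_index.
  - by have := lt_n y (inI y ys (negbT yV)); lia.
  - by have := lt_n x (inI x xs (negbT xV)); lia.
  - by apply: r_inj; apply: inI; rewrite ?xV ?yV.
have [||H [m [nm v u b]]] := all_in s sP r' (n + N)%N.
- by move=> x y xs ys; apply: r'_inj; rewrite mem_cat ?xs ?ys orbT.
- move=> x xs; rewrite /r'; case: ifP => xV; first by rewrite ltn_add2l ltV.
  by apply: ltn_addr; apply: lt_n; apply: inI; rewrite ?xV.
have bV y : y \in enum_fset [fset r' x | x in V] -> n <= y < (n + N)%N.
  move=> /imfsetP[x /= xV ->]; rewrite /r' xV; have := ltV x xV; lia.
exists (Br [fset r' x | x in V] H), m; split=> /=; first by lia.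
- constructor=> // x; rewrite /= mem_filter => /andP[/negPf xV _]; by rewrite /r' xV.
- rewrite -/(bv_ctx H) cat_uniq fset_uniq u andbT; apply/hasPn => y /(allP b) y2.
  by apply/negP => /bV; lia.
- rewrite -/(bv_ctx H) all_cat; apply/andP; split; apply/allP => y; first by move=> /bV; lia.
  by move=> /(allP b); lia.
Qed.

Lemma flattening_of_variant Sg (S T : bseq Sg) ns :
  fresh_variant S T -> uniq ns -> size ns = size (leaves S.1) ->
  flattening S (zip ns (map (@ln Sg) (leaves T.1)), ln T.2).
Proof.
move=> FT u_ns sz; have [_ [r [_ cv _]]] := FT; exists T; split=> //=.
  by rewrite /dom -/(unzip1 _) unzip1_zip // size_map (cvariant_size cv) sz.
by rewrite -/(unzip2 _) unzip2_zip // size_map (cvariant_size cv) sz.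
Qed.

Lemma fresh_variant_exists Sg (S : bseq Sg) : exists T, fresh_variant S T.
Proof.
case: S => G A; pose n := fresh (fv_seq (G, A)).
have lt_n x : x \in fv_seq (G, A) -> x < n.
  rewrite /n /fresh ltnS; elim: (fv_seq _) => //= y s IH.
  by rewrite in_cons => /orP[/eqP->|/IH]; lia.
have [||H [m [nm cv uH bH]]] := @item_fresh _ G id n; first by move=> x y _ _.
  by move=> x xG; apply: lt_n; rewrite mem_cat xG.
have [|B [m' [nm' eB uB bB]]] := @form_fresh _ A id m.
  by move=> x xA; apply: leq_trans nm; apply: lt_n; rewrite mem_cat xA orbT.
exists (H, B); split; last by exists id; split=> // x y _ _.
have fvE x : x \in fv_seq (H, B) -> x < n.
  rewrite mem_cat (cvariant_fv cv) (fv_variant eB) !map_id -mem_cat; exact: lt_n.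
rewrite /normalized /bv_seq /= -/(bv_ctx H) cat_uniq uH uB /= andbT; apply/andP; split.
  by apply/hasPn => y /(allP bB) y2; apply/negP => /(allP bH); lia.
rewrite all_cat; apply/andP; split; apply/allP => y.
  by move=> /(allP bH) y1; apply/negP => /fvE; lia.
by move=> /(allP bB) y1; apply/negP => /fvE; lia.
Qed.

Lemma flattening_exists Sg (S : bseq Sg) : exists T, flattening S T.
Proof.
have [T FT] := fresh_variant_exists S.
exists (zip (iota 0 (size (leaves S.1))) (map (@ln Sg) (leaves T.1)), ln T.2).
by apply: flattening_of_variant; rewrite ?iota_uniq ?size_iota.
Qed.

(** Bound names are renamed along with free ones, so an injective [f] causes no capture and keeps
    distinct names distinct. *)
Fixpoint fren Sg (f : nat -> nat) (A : form Sg) : form Sg :=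
  match A with
  | Atom p ts => Atom [ffun i => tmap f (ts i)]
  | Imp A B => Imp (fren f A) (fren f B)
  | All x A => All (f x) (fren f A)
  end.

Fixpoint iren Sg (f : nat -> nat) (I : item Sg) : item Sg :=
  match I with
  | Leaf C => Leaf (fren f C)
  | Br V G => Br [fset f x | x in V] [seq iren f J | J <- G]
  end.

Lemma ln_fren Sg f (A : form Sg) : injective f -> ln (fren f A) = lren f (ln A).
Proof.
move=> f_inj; elim: A => /= [p ts|A -> B ->|x A ->] //.
  by congr LAtom; apply/ffunP => i; rewrite !ffunE !tmap_comp.
rewrite -[RHS]/(lren f (lall x (ln A))) lren_lall // => y _; exact: f_inj.
Qed.

Lemma bv_fren Sg f (A : form Sg) : bv (fren f A) = map f (bv A).
Proof. by elim: A => //= [A -> B ->|x A ->] //; rewrite map_cat. Qed.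

Lemma bv_iren Sg f (G : ctx Sg) : injective f ->
  perm_eq (bv_ctx (map (iren f) G)) (map f (bv_ctx G)).
Proof.
move=> f_inj; pose P (I : item Sg) := perm_eq (bv_item (iren f I)) (map f (bv_item I)).
have all_in (s : ctx Sg) : (forall I, List.In I s -> P I) -> perm_eq (bv_ctx (map (iren f) s)) (map f (bv_ctx s)).
  elim: s => //= I s IH H; rewrite /bv_ctx /= map_cat; apply: perm_cat; first by apply: H; left.
  by apply: IH => J Js; apply: H; right.
apply: (all_in G) => I _; move: I; fix IH 1 => -[C|V s]; rewrite /P /=; first by rewrite bv_fren.
rewrite map_cat; apply: perm_cat.
  apply: uniq_perm; rewrite ?fset_uniq ?map_inj_uniq ?fset_uniq // => y.
  by apply/imfsetP/mapP => -[x xV ->]; exists x.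
apply: (all_in s) => I; elim: s => [|J s IHs]; first by case.
by case=> [<-|Is]; [exact: IH | exact: (IHs Is)].
Qed.

Lemma cvariant_iren Sg r f (G H : ctx Sg) : injective f ->
  cvariant r G H -> cvariant (f \o r) G (map (iren f) H).
Proof.
move=> f_inj; pose P r (I J : item Sg) := ivariant (f \o r) I (iren f J).
elim/(@cvariant_mut _ P) => {r G H}.
- by move=> r C D e; constructor; rewrite ln_fren // e lren_comp.
- move=> r r' V G H rr' r'_inj _ IH; rewrite /P /=.
  have -> : [fset f x | x in [fset r' x | x in V]] = [fset (f \o r') x | x in V].
    apply/fsetP => y; apply/imfsetP/imfsetP => /= [[_ /imfsetP[x /= xV ->] ->]|[x xV ->]].
      by exists x.
    by exists (r' x) => //; apply/imfsetP; exists x.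
  constructor=> //; first by move=> x /rr' /= ->.
  by move=> x y xG yG /f_inj; exact: r'_inj.
- by move=> r; constructor.
- by move=> r I J G H _ ? _ ?; constructor.
Qed.

Lemma fresh_variant_iren Sg f (S T : bseq Sg) : injective f ->
  fresh_variant S T -> fresh_variant S (map (iren f) T.1, fren f T.2).
Proof.
move: T => [H B] f_inj [/andP[u_bv /allP fv_bv] [r [/= r_inj cv eB]]]; split; last first.
  exists (f \o r); split=> /=; last by rewrite ln_fren // eB lren_comp.
    by move=> x y xS yS /f_inj; exact: r_inj.
  exact: cvariant_iren.
have bvE : perm_eq (bv_seq (map (iren f) H, fren f B)) (map f (bv_seq (H, B))).
  by rewrite /bv_seq /= -!/(bv_ctx _) map_cat bv_fren perm_cat2r bv_iren.
have fvE y : y \in fv_seq (map (iren f) H, fren f B) -> y \in map f (fv_seq (H, B)).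
  rewrite map_cat !mem_cat /= (cvariant_fv (cvariant_iren f_inj cv)) map_comp.
  rewrite (fv_variant (r := f) (C := B)) ?ln_fren // => /orP[|->]; last by rewrite orbT.
  by move=> /mapP[z zr ->]; rewrite mem_map // (cvariant_fv cv) zr.
rewrite /normalized (perm_uniq bvE) map_inj_uniq // u_bv; apply/allP => y.
rewrite (perm_mem bvE) => /mapP[x xb ->]; apply: contraNN (fv_bv x xb) => /fvE.
by rewrite mem_map.
Qed.

(** A faithful naming is realized by an actual variant. The naming of any fresh variant differs from
    [rho] by a map injective on the names in use; an injective extension of this map, applied to all
    names of the variant at once, keeps it normalized. *)
Lemma flat_flattening Sg g rho (S : bseq Sg) T :
  flat_by g rho S T -> T.1 = tagged_ctx g rho -> flattening S T.
Proof.
case: T => D B [eg ug F _ /= eB] /= eD; subst D B.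
have [T0 FT0] := fresh_variant_exists S.
have szg : size (names g) = size (leaves S.1).
  rewrite -eg /names size_map; elim: (g) => //= i s IH; rewrite decls_cons size_cat IH /leaves /= size_cat.
  congr addn; elim/atree_ind': i => //= V h IHh; rewrite !size_flatten /shape -!map_comp.
  by congr sumn; apply: eq_map_In => j /IHh.
have FT := flattening_of_variant FT0 ug szg.
have [rho0 [F0 /= eB0 eD0]] := flattening_naming FT eg ug.
have szT : size (names g) = size (map (@ln Sg) (leaves T0.1)).
  by have [_ [r [_ cv _]]] := FT0; rewrite size_map (cvariant_size cv).
rewrite -/(unzip2 _) unzip2_zip ?szT // in eD0.
have R : renames id g g.
  split=> // [b C bC|c cg|c cg]; first by exists b.
    by exists c => //; split=> // b; rewrite map_id.
  by exists c => //; split=> // b; rewrite map_id.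
have [rv rvE] := faithful_transfer F0 F R.
pose used := flatten [seq [seq rho0 (Some d.1) x | x <- fv d.2] | d <- decls g] ++ map (rho0 None) (fv S.2).
have usedP y : y \in used -> exists o C x, [/\ entry g S.2 o C, x \in fv C & y = rho0 o x].
  rewrite mem_cat => /orP[/mem_flatten_map_In[[a C] aC /mapP[x xC ->]]|/mapP[x xC ->]].
    by exists (Some a), C, x.
  by exists None, S.2, x.
have rv_inj : {in used &, injective rv}.
  move=> y y' /usedP[o [C [x [oC xC ->]]]] /usedP[o' [C' [x' [o'C' x'C' ->]]]].
  rewrite (rvE _ _ _ oC xC) (rvE _ _ _ o'C' x'C').
  have -> : omap id o = o by case: (o).
  have -> : omap id o' = o' by case: (o').
  by move=> /(F _ _ _ _ _ _ oC o'C' xC x'C') h; apply/(F0 _ _ _ _ _ _ oC o'C' xC x'C').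
have [f f_inj fE] := extend_injective rv_inj.
have lrenE o C : entry g S.2 o C -> lren f (lren (rho0 o) (ln C)) = lren (rho o) (ln C).
  move=> oC; rewrite lren_comp; apply: lren_ext => x; rewrite lfv_ln /= => xC.
  rewrite fE ?(rvE _ _ _ oC xC); first by case: (o).
  rewrite mem_cat; case: o oC => [a|] /= aC; apply/orP; [left|right; by rewrite -aC map_f].
  by apply/mem_flatten_map_In; exists (a, C) => //; apply: map_f.
exists (map (iren f) T0.1, fren f T0.2); split; first exact: fresh_variant_iren.
- by rewrite dom_tagged.
- have lE (s : ctx Sg) : leaves (map (iren f) s) = map (fren f) (leaves s).
    have l1 (I : item Sg) : leaves_item (iren f I) = map (fren f) (leaves_item I).
      move: I; fix IH 1 => -[C|V h] //=; rewrite map_flatten_map -map_comp; congr flatten.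
      by elim: h => //= J h ->; rewrite IH.
    by rewrite /leaves map_flatten_map -map_comp; congr flatten; apply: eq_map => I /=.
  rewrite lE -map_comp /tagged_ctx -map_comp.
  rewrite (eq_map (g := lren f \o @ln Sg)); last by move=> C /=; rewrite ln_fren.
  rewrite [RHS]map_comp eD0 -[RHS]map_comp; apply: eq_map_In => -[a C] aC /=.
  by rewrite (lrenE (Some a)).
- by rewrite /= ln_fren // eB0 (lrenE None).
Qed.

(** * A contraction undone by a partial duplication *)

Lemma shift_eq M m m' (b b' : bool) : m < M -> m' < M -> (m = m' -> b = b') ->
  (if b then M + m else m)%N = (if b' then M + m' else m')%N <-> m = m'.
Proof.
move=> lt_m lt_m' bb'; split=> [|e]; last by rewrite (bb' e) e.
by case: b b' {bb'} => -[]; lia.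
Qed.

(* The variables bound inside the kept copy are shifted past all names of [T];
   sigma_1 and sigma_2 send them to their names in the two copies of [T]. *)
Lemma flat_contract Sg (G H : ctx Sg) A T : clean true G H -> flat (G, A) T ->
  exists T1 d, flattening (H, A) T1 /\ partial_dup d T1 T.
Proof.
move=> c [g [rho FT]]; have [/= eg ug F T1E T2E] := FT.
have [h [gi [gj [f [eh [r cd ck cn cl cc cb cbc ci cf]]]]]] := clean_contraction c erefl eg ug.
have [f_inj gij gji _ _] := r.
have u_hj : uniq (names h ++ names gj) by rewrite -(perm_uniq cn).
have uh : uniq (names h) by move: u_hj; rewrite cat_uniq => /and3P[].
have ih a : a \in names gi -> a \in names h.
  by move=> /mem_names[C /ck aC]; exact: In_decls_name aC.
have fj a : a \in names gi -> f a \in names gj.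
  by move=> ai; rewrite (renames_names r) map_f.
have h_notj a : a \in names h -> inside (Some a) (names gj) = false.
  exact: (@uniq_inside _ _ (Some a) u_hj).
have j_noti a : a \in names gj -> inside (Some a) (names gi) = false.
  by move=> aj; apply: contraTF aj => /= /ih/h_notj /= ->.
have e_h o C : entry h A o C -> entry g A o C.
  by case: o => //= a aC; apply/cd; left.
have e_h_notj o C : entry h A o C -> inside o (names gj) = false.
  by case: o => //= a aC; apply: h_notj; exact: In_decls_name aC.
have e_j a C : List.In (a, C) (decls gj) -> entry g A (Some a) C.
  by move=> aC; apply/cd; right.
have [M ltM] : exists M, forall o C x, entry g A o C -> x \in fv C -> rho o x < M.
  exists (fresh (lfv_seq T)) => o C x oC xC.
  have : rho o x \in lfv_seq T by apply/(flat_lfv _ FT); exists o, C, x.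
  rewrite /fresh ltnS; elim: (lfv_seq T) => //= y s IH.
  by rewrite in_cons => /orP[/eqP->|/IH]; lia.
(* These are the variables whose names differ between the two copies. Whole classes are concerned,
   since a link from such a variable does not leave the copy. *)
pose bnd o x := if o is Some a then (a \in names gi) && ~~ linked (cuts gi) x (Some a) None else false.
have bnd_linked o o' x : linked (cuts g) x o o' -> bnd o x -> bnd o' x.
  case: o => //= a lk /andP[ai bx]; have := cb x a o' ai lk; rewrite (negPf bx) orbF.
  case: o' lk => //= a' lk a'i; rewrite a'i; apply: contraNN bx.
  exact: linked_trans (ci x a a' ai a'i lk).
pose rho1 o x := if bnd o x then (M + rho o x)%N else rho o x.
have F1 : faithful h A rho1.
  move=> o o' C C' x x' oC o'C' xC x'C'.
  have [oj o'j] := (e_h_notj _ _ oC, e_h_notj _ _ o'C').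
  have Fg := F _ _ _ _ _ _ (e_h _ _ oC) (e_h _ _ o'C') xC x'C'.
  have [lo lo'] := (ltM _ _ _ (e_h _ _ oC) xC, ltM _ _ _ (e_h _ _ o'C') x'C').
  (* Shifted names start at [M] and the others stay below it, so faithfulness could fail only if a
     linked class were shifted in part. *)
  rewrite cl //; apply: (iff_trans _ Fg); apply: shift_eq => // e.
  case/Fg: e => ex lk; subst x'; apply/idP/idP; first exact: bnd_linked lk.
  by apply: bnd_linked; rewrite linked_sym.
pose T1 : lseq Sg := (tagged_ctx h rho1, lren (rho1 None) (ln A)).
have FT1 : flat_by h rho1 (H, A) T1 by split.
pose bs := flatten [seq [seq rho (Some d.1) x | x <- fv d.2 & bnd (Some d.1) x] | d <- decls gi].
have bsP y : y \in bs <-> exists a C x,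
    [/\ List.In (a, C) (decls gi), x \in fv C, bnd (Some a) x & y = rho (Some a) x].
  rewrite /bs mem_flatten_map_In; split=> [[[a C] aC /mapP[x]]|[a [C [x [aC xC bx ->]]]]].
    by rewrite mem_filter => /andP[bx xC] ->; exists a, C, x.
  by exists (a, C) => //; apply: map_f; rewrite mem_filter bx.
(* [kappa] takes a name of the kept copy to the name of the same variable in the dropped one; it is
   well defined because both copies have the same links ([cc]). *)
pose Q y z := exists a C x,
  [/\ List.In (a, C) (decls gi), x \in fv C, y = rho (Some a) x & z = rho (Some (f a)) x].
pose kappa y := epsilon (inhabits 0) (Q y).
have e_i a C : List.In (a, C) (decls gi) -> entry g A (Some a) C.
  by move=> /ck aC; apply: e_h.
have e_f a C : List.In (a, C) (decls gi) -> entry g A (Some (f a)) C.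
  by move=> /gij; exact: e_j.
have kappaE a C x : List.In (a, C) (decls gi) -> x \in fv C ->
    kappa (rho (Some a) x) = rho (Some (f a)) x.
  move=> aC xC; have : Q (rho (Some a) x) (kappa (rho (Some a) x)).
    by apply: epsilon_spec; exists (rho (Some (f a)) x), a, C, x.
  move=> [a' [C' [x' [a'C' x'C' e ->]]]].
  have [e' lk] := (F _ _ _ _ _ _ (e_i _ _ aC) (e_i _ _ a'C') xC x'C').1 e; subst x'.
  apply/esym/(F _ _ _ _ _ _ (e_f _ _ aC) (e_f _ _ a'C') xC x'C'); split=> //.
  by rewrite cc //; [exact: In_decls_name aC|exact: In_decls_name a'C'].
pose dd := [fset z in map (addn M) bs].
have ddP z : z \in dd <-> exists a C x,
    [/\ List.In (a, C) (decls gi), x \in fv C, bnd (Some a) x & z = (M + rho (Some a) x)%N].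
  rewrite in_fset /=; split=> [/mapP[y /bsP[a [C [x [aC xC bx ->]]]] ->]|[a [C [x [aC xC bx ->]]]]].
    by exists a, C, x.
  by apply: map_f; apply/bsP; exists a, C, x.
have dd_ge z : z \in dd -> M <= z by move=> /ddP[a [C [x [_ _ _ ->]]]]; lia.
have notdd o C x : entry g A o C -> x \in fv C -> rho o x \notin dd.
  by move=> oC xC; apply/negP => /dd_ge; have := ltM _ _ _ oC xC; lia.
pose sigma (i : bool) z := if z \in dd then (if i then (z - M)%N else kappa (z - M)%N) else z.
have sigmaE i a C x : List.In (a, C) (decls gi) -> x \in fv C -> bnd (Some a) x ->
    sigma i (M + rho (Some a) x)%N = rho (Some (if i then a else f a)) x.
  move=> aC xC bx; rewrite /sigma; have -> : (M + rho (Some a) x)%N \in dd.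
    by apply/ddP; exists a, C, x.
  by rewrite addKn; case: i => //; exact: kappaE xC.
have sigma1 o C x : entry h A o C -> x \in fv C -> sigma true (rho1 o x) = rho o x.
  move=> oC xC; rewrite /rho1; case: ifP => b; last first.
    by rewrite /sigma (negPf (notdd _ _ _ (e_h _ _ oC) xC)).
  case: o oC b => [a|//] aC b; case/andP: (b) => ai _.
  have [C' aC'] := (mem_names _ _).1 ai; have eC := In_decls_fun uh aC (ck _ aC'); subst C'.
  exact: (sigmaE true) aC' xC b.
have sigma2 a C x : List.In (a, C) (decls gi) -> x \in fv C ->
    sigma false (rho1 (Some a) x) = rho (Some (f a)) x.
  move=> aC xC; rewrite /rho1; case: ifP => b; first exact: (sigmaE false) aC xC b.
  rewrite /sigma (negPf (notdd _ _ _ (e_i _ _ aC) xC)).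
  apply/(F _ _ _ _ _ _ (e_i _ _ aC) (e_f _ _ aC) xC xC); split=> //; apply: cf.
    exact: In_decls_name aC.
  by move: b; rewrite /bnd (In_decls_name aC) => /negbT/negPn.
(* Each kept occurrence is its own first copy; only those in the contracted item have a second
   one. *)
pose nm := [seq (a, true, a) | a <- names h] ++ [seq (a, false, f a) | a <- names gi].
have nmP b i a : (b, i, a) \in nm <->
    (if i then b \in names h /\ a = b else b \in names gi /\ a = f b).
  rewrite mem_cat; split=> [/orP[/mapP[e eh' [-> -> ->]]|/mapP[e eh' [-> -> ->]]] //|].
  by case: i => -[bb ->]; apply/orP; [left|right]; apply/mapP; exists b.
exists T1, (DupData dd sigma nm); split; first exact: (flat_flattening FT1).
split=> /=.
- split=> /=.
  + by move=> i x /negPf xd; rewrite /sigma xd.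
  (* If the image were a name of [T1], a variable bound inside one copy would be linked to an
     occurrence kept in [H]. For the first copy, that occurrence would itself have a shifted name;
     for the second, the link would leave the dropped copy. *)
  + move=> i z /ddP[a [C [x [aC xC bx ->]]]]; rewrite (sigmaE _ _ _ _ aC xC bx).
    have oE : entry g A (Some (if i then a else f a)) C by case: (i); [exact: e_i|exact: e_f].
    rewrite (notdd _ _ _ oE xC); apply/negP => /(flat_lfv _ FT1)[o [C' [x' [/= oC' x'C']]]].
    rewrite /rho1; case b: (bnd o x') => e; first by have := ltM _ _ _ oE xC; rewrite e ltnNge leq_addr.
    have [ex lk] := (F _ _ _ _ _ _ oE (e_h _ _ oC') xC x'C').1 e; subst x'.
    case/andP: (bx) => ai nl; case: i oE e lk => oE e lk.
      by rewrite (bnd_linked _ _ _ lk bx) in b.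
    by have := cbc _ _ _ ai lk; rewrite (negPf nl) (e_h_notj _ _ oC').
  + move=> i j z w /ddP[a [C [x [aC xC bx ->]]]] /ddP[a' [C' [x' [a'C' x'C' bx' ->]]]].
    rewrite (sigmaE _ _ _ _ aC xC bx) (sigmaE _ _ _ _ a'C' x'C' bx').
    have [ai a'i] := (In_decls_name aC, In_decls_name a'C').
    (* The two images are disjoint, because a variable bound inside the kept copy has no link into
       the dropped one. *)
    have mixed b b' B B' y y' : List.In (b, B) (decls gi) -> List.In (b', B') (decls gi) ->
        y \in fv B -> y' \in fv B' -> bnd (Some b) y -> rho (Some b) y <> rho (Some (f b')) y'.
      move=> bB b'B' yB y'B' bb /(F _ _ _ _ _ _ (e_i _ _ bB) (e_f _ _ b'B') yB y'B')[_ lk].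
      case/andP: bb => bi nl; have := cb _ _ _ bi lk.
      by rewrite (negPf nl) (j_noti _ (fj _ (In_decls_name b'B'))).
    case: i; case: j => e.
    * by rewrite e.
    * by case: (mixed _ _ _ _ _ _ aC a'C' xC x'C' bx).
    * by case: (mixed _ _ _ _ _ _ a'C' aC x'C' xC bx').
    * case/(F _ _ _ _ _ _ (e_f _ _ aC) (e_f _ _ a'C') xC x'C'): e => ex lk; subst x'.
      split=> //; congr addn; apply/(F _ _ _ _ _ _ (e_i _ _ aC) (e_i _ _ a'C') xC x'C').
      by split=> //; rewrite -cc.
- split=> /=.
  + by move=> b i a a' /nmP h1 /nmP h2; case: i h1 h2 => -[_ ->] [_ ->].
  + move=> b b' i i' a /nmP h1 /nmP h2; case: i h1 => -[bh e]; case: i' h2 => -[b'h e'].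
    * by rewrite -e -e'.
    * by have := h_notj b bh; rewrite /= -e e' fj.
    * by have := h_notj b' b'h; rewrite /= -e' e fj.
    * by split=> //; apply: f_inj => //; rewrite -e -e'.
- by move=> b; rewrite dom_tagged => bh; exists true, b; apply/nmP.
- move=> a L; rewrite T1E In_tagged; split.
    move=> [C /cd[aC|aC] ->].
      exists a, true, (lren (rho1 (Some a)) (ln C)); split.
      + by apply/In_tagged; exists C.
      + by apply/nmP; split=> //; exact: In_decls_name aC.
      + rewrite lren_comp; apply: lren_ext => x; rewrite lfv_ln /= => xC.
        by rewrite (sigma1 (Some a) C).
    have [b bC ->] := gji _ _ aC.
    exists b, false, (lren (rho1 (Some b)) (ln C)); split.
    + by apply/In_tagged; exists C => //; exact: ck.
    + by apply/nmP; split=> //; exact: In_decls_name bC.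
    + rewrite lren_comp; apply: lren_ext => x; rewrite lfv_ln /= => xC.
      by rewrite (sigma2 b C).
  move=> [b [i [L0 [/In_tagged[C bC ->] /nmP bi ->]]]]; case: i bi => -[bb ->].
    exists C; first by apply/cd; left.
    rewrite lren_comp; apply: lren_ext => x; rewrite lfv_ln /= => xC.
    by rewrite (sigma1 (Some b) C).
  have [C' bC'] := (mem_names _ _).1 bb; have eC := In_decls_fun uh bC (ck _ bC'); subst C'.
  exists C; first by apply/cd; right; exact: gij.
  rewrite lren_comp; apply: lren_ext => x; rewrite lfv_ln /= => xC.
  by rewrite (sigma2 b C).
- exists true; rewrite T2E lren_comp; apply: lren_ext => x; rewrite lfv_ln /= => xA.
  by rewrite (sigma1 None A).
Qed.

(** * The functions G and H, and the scheme grammar *)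

Lemma cleaned_nf Sg (next : strategy Sg) G : next G = None -> cleaned next G = G.
Proof.
by move=> nG; rewrite /cleaned; elim: (weight 0 G) => //= n ->; rewrite /clean_step nG.
Qed.

Lemma cleaned_step Sg (next : strategy Sg) G e H :
  strategyP next -> next G = Some (e, H) -> cleaned next G = cleaned next H.
Proof.
move=> nextP nG; have := nextP G; rewrite nG => /(clean_weight 0) lt_w.
rewrite [LHS]/cleaned -(prednK (n := weight 0 G)); last by lia.
rewrite iterSr [X in iter _ _ X]/clean_step nG.
(* One of the [weight 0 G] iterations was the first step. Since the weight has dropped, at least
   [weight 0 H] remain, and any surplus leaves the normal form of [H] unchanged. *)
rewrite (_ : (weight 0 G).-1 = (weight 0 G).-1 - weight 0 H + weight 0 H)%N; last by lia.
rewrite iterD -/(cleaned next H); elim: (_ - _)%N => //= n ->.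
by rewrite /clean_step cleanedP.
Qed.

Lemma choose_flatteningP Sg (S : bseq Sg) : flattening S (choose_flattening S).
Proof. by apply: epsilon_spec; exact: flattening_exists. Qed.

Lemma flattening_is_flat Sg (S : bseq Sg) T : flattening S T -> flat S T.
Proof. by move=> /flattening_flat[g [rho [F _]]]; exists g, rho. Qed.

Lemma choose_renamingP Sg (S : bseq Sg) T T' :
  flat S T -> flat S T' -> alpha_via (choose_renaming T T') T T'.
Proof.
move=> FT FT'; exact: (epsilon_spec _ (fun r => alpha_via r T T') (flat_alpha FT FT')).
Qed.

Lemma choose_dupP Sg (G H : ctx Sg) A T (c := choose_dup (H, A) T) :
  clean true G H -> flat (G, A) T -> flattening (H, A) c.1 /\ partial_dup c.2 c.1 T.
Proof.
move=> GH FT; apply: (epsilon_spec (inhabits (([::], ln A), DupData fset0 (fun _ => id) [::]))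
  (fun p => flattening (H, A) p.1 /\ partial_dup p.2 p.1 T)).
by have [T1 [d h]] := flat_contract GH FT; exists (T1, d).
Qed.

Lemma strategy_clean Sg (next : strategy Sg) G e H :
  strategyP next -> next G = Some (e, H) -> clean e G H.
Proof. by move=> /(_ G) nextP e'; rewrite e' in nextP. Qed.

Lemma inG_sound Sg (next : strategy Sg) G A T T' u t :
  strategyP next -> inG next G A T T' u t -> flat (G, A) T ->
  flattening (cleaned next G, A) T' -> ljp T'.1 u T'.2 -> ljp T.1 t T.2.
Proof.
move=> nextP; elim=> {G A T T' u t} [G A T T' u nG|G H A T T' u t T1 nG _ IH|G H A T T' u t t' c nG _ _ Ft] FT FT' T'u.
- rewrite cleaned_nf // in FT'.
  exact: ljp_alpha (choose_renamingP (flattening_is_flat FT') FT) T'u.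
- have FT1 : flattening (H, A) T1 by exact: choose_flatteningP.
  rewrite (cleaned_step nextP nG) in FT'.
  have FT2 := flat_move (strategy_clean nextP nG) FT.
  apply: ljp_alpha (choose_renamingP (flattening_is_flat FT1) FT2) _.
  exact: IH (flattening_is_flat FT1) FT' T'u.
- exact: inF_sound Ft.
Qed.

(** [T] is a flattening only up to order, as re-rooting delivers it, while [T'] is the literal
    flattening to which H applies next. Renaming steps are undone by an inverse renaming and
    contractions by inverting F; the recursion is along the cleaning sequence, whose weights
    decrease. *)
Lemma inG_complete Sg (next : strategy Sg) G A T T' t :
  strategyP next -> flat (G, A) T -> flattening (cleaned next G, A) T' -> ljp T.1 t T.2 ->
  exists u, [/\ inG next G A T T' u t, ljp T'.1 u T'.2 & psize u = psize t].
Proof.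
move=> nextP; have [n le_n] := ubnP (weight 0 G).
elim: n => // n IH in G T t le_n * => FT FT' Tt.
case nG: (next G) => [[e H]|]; last first.
  rewrite cleaned_nf // in FT'.
  have al := choose_renamingP (flattening_is_flat FT') FT.
  have [u [T'u -> sz]] := ljp_alpha_surj al Tt.
  by exists u; split; rewrite ?psize_pren //; exact: inG_nf.
have GH := strategy_clean nextP nG; have lt_w := clean_weight 0 GH.
rewrite (cleaned_step nextP nG) in FT'.
case: e nG GH => nG GH.
  have [FT1 PD] := choose_dupP GH FT.
  have [v [T1v Fv szv]] := inF_complete PD Tt.
  have [|u [Gu T'u szu]] := IH H _ v _ (flattening_is_flat FT1) FT' T1v; first by lia.
  by exists u; split; rewrite ?szu //; exact: inG_dup Gu Fv.
have FT1 := choose_flatteningP (H, A).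
have FT2 := flat_move GH FT.
have [v [T1v -> szv]] := ljp_alpha_surj (choose_renamingP (flattening_is_flat FT1) FT2) Tt.
have [|u [Gu T'u szu]] := IH H _ v _ (flattening_is_flat FT1) FT' T1v; first by lia.
by exists u; split; rewrite ?psize_pren //; exact: inG_ren nG Gu.
Qed.

(** * Invariance of [good], and matching of implications *)

Lemma good_imp Sg (A B : form Sg) : good (Imp A B) -> good A && good B.
Proof.
rewrite /good /= cat_uniq all_cat => /andP[/and3P[uA _ uB] /andP[/allP hA /allP hB]].
rewrite uA uB; apply/andP; split; apply/allP => x xb.
  by have := hA x xb; rewrite mem_cat negb_or => /andP[].
by have := hB x xb; rewrite mem_cat negb_or => /andP[].
Qed.

Lemma good_all Sg x (A : form Sg) : good (All x A) -> good A.
Proof.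
rewrite /good /= => /andP[/andP[xA uA] /andP[_ /allP hA]]; rewrite uA; apply/allP => y yb.
have := hA y yb; rewrite mem_filter; apply: contraNN => ->; rewrite andbT.
by apply: contraNneq xA => <-.
Qed.

Lemma good_imps Sg As (P A : form Sg) : good (imps As P) -> List.In A As -> good A.
Proof.
elim: As => //= B As IH /good_imp/andP[gB /IH gAs] [<-|] //; exact: gAs.
Qed.

Definition good_ctx Sg (G : ctx Sg) : Prop := forall C, List.In C (leaves G) -> good C.

Lemma leaves_cat Sg (G H : ctx Sg) : leaves (G ++ H) = leaves G ++ leaves H.
Proof. by rewrite /leaves map_cat flatten_cat. Qed.

Lemma leaves_cons Sg I (G : ctx Sg) : leaves (I :: G) = leaves_item I ++ leaves G.
Proof. by []. Qed.

Lemma clean_leaves Sg e (G H : ctx Sg) C : clean e G H ->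
  List.In C (leaves H) -> List.In C (leaves G).
Proof.
elim=> {e G H} [a b V c I d _|a b V|a b c I J _|e a b V G H _ IH];
  rewrite !(leaves_cat, leaves_cons) /= -?/(leaves _) ?(leaves_cat, leaves_cons) ?In_cat;
  try tauto.
Qed.

Lemma good_cleaned Sg (next : strategy Sg) (G : ctx Sg) :
  strategyP next -> good_ctx G -> good_ctx (cleaned next G).
Proof.
move=> nextP gG; rewrite /cleaned; elim: (weight 0 G) => //= n; move: (iter _ _ _) => H gH.
rewrite /clean_step; have := nextP H; case: (next H) => // -[e K] HK C CK.
by apply: gH; exact: clean_leaves HK CK.
Qed.

Lemma focus_leaves Sg (acc G : ctx Sg) k V C Gs D : focus acc G k V C Gs ->
  List.In D (leaves Gs) -> List.In D (leaves (acc ++ G)).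
Proof.
elim=> {acc G k V C Gs} [acc a b C|acc a b V G k W C Gs _ IH].
  by rewrite !(leaves_cat, leaves_cons, In_cat) /=; tauto.
move=> /IH; rewrite !(leaves_cat, leaves_cons) /= -?/(leaves _) !In_cat.
by rewrite !leaves_cat !In_cat /=; tauto.
Qed.

Lemma ln_imps Sg As (P : form Sg) : ln (imps As P) = limps (map (@ln Sg) As) (ln P).
Proof. by elim: As => //= A As ->. Qed.

Lemma fv_imps Sg As (P A : form Sg) : List.In A As -> {subset fv A <= fv (imps As P)}.
Proof.
elim: As => //= B As IH [<-|AAs] x xA; rewrite mem_cat; first by rewrite xA.
by rewrite (IH AAs x xA) orbT.
Qed.

Lemma limps_inj Sg (As Bs : seq (lform Sg)) P Q :
  size As = size Bs -> limps As P = limps Bs Q -> As = Bs /\ P = Q.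
Proof.
by elim: As Bs => [|A As IH] [|B Bs] //= [sz] [-> e]; have [-> ->] := IH _ sz e.
Qed.

Lemma latomic_ln Sg (P : form Sg) : latomic (ln P) = atomic P.
Proof. by case: P. Qed.

Lemma limps_ln_inv Sg r Bs (B : lform Sg) (C : form Sg) : latomic B -> limps Bs B = lren r (ln C) ->
  exists As P, [/\ C = imps As P, Bs = [seq lren r (ln A) | A <- As], B = lren r (ln P) & atomic P].
Proof.
move=> B_at; elim: Bs C => [|B1 Bs IH] C /=.
  move=> e; exists [::], C; split=> //.
  by rewrite -latomic_ln -(latomic_lren r) -e.
case: C => //= C1 C [-> /IH[As [P [-> -> -> P_at]]]].
by exists (C1 :: As), P.
Qed.

(** Atoms bind nothing, so each is determined by its alpha-class. This turns the match of a head
    with its goal in LJ+ into the literal equality that (L->) demands of unquotiented LJB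
    formulas. *)
Lemma atomic_ln_inj Sg (P Q : form Sg) : atomic P -> ln P = ln Q -> P = Q.
Proof.
case: P => // p ts _; case: Q => //= q us [epq]; subst q => e; congr Atom.
apply/ffunP => i; have := congr1 (fun ts : {ffun _ -> _} => ts i) (inj_pair2 _ _ _ _ _ e).
rewrite !ffunE => ei; rewrite -[LHS]tmap_id -[RHS]tmap_id.
by apply: tmap_rel ei _ => v w _ _ [].
Qed.

Lemma good_bracket Sg (G : ctx Sg) x A : good_ctx G -> good_ctx (bracket_all G x A).
Proof. by move=> gG C; rewrite /leaves /= cats0; exact: gG. Qed.

Lemma good_rcons Sg (G : ctx Sg) A : good A -> good_ctx G -> good_ctx (rcons G (Leaf A)).
Proof.
by move=> gA gG C; rewrite -cats1 leaves_cat In_cat => -[/gG|/= [<-|]].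
Qed.

Lemma good_focus Sg (G : ctx Sg) k V C Gs : focus [::] G k V C Gs -> good_ctx G -> good_ctx Gs.
Proof. by move=> foc gG D /(focus_leaves foc); exact: gG. Qed.

Lemma leaves_erase Sg (g : seq (atree Sg)) : leaves (map (@erase Sg) g) = map snd (decls g).
Proof.
have l1 (i : atree Sg) : leaves_item (erase i) = map snd (idecls i).
  elim/atree_ind': i => //= V h IH; rewrite map_flatten_map -map_comp; congr flatten.
  exact: eq_map_In.
rewrite /leaves /decls map_flatten_map -map_comp; congr flatten; exact: eq_map.
Qed.

(** * Soundness and completeness of H *)

Lemma inH_sound Sg canon (next : strategy Sg) G A T p t :
  strategyP next -> inH canon next G A T p t -> flattening (G, A) T ->
  good A -> good_ctx G -> ljp T.1 t T.2.
Proof.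
move=> nextP; elim=> {G A T p t}
  [G k As A Gs D a' Bs B ps ss ts Gc lr szp _ kD szB szs szt _ IH HG|
   G x A1 D B B1 p s t y Gv Gc eB _ IH HG|G A1 A2 D B1 B2 p s t a' Ga Gc _ IH HG] FT gA gG /=.
- have [V [foc A_at _]] := lr.
  have [g [rho [FB eD]]] := flattening_flat FT.
  have [a [ka _ flat_s]] := flat_focus FB foc.
  have gC : good (imps As A).
    apply: gG; have [eg _ _ _ _] := FB; rewrite -[G]eg leaves_erase; apply/In_map.
    by exists (a, imps As A) => //; exact: onth_In ka.
  (* The declarations of [D] come in the order of the leaves, so position [k] holds the declaration
     of the focused occurrence [a], named by [rho (Some a)]. *)
  move: (kD); rewrite {1}[D]eD => /onth_map_Some[d]; rewrite ka => -[<-] /= [ea].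
  rewrite ln_imps lren_limps => /limps_inj[]; first by rewrite !size_map szB.
  move=> eBs eB; apply: (@ljp_L _ _ _ Bs); first exact: onth_In kD.
  + by rewrite eB latomic_lren latomic_ln.
  + by rewrite szt szB.
  move=> i Bi ti Bsi tsi.
  have [Ai Asi eBi] : exists2 Ai, onth As i = Some Ai & Bi = lren (rho (Some a)) (ln Ai).
    by move: Bsi; rewrite eBs => /onth_map_Some[_ /onth_map_Some[Ai Asi ->] ->]; exists Ai.
  have [pi psi] := onth_same_size (esym szp) Asi; have [si ssi] := onth_same_size (esym szs) Asi.
  have AiAs := onth_In Asi.
  have FS := choose_flatteningP (Gc, Ai).
  apply: (inG_sound nextP (HG _ _ _ _ _ Asi Bsi ssi tsi) _ FS).
    by rewrite eBi; apply: flat_s; exact: fv_imps.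
  apply: (IH _ _ _ _ Asi psi ssi FS); first exact: good_imps gC AiAs.
  by apply: good_cleaned => //; exact: good_focus foc gG.
- have [g [rho [FB _]]] := flattening_flat FT.
  have yT : y \notin lfv_seq (D, B) by exact: fresh_notin.
  have FS := choose_flatteningP (Gc, A1).
  have yD : y \notin lfv_ctx D by move: yT; rewrite mem_cat negb_or => /andP[].
  (* [y] is computed from [B], so it is generalized before [B] is rewritten. *)
  move: y yD yT eB => y yD yT eB; rewrite eB; apply: ljp_Rall => //.
  apply: (inG_sound nextP HG _ FS).
    by rewrite eB in FB yT; eexists; eexists; exact: flat_bracket gA FB yT.
  apply: (IH FS); first exact: good_all gA.
  by apply: good_cleaned => //; exact: good_bracket.
- have [g [rho [FB _]]] := flattening_flat FT.
  have aD : a' \notin dom D by exact: fresh_notin.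
  have FS := choose_flatteningP (Gc, A2); have /andP[gA1 gA2] := good_imp gA.
  apply: ljp_Rimp => //; apply: (inG_sound nextP HG _ FS).
    by eexists; eexists; exact: flat_rcons FB aD.
  by apply: (IH FS) => //; apply: good_cleaned => //; exact: good_rcons.
Qed.

Lemma inH_complete Sg canon (next : strategy Sg) G A T t :
  strategyP next -> flattening (G, A) T -> good A -> good_ctx G -> ljp T.1 t T.2 ->
  exists p, scheme_of canon next G A p /\ inH canon next G A T p t.
Proof.
move=> nextP; have [n le_n] := ubnP (psize t).
elim: n => // n IH in G A T t le_n *; case: T => D B FT gA gG /= Dt.
have [g [rho [FB /= eD]]] := flattening_flat FT; have [/= eg ug F _ eB] := FB.
case: t le_n Dt => [hd ts|t|t] le_n Dt.
- have [a [Bs [-> aD B_at sz Hts]]] := ljp_L_inv Dt.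
  have [k kD] := In_onth aD.
  move: (kD); rewrite {1}eD => /onth_map_Some[[b C] kg [eb eC]]; subst b.
  have [As [P [eCP eBs eBP P_at]]] := limps_ln_inv B_at eC; subst C.
  have bC := onth_In kg.
  have e_b : entry g A (Some a) (imps As P) by [].
  have e_A : entry g A None A by [].
  have fvP : {subset fv P <= fv (imps As P)}.
    by move=> x xP; elim: (As) => //= A0 As0 IHAs; rewrite mem_cat IHAs orbT.
  have eP : P = A.
    apply: atomic_ln_inj => //; apply: (lren_inj_in (r := id)) => //.
    apply: lren_rel (etrans (esym eBP) eB) _ => x y; rewrite !lfv_ln => xP yA /=.
    by case/(F _ _ _ _ _ _ e_b e_A (fvP _ xP) yA).
  subst P.
  have kl : onth (leaves G) k = Some (imps As A).
    by rewrite -eg leaves_erase; apply/onth_map_Some; exists (a, imps As A).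
  have [V [Gs foc]] := focus_exists kl [::].
  have [a0 [ka lV flat_s]] := flat_focus FB foc.
  move: ka; rewrite kg => -[ea]; subst a0.
  have lr : left_rule G k As A Gs.
    exists V; split=> //; apply/allP => x xA; rewrite lV negbK.
    (* The head and the goal have the same conclusion in LJ+, so corresponding free variables have
       equal names. By faithfulness they are linked, hence outside [V], and the side condition of
       (L->) holds. *)
    have exy : rho (Some a) x = rho None x.
      have : map (rho (Some a)) (fv A) = map (rho None) (fv A).
        by rewrite -lfv_ln -!lfv_lren -eBP -eB.
      by move/eq_in_map; apply.
    by case/(F _ _ _ _ _ _ e_b e_A (fvP _ xA) xA): exy.
  pose Gc := cleaned next Gs.
  have gGc : good_ctx Gc by apply: good_cleaned => //; exact: good_focus foc gG.
  have gC : good (imps As A) by apply: gG; exact: onth_In kl.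
  have step i : i < size As -> exists ps : scheme Sg * pterm, forall Ai t,
      onth As i = Some Ai -> onth ts i = Some t ->
      [/\ scheme_of canon next Gc Ai ps.1, inH canon next Gc Ai (choose_flattening (Gc, Ai)) ps.1 ps.2
        & inG next Gs Ai (D, lren (rho (Some a)) (ln Ai)) (choose_flattening (Gc, Ai)) ps.2 t].
    move=> lt_i; have [Ai Asi] := lt_onth lt_i.
    have szA : size As = size ts by rewrite sz eBs size_map.
    have [t tsi] := onth_same_size szA Asi; have AiAs := onth_In Asi.
    have FS := choose_flatteningP (Gc, Ai).
    have Dti : ljp D t (lren (rho (Some a)) (ln Ai)).
      by apply: (Hts i) => //; rewrite eBs; apply/onth_map_Some; exists Ai.
    have [s [Gst Ss szs]] := inG_complete (T := (D, lren (rho (Some a)) (ln Ai))) nextP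
       (flat_s Ai (fv_imps A AiAs)) FS Dti.
    have [|p [sp Hp]] := IH Gc Ai _ s _ FS (good_imps gC AiAs) gGc Ss.
      by rewrite szs; have := psize_In hd (onth_In tsi); lia.
    by exists (p, s) => Ai' t'; rewrite Asi tsi => -[<-] [<-].
  have [pss [sz_pss Hpss]] := list_choice step.
  have tsE i x : onth As i = Some x -> exists t, onth ts i = Some t.
    by apply: onth_same_size; rewrite sz eBs size_map.
  exists (SApp (canon (imps As A)) (map fst pss)); split.
    apply: scheme_L lr _ _; first by rewrite size_map.
    move=> i Ai p Asi /onth_map_Some[q qi ->]; have [t tsi] := tsE _ _ Asi.
    by case: (Hpss i q qi Ai t Asi tsi).
  apply: (@inH_L _ _ _ _ _ _ _ _ _ _ Bs _ _ (map snd pss)).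
  + exact: lr.
  + by rewrite size_map.
  + move=> i Ai p Asi /onth_map_Some[q qi ->]; have [t tsi] := tsE _ _ Asi.
    by case: (Hpss i q qi Ai t Asi tsi).
  + exact: kD.
  + by rewrite eBs size_map.
  + by rewrite size_map.
  + by rewrite sz eBs size_map.
  + move=> i Ai p s Asi /onth_map_Some[q qi ->] /onth_map_Some[q']; rewrite qi => -[<-] ->.
    by have [t tsi] := tsE _ _ Asi; case: (Hpss i q qi Ai t Asi tsi).
  + move=> i Ai Bi s t Asi; rewrite eBs => /onth_map_Some[Ai']; rewrite Asi => -[<-] ->.
    by move=> /onth_map_Some[q qi ->] tsi; case: (Hpss i q qi Ai t Asi tsi).
- pose y := fresh (lfv_seq (D, B)).
  have yT : y \notin lfv_seq (D, B) by exact: fresh_notin.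
  have /norP[yD yB] : ~~ ((y \in lfv_ctx D) || (y \in lfv B)) by rewrite -mem_cat.
  have [B1 eB1 Dt1] := ljp_Rall_inv Dt yD yB.
  case: A FT gA FB F eB => [||x A1] //=; try by rewrite eB1.
  move=> FT gA FB F eB.
  pose Gc := cleaned next (bracket_all G x A1).
  have FS := choose_flatteningP (Gc, A1).
  have fl : flat (bracket_all G x A1, A1) (D, B1).
    move: (y) yT eB1 => z zT eB1; rewrite eB1 in FB zT.
    by eexists; eexists; exact: flat_bracket gA FB zT.
  have [s [Gst Ss szs]] := inG_complete nextP fl FS Dt1.
  have [||p [sp Hp]] := IH Gc A1 _ s _ FS (good_all gA) _ Ss.
  + by rewrite szs.
  + by apply: good_cleaned => //; exact: good_bracket.
  exists (SAll x p); split; first exact: scheme_Rall.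
  exact: inH_Rall eB1 Hp Gst.
- pose a' := fresh (dom D).
  have aD : a' \notin dom D by exact: fresh_notin.
  have [B1 [B2 [u [eB1 et Du]]]] := ljp_Rimp_inv Dt aD.
  case: A FT gA FB F eB => [|A1 A2|] //=; try by rewrite eB1.
  move=> FT gA FB F eB; subst B; rewrite et.
  pose Gc := cleaned next (rcons G (Leaf A1)).
  have FS := choose_flatteningP (Gc, A2); have /andP[gA1 gA2] := good_imp gA.
  have fl : flat (rcons G (Leaf A1), A2) (rcons D (a', B1), B2).
    by eexists; eexists; exact: flat_rcons FB aD.
  have [s [Gst Ss szs]] := inG_complete nextP fl FS Du.
  have [||p [sp Hp]] := IH Gc A2 _ s _ FS gA2 _ Ss.
  + by rewrite szs; move: le_n; rewrite et /= psize_pbind.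
  + by apply: good_cleaned => //; exact: good_rcons.
  exists (SLam (canon A1) A1 p); split; first exact: scheme_Rimp.
  exact: inH_Rimp Hp Gst.
Qed.

(** * Schemes as words of the grammar *)

Lemma derives_trans_map Sg (canon : form Sg -> nat) (next : strategy Sg) S0 (f : word Sg -> word Sg) v w :
  (forall v w, derives1 canon next S0 v w -> derives1 canon next S0 (f v) (f w)) ->
  clos_refl_trans _ (derives1 canon next S0) v w ->
  clos_refl_trans _ (derives1 canon next S0) (f v) (f w).
Proof.
move=> H; elim=> {v w} [v w vw|v|u v w _ uv _ vw]; first by apply: rt_step; exact: H.
  exact: rt_refl.
exact: rt_trans uv vw.
Qed.

(** Arguments are rewritten from left to right; [us] holds those already finished. *)
Lemma derives_args Sg (canon : form Sg -> nat) (next : strategy Sg) S0 a us vs ws :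
  size vs = size ws ->
  (forall i v w, onth vs i = Some v -> onth ws i = Some w ->
     clos_refl_trans _ (derives1 canon next S0) v w) ->
  clos_refl_trans _ (derives1 canon next S0) (WApp a (us ++ vs)) (WApp a (us ++ ws)).
Proof.
elim: vs ws us => [|v vs IH] [|w ws] us //= => [_ _|[sz] H]; first exact: rt_refl.
apply: (@rt_trans _ _ _ (WApp a (us ++ w :: vs))).
  apply: (derives_trans_map (f := fun v => WApp a (us ++ v :: vs))); last exact: (H 0).
  by move=> v' w'; exact: derives_App.
rewrite -!cat_rcons; apply: IH => // i; exact: (H i.+1).
Qed.

(** Reachability is carried along the scheme derivation because a non-terminal may be rewritten only
    when it is reachable from [S0]. *)
Lemma scheme_generated Sg (canon : form Sg -> nat) (next : strategy Sg) S0 G A p :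
  scheme_of canon next G A p -> reachable canon next S0 (G, A) ->
  clos_refl_trans _ (derives1 canon next S0) (NT (G, A)) (terminal p).
Proof.
elim=> {G A p} [G k As P Gs ps lr sz _ IH|G x A p _ IH|G A B p _ IH] rS /=.
- have pr := prod_L canon next lr.
  apply: rt_trans (rt_step _ _ _ _ (derives_NT rS pr)) _.
  apply: (@derives_args _ _ _ _ _ [::]); first by rewrite !size_map sz.
  move=> i _ _ /onth_map_Some[A Ai ->] /onth_map_Some[p pi ->].
  apply: (IH i) => //; apply: reach_step rS pr _.
  apply/In_flatten_map; exists (NT (cleaned next Gs, A)); last by left.
  by apply/In_map; exists A => //; exact: onth_In Ai.
- have pr := prod_Rall canon next G x A.
  apply: rt_trans (rt_step _ _ _ _ (derives_NT rS pr)) _.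
  apply: (derives_trans_map (f := WAll x)) => [v w|]; first exact: derives_All.
  by apply: IH; apply: reach_step rS pr _; left.
- have pr := prod_Rimp canon next G A B.
  apply: rt_trans (rt_step _ _ _ _ (derives_NT rS pr)) _.
  apply: (derives_trans_map (f := WLam (canon A) A)) => [v w|]; first exact: derives_Lam.
  by apply: IH; apply: reach_step rS pr _; left.
Qed.

Theorem theorem1 (Sg : signature)
    (canon : form Sg -> nat) (canon_inj : injective canon)
    (next : strategy Sg) (nextP : strategyP next)
    (A : form Sg) (A_pos : positive A)
    (A' : form Sg) (A'_variant : ln A' = ln A) (A'_norm : normalized ([::], A'))
    (t : pterm) :
  ljp [::] t (ln A) <->
  exists p : scheme Sg,
    generated canon next ([::], A') p /\
    inH canon next [::] A' ([::], ln A') p t.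
Proof.
(* With an empty context, [normalized] computes to [good]. *)
have gA : good A' := A'_norm.
have gE : good_ctx (Sg := Sg) [::] by move=> C [].
have FT : flattening ([::], A') ([::], ln A').
  exists ([::], A'); split=> //; split=> //; exists id; split=> //=; first exact: cvariant_nil.
  by rewrite lren_id.
rewrite -A'_variant; split=> [At|[p [_ Hp]]]; last exact: (inH_sound nextP Hp FT).
have [p [sp Hp]] := inH_complete canon nextP FT gA gE At.
by exists p; split=> //; apply: scheme_generated sp _; exact: reach_init.
Qed.
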